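(* For every $s \in \mathbb{N}$ there exists $n_0 = n_0(s)$ such that, for every $n \ge n_0$, $$r(K_s,Q_n) = (s-1)(2^n-1)+1.$$
   Context: $K_s$ is the complete graph on $s$ vertices. $Q_n$ is the $n$-dimensional hypercube: the graph with vertex set $\{0,1\}^n$ in which two vertices are adjacent if and only if they differ in exactly one coordinate. For graphs $G$ and $H$, $r(G,H)$ is the minimum integer $N$ such that every red-blue colouring of the edges of $K_N$ contains either a blue copy of $G$ or a red copy of $H$ (as a not necessarily induced subgraph). $\mathbb{N}$ denotes the positive integers. *)

(* Defs.v *)
From mathcomp Require Import all_boot.

Set Implicit Arguments.
Unset Strict Implicit.
Unset Printing Implicit Defensive.

Record sgraph := SGraph {
  vertex :> finType;
  adj : rel vertex;
  adj_sym : symmetric adj;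
  adj_irr : irreflexive adj }.

Fact complete_sym s : symmetric (fun x y : 'I_s => x != y).
Proof. by move=> x y; rewrite eq_sym. Qed.

Fact complete_irr s : irreflexive (fun x y : 'I_s => x != y).
Proof. by move=> x; rewrite eqxx. Qed.

Definition complete_graph (s : nat) : sgraph :=
  SGraph (@complete_sym s) (@complete_irr s).

Definition hypercube_adj (n : nat) : rel {ffun 'I_n -> bool} :=
  fun x y => #|[set i | x i != y i]| == 1.

Fact hypercube_sym n : symmetric (@hypercube_adj n).
Proof.
move=> x y; rewrite /hypercube_adj; congr (_ == _).
by apply: eq_card => i; rewrite !inE eq_sym.
Qed.

Fact hypercube_irr n : irreflexive (@hypercube_adj n).
Proof.
move=> x; rewrite /hypercube_adj (_ : [set i | x i != x i] = set0) ?cards0 //.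
by apply/setP=> i; rewrite !inE eqxx.
Qed.

Definition hypercube (n : nat) : sgraph :=
  SGraph (@hypercube_sym n) (@hypercube_irr n).

(* A copy of [H] in [G] need not be induced: only adjacency is preserved. *)
Definition has_copy (G H : sgraph) : Prop :=
  exists f : H -> G, injective f /\ forall x y, adj x y -> adj (f x) (f y).

Definition blue : bool := false.
Definition red : bool := true.

(* An edge {x, y} is represented by the set [set x; y]; the values of [c] on
   sets that are not edges of [G] are never used. *)
Definition colour_adj (G : sgraph) (c : {set G} -> bool) (b : bool) : rel G :=
  fun x y => adj x y && (c [set x; y] == b).

Fact colour_sym (G : sgraph) (c : {set G} -> bool) b :
  symmetric (colour_adj c b).
Proof. by move=> x y; rewrite /colour_adj adj_sym setUC. Qed.

Fact colour_irr (G : sgraph) (c : {set G} -> bool) b :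
  irreflexive (colour_adj c b).
Proof. by move=> x; rewrite /colour_adj adj_irr. Qed.

Definition colour_class (G : sgraph) (c : {set G} -> bool) (b : bool) : sgraph :=
  SGraph (colour_sym c b) (colour_irr c b).

Definition ramsey_prop (G H : sgraph) (N : nat) : Prop :=
  forall c : {set complete_graph N} -> bool,
    has_copy (colour_class c blue) G \/ has_copy (colour_class c red) H.

(* [is_ramsey_number G H N] means r(G, H) = N. *)
Definition is_ramsey_number (G H : sgraph) (N : nat) : Prop :=
  ramsey_prop G H N /\ forall M : nat, ramsey_prop G H M -> N <= M.

(* Main.v *)
Require Import Defs.
From mathcomp Require Import all_boot all_order all_algebra perm.
From mathcomp Require Import zify ring lra.

(* For the lower bound, colour by s - 1 disjoint red cliques on 2^n - 1 vertices.
   For the upper bound, let e be a K_s-free blue graph on (s-1)(2^n-1)+1 vertices;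
   we look for a red Q_n.

   Embedding. Cut Q_n into subcubes (cells), reserve a vertex set (pool) for
   each cell, with few blue edges inside a pool and between the pools of adjacent
   cells, and refine the cells one batch of coordinates at a time. When a vertex
   has too many blue neighbours in its own pool, these neighbours span no blue
   clique of the previous size and they become the pool of the cell: the clique
   number of a pool drops, so this stops, and at the end cells are vertices.

   Rough structure. Moving large blue neighbourhoods to new colours, whose clique
   number is smaller, colours V with 2^x colours so that the blue degrees inside
   colour classes are tiny compared with any given function of x. Link two classes
   that contain large subsets with few blue edges in between. A link component of
   more than (1 + eta) 2^n vertices yields a path of sparse pools, which receives
   the cube layer by layer. Otherwise, by pigeonhole over many scales, some fixed
   partition has its parts pairwise dense at s scales; since there is no blue K_s,
   there are s - 1 parts, of about 2^n vertices, and every vertex has small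
   blue degree to one of them.

   Bootstrapping. Suppose that blue degrees to the own part are at most 2^n / 2^j.
   If two parts contain many disjoint sparse pairs, these are placed on a code of
   minimum distance 4 among the cells and provide room for a cube; otherwise,
   deleting a maximal family of such pairs leaves parts that are dense at a much
   finer scale, which improves j to j + 1. Once 64 n <= 2^j, a part with at least
   2^n vertices contains a red cube by an exchange argument. *)

Set Implicit Arguments.
Unset Strict Implicit.
Unset Printing Implicit Defensive.

Import Order.TTheory GRing.Theory Num.Theory.

(** * Blue cliques and sparse subsets *)

(** The refinement of pools always wastes something: a pool must exceed the cells that it serves by
    a small proportion. The colouring of the lower bound has parts of [2^n - 1] vertices, so
    refinement alone cannot reach the exact number. The last vertex is won by [exact_cube], which
    wastes nothing but needs blue degrees below [2^n / (64 n)]; hence the climb of [j] from a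
    constant to about [log n]. One round of the climb is affordable because its densities are powers
    [2^-d] with [d] linear in [log j], while the degree bound at hand is [2^-j]. Refinement wastes
    little because stage [j] opens [O(j)] coordinates and charges [2^-j] to each, a convergent
    series. A second obstacle: a vertex attached to a part has few blue neighbours in the core [U i]
    of that part, but nothing is known among the attached vertices. They are therefore used through
    sparse pieces, or singly at pairwise non-adjacent positions; this dictates the leaves of the
    ladder and the role of parity. *)

Lemma card_bigcup_leq_sum (I T : finType) (P : pred I) (F : I -> {set T}) :
  #|\bigcup_(i | P i) F i| <= \sum_(i | P i) #|F i|.
Proof.
elim/big_ind2: _ => [|A1 n1 A2 n2 h1 h2|i _]; rewrite ?cards0 //.
by apply: leq_trans (leq_card_setU _ _).1 _; apply: leq_add.
Qed.

Section Blue.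
Variables (V : finType) (e : rel V).
Hypotheses (e_sym : symmetric e) (e_irr : irreflexive e).
Implicit Types (u v : V) (A B C T : {set V}).

Definition nbhd v : {set V} := [set u | e v u].
Definition deg v B := #|nbhd v :&: B|.
Definition edges A B := \sum_(a in A) deg a B.
Definition clique C := [forall x in C, forall y in C, (x != y) ==> e x y].
(* No blue clique of r vertices: [kfree 1 A] means that A is empty. *)
Definition kfree r A := [forall C : {set V}, (C \subset A) && clique C ==> (#|C| < r)].

Lemma cliqueP C :
  reflect {in C &, forall x y, x != y -> e x y} (clique C).
Proof.
apply: (iffP forall_inP) => [h x y xC yC xy|h x xC].
  by have /forall_inP/(_ y yC)/implyP/(_ xy) := h x xC.
by apply/forall_inP => y yC; apply/implyP; apply: h.
Qed.

Lemma kfreeP r A :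
  reflect (forall C, C \subset A -> clique C -> #|C| < r) (kfree r A).
Proof.
apply: (iffP forallP) => [h C CA cC|h C]; first by have /implyP := h C; rewrite CA cC; apply.
by apply/implyP => /andP[CA cC]; apply: h.
Qed.

Lemma kfreeS r A B : B \subset A -> kfree r A -> kfree r B.
Proof.
by move=> BA /kfreeP h; apply/kfreeP => C CB; apply: h; apply: subset_trans BA.
Qed.

Lemma clique0 : clique set0.
Proof. by apply/cliqueP => x y; rewrite inE. Qed.

Lemma kfree_gt0 r A : kfree r A -> 0 < r.
Proof. by move=> /kfreeP/(_ set0 (sub0set _) clique0); rewrite cards0. Qed.

Lemma kfree1 A : kfree 1 A -> A = set0.
Proof.
move=> /kfreeP h; apply/setP => x; rewrite inE; apply/negP => xA.
suff : #|[set x]| < 1 by rewrite cards1.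
apply: h; first by rewrite sub1set.
by apply/cliqueP => y z; rewrite !inE => /eqP-> /eqP->; rewrite eqxx.
Qed.

Lemma clique_cons v C : C \subset nbhd v -> clique C -> clique (v |: C).
Proof.
move=> Cv /cliqueP cC; apply/cliqueP => x y.
rewrite !inE => /orP[/eqP->|xC] /orP[/eqP->|yC]; rewrite ?eqxx // => xy.
- by have := subsetP Cv _ yC; rewrite inE.
- by have := subsetP Cv _ xC; rewrite inE e_sym.
- exact: cC.
Qed.

Lemma card_cons_nbhd v C : C \subset nbhd v -> #|v |: C| = #|C|.+1.
Proof.
move=> Cv; rewrite cardsU1; suff -> : v \notin C by [].
by apply/negP => /(subsetP Cv); rewrite inE e_irr.
Qed.

Lemma kfree_nbhd r v A : v \in A -> kfree r.+1 A -> kfree r (nbhd v :&: A).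
Proof.
move=> vA /kfreeP h; apply/kfreeP => C /subsetIP[Cv CA] cC.
rewrite -ltnS -(card_cons_nbhd Cv); apply: h; last exact: clique_cons.
by rewrite subUset sub1set vA.
Qed.

Lemma deg_sub v A B : A \subset B -> deg v A <= deg v B.
Proof. by move=> AB; apply/subset_leq_card/setIS. Qed.

Lemma degE v A : deg v A = \sum_(u in A) (e v u : nat).
Proof.
rewrite /deg -sum1_card big_mkcond [RHS]big_mkcond; apply: eq_bigr => u _.
by rewrite !inE; case: (e v u); case: (u \in A).
Qed.

Lemma edgesC A B : edges A B = edges B A.
Proof.
rewrite /edges; under eq_bigr => a _ do rewrite degE.
rewrite exchange_big /=; apply: eq_bigr => b _; rewrite degE.
by apply: eq_bigr => a _; rewrite e_sym.
Qed.

Lemma edgesS A A' B B' : A \subset A' -> B \subset B' -> edges A B <= edges A' B'.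
Proof.
move=> AA BB; rewrite /edges [X in _ <= X](big_setID A) /= (setIidPr AA).
by apply: leq_trans (leq_addr _ _); apply: leq_sum => a _; apply: deg_sub.
Qed.

Lemma edges_leq (k : nat) A B :
  {in A, forall a, deg a B <= k} -> edges A B <= #|A| * k.
Proof. by move=> h; rewrite -sum_nat_const; apply: leq_sum. Qed.

Lemma dense_vertex (A B : {set V}) D : #|A| * #|B| < edges A B * D ->
  exists2 v, v \in A & #|B| <= deg v B * D.
Proof.
move=> hE; have [/exists_inP[v vA hv]|/exists_inPn hD] := boolP [exists v in A, #|B| <= deg v B * D].
  by exists v.
move: hE; rewrite ltnNge /edges big_distrl /= -sum_nat_const; case/negP; apply: leq_sum => v vA.
by have := hD v vA; rewrite -ltnNge => /ltnW.
Qed.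

Section Markov.
Variable R : realFieldType.
Local Open Scope ring_scope.

Lemma edges_ler (k : R) A B :
  {in A, forall a, (deg a B)%:R <= k} -> (edges A B)%:R <= #|A|%:R * k.
Proof.
move=> h; rewrite /edges natr_sum mulr_natl -sumr_const.
by apply: ler_sum => a aA; apply: h.
Qed.

Lemma markov (k : R) A B : 
  #|[set a in A | k < (deg a B)%:R]|%:R * k <= (edges A B)%:R.
Proof.
rewrite /edges natr_sum (big_setID [set a in A | k < (deg a B)%:R]) /=.
set S := [set a in A | _]; have SA : S \subset A by apply/subsetP => x; rewrite inE => /andP[].
rewrite (setIidPr SA) -[leLHS]addr0; apply: lerD.
  by rewrite mulr_natl -sumr_const; apply: ler_sum => a; rewrite inE => /andP[_ /ltW].
by apply: sumr_ge0 => a _; rewrite ler0n.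
Qed.

End Markov.
End Blue.

Lemma card_subset_exists (T : finType) (A : {set T}) k :
  k <= #|A| -> exists2 B : {set T}, B \subset A & #|B| = k.
Proof.
move=> kA; exists [set x in take k (enum A)].
  by apply/subsetP => x; rewrite inE => /mem_take; rewrite mem_enum.
rewrite cardsE (card_uniqP _) ?take_uniq ?enum_uniq // size_take -cardE.
by move: kA; rewrite leq_eqVlt => /orP[/eqP->|->] //; rewrite ltnn.
Qed.

Section Blue.
Variables (V : finType) (e : rel V).
Hypotheses (e_sym : symmetric e) (e_irr : irreflexive e).
Implicit Types (u v : V) (A B C T Y : {set V}).
Local Notation deg := (deg e).
Local Notation edges := (edges e).

Lemma edges_avg A B X :
  0 < #|A| -> edges A B <= X -> exists2 a, a \in A & deg a B * #|A| <= X.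
Proof.
move=> A0 AB; apply/exists_inP.
have [//|/exists_inPn h] := boolP [exists a in A, deg a B * #|A| <= X].
suff : #|A| * X.+1 <= #|A| * edges A B.
  by rewrite leq_mul2l -(negbK (_ == 0)) -lt0n A0 /= ltnNge AB.
rewrite [#|A| * edges _ _]mulnC /edges big_distrl /= -sum_nat_const.
by apply: leq_sum => a aA; rewrite ltnNge h.
Qed.

Lemma edgesU1 y Y : y \notin Y -> edges (y |: Y) (y |: Y) = edges Y Y + (deg y Y).*2.
Proof.
move=> yY; have degU v : deg v (y |: Y) = e v y + deg v Y.
  by rewrite !degE big_setU1.
rewrite /edges big_setU1 //= degU e_irr.
rewrite (eq_bigr (fun v => e v y + deg v Y)); last by move=> v _; rewrite degU.
rewrite big_split /= -addnn.
have -> : \sum_(i in Y) e i y = deg y Y by rewrite degE; apply: eq_bigr => i _; rewrite e_sym.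
by rewrite add0n; lia.
Qed.

(** Always add the vertex of [T :\: Y] with the fewest neighbours in [Y]: by averaging it has at
    most [k * D / (#|T| - k)] of them, hence at most [2 * k * D / #|T|], and [edges Y Y] counts each
    new edge twice. *)
Lemma greedy_sparse D T k : {in T, forall u, deg u T <= D} -> k.*2 <= #|T| ->
  exists Y, [/\ Y \subset T, #|Y| = k & edges Y Y * #|T| <= 4 * k ^ 2 * D].
Proof.
move=> hD; elim: k => [|k IH] kT.
  by exists set0; rewrite sub0set cards0 /edges big_set0.
have [|Y [YT Yk YE]] := IH; first by apply: leq_trans kT; rewrite leq_double.
have cTY : #|T :\: Y| = #|T| - k by rewrite cardsD (setIidPr YT) Yk.
have kk : k.+1.*2 = k.*2.+2 by []. 
have TY0 : 0 < #|T :\: Y| by rewrite cTY; lia.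
have [|y /setDP[yT yY] hy] := @edges_avg (T :\: Y) Y (k * D) TY0.
  rewrite edgesC // -Yk; apply: edges_leq => a aY.
  by apply: leq_trans (hD a (subsetP YT _ aY)); apply: deg_sub; apply: subsetDl.
exists (y |: Y); rewrite subUset sub1set yT YT cardsU1 yY Yk; split=> //.
rewrite edgesU1 // mulnDl.
have : deg y Y * #|T| <= 2 * (k * D).
  have : #|T| <= 2 * #|T :\: Y| by rewrite cTY; lia.
  by move=> h; nia.
by move: YE; rewrite -!mulnn -addnn; nia.
Qed.

(** Either some neighbourhood is large enough for induction on [r], or all degrees are a factor
    [16 * K] below [#|T|]. Then [greedy_sparse] with [2 * M] vertices gives [edges Y Y * K <= M^2],
    so at most [M] of them have too large a degree. The constant 16 is [4 * 2^2]. *)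
Lemma sparse_subset r K M T : 0 < K -> 0 < M ->
  kfree e r T -> M * (16 * K) ^ r <= #|T| ->
  exists Y, [/\ Y \subset T, #|Y| = M & {in Y, forall u, deg u Y * K <= M}].
Proof.
move=> K0 M0; elim: r T => [|r IH] T kT cT; first by have := kfree_gt0 kT.
have [/exists_inP[v vT hv]|/exists_inPn hD] :=
    boolP [exists v in T, M * (16 * K) ^ r <= deg v T].
  have [Y [YT cY hY]] := IH (nbhd e v :&: T) (kfree_nbhd e_sym e_irr vT kT) hv.
  by exists Y; split=> //; apply: subset_trans YT (subsetIr _ _).
set D := M * (16 * K) ^ r in hD.
have D0 : M <= D by rewrite /D leq_pmulr // expn_gt0; lia.
have TD : 16 * K * D <= #|T| by move: cT; rewrite expnS /D; nia.
have hT : {in T, forall u, deg u T <= D} by move=> u /hD; rewrite -ltnNge => /ltnW.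
have [|Y [YT cY hY]] := @greedy_sparse D T M.*2 hT; first by rewrite -!addnn; nia.
pose S := [set u in Y | M < deg u Y * K].
have SE : #|S| * M <= edges Y Y * K.
  rewrite /edges big_distrl /= (big_setID S) /= -[X in X <= _]addn0.
  apply: leq_add => //; rewrite -sum_nat_const.
  have -> : Y :&: S = S by apply/setIidPr/subsetP => x; rewrite inE => /andP[].
  by apply: leq_sum => x; rewrite inE => /andP[_ /ltnW].
have SM : #|S| <= M.
  have T0 : 0 < #|T| by apply: leq_trans TD; rewrite !muln_gt0 K0 /=; lia.
  have : #|S| * M * #|T| <= 16 * M ^ 2 * D * K.
    move: hY; rewrite -[M.*2]muln2 expnMn => hY.
    apply: (@leq_trans (edges Y Y * #|T| * K)); last by nia.
    by rewrite [leqRHS]mulnAC leq_mul2r SE orbT.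
  move=> h; have : #|S| * (M * (16 * K * D)) <= M * (M * (16 * K * D)).
    by apply: leq_trans (_ : #|S| * (M * #|T|) <= _); rewrite ?leq_mul2l ?TD ?orbT //; nia.
  have P0 : 0 < M * (16 * K * D) by rewrite !muln_gt0 M0 K0 /=; lia.
  by rewrite leq_pmul2r.
have [|Z ZY cZ] := @card_subset_exists _ (Y :\: S) M.
  rewrite cardsD (_ : Y :&: S = S) ?cY; last by apply/setIidPr/subsetP => x; rewrite inE => /andP[].
  by rewrite -addnn; lia.
exists Z; split=> //; first by apply: subset_trans (subset_trans ZY (subsetDl _ _)) YT.
move=> u /(subsetP ZY)/setDP[uY]; rewrite inE uY /= -leqNgt => h.
apply: leq_trans h; rewrite leq_mul2r deg_sub ?orbT //.
exact: subset_trans ZY (subsetDl _ _).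
Qed.
End Blue.

(** * Embedding a red cube by refining pools *)

Section Cube.
Variable m : nat.
Definition cube := {ffun 'I_m -> bool}.
Implicit Types (x y z : cube) (t : 'I_m).

Definition flip x t : cube := [ffun i => (i == t) (+) x i].
(** The classes of [agree c] are the cells of depth [c]: subcubes of dimension [m - c], with the
    first [c] coordinates fixed. *)
Definition agree c x y := [forall i : 'I_m, (i < c) ==> (x i == y i)].

Lemma agreeP c x y : reflect (forall i : 'I_m, i < c -> x i = y i) (agree c x y).
Proof.
apply: (iffP forallP) => [h i ic|h i]; first by have := h i; rewrite ic => /eqP.
by apply/implyP => ic; rewrite h.
Qed.

Lemma agree_refl c x : agree c x x.
Proof. exact/agreeP. Qed.

Lemma agree_sym c x y : agree c x y = agree c y x.
Proof. by apply/agreeP/agreeP => h i ic; rewrite h. Qed.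

Lemma agree_trans c y x z : agree c x y -> agree c y z -> agree c x z.
Proof. by move=> /agreeP h /agreeP h'; apply/agreeP => i ic; rewrite h ?h'. Qed.

Lemma agree_leq c c' x y : c <= c' -> agree c' x y -> agree c x y.
Proof. by move=> cc /agreeP h; apply/agreeP => i ic; apply/h/(leq_trans ic). Qed.

Lemma agree_full x y : agree m x y -> x = y.
Proof. by move=> /agreeP h; apply/ffunP => i; apply: h. Qed.

Lemma flipK t : involutive (flip^~ t).
Proof. by move=> x; apply/ffunP => i; rewrite !ffunE addKb. Qed.

Lemma agree_flip c x y t : agree c (flip x t) (flip y t) = agree c x y.
Proof.
apply/agreeP/agreeP => h i ic; last by rewrite !ffunE h.
by have := h i ic; rewrite !ffunE => /addbI.
Qed.

Lemma agree_flipr c x t : agree c x (flip x t) = (c <= t).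
Proof.
apply/agreeP/idP => [h|ct i ic].
  by rewrite leqNgt; apply/negP => /h; rewrite ffunE eqxx; case: (x t).
rewrite ffunE; case: eqP => // it; subst i.
by move: ic; rewrite ltnNge ct.
Qed.

Lemma card_cell c x : c <= m -> #|[set y | agree c x y]| = 2 ^ (m - c).
Proof.
move=> cm.
pose P (i : 'I_m) : pred bool := if i < c then pred1 (x i) else predT.
have -> : #|[set y | agree c x y]| = #|(family P : pred {ffun 'I_m -> bool})|.
  rewrite cardsE; apply: eq_card => y; rewrite !inE; apply/agreeP/familyP => h i.
    by rewrite /P; case: ifP => // ic; rewrite inE h.
  by move=> ic; have := h i; rewrite /P ic inE => /eqP.
rewrite card_family foldrE big_map big_enum /= (bigID (fun i : 'I_m => i < c)) /=.
rewrite big1 ?mul1n; last by move=> i ic; rewrite /P ic card1.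
rewrite (eq_bigr (fun _ => 2)); last by move=> i /negbTE ic; rewrite /P ic card_bool.
rewrite prod_nat_const; congr (_ ^ _).
have -> : #|[pred i : 'I_m | ~~ (i < c)]| = m - #|[pred i : 'I_m | i < c]|.
  have E := cardC [pred i : 'I_m | i < c]; rewrite card_ord in E.
  have -> : #|[pred i : 'I_m | ~~ (i < c)]| = #|predC [pred i : 'I_m | i < c]| by apply: eq_card.
  by move: E; set a := #|_|; set a' := #|_| => E; lia.
congr (_ - _); rewrite -sum1_card (eq_bigl (fun i : 'I_m => i < c)) //.
by rewrite -(big_ord_widen _ (fun _ => 1) cm) sum1_card card_ord.
Qed.

End Cube.

Lemma ltn_subS n l l' : l' < l -> l <= n -> n.+1 - l < n.+1 - l'.
Proof. by lia. Qed.

(** * The invariant of the refinement, and the creation of one pool *)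

Section Process.
Variables (V : finType) (e : rel V) (m s : nat) (R : realFieldType).
Hypotheses (e_sym : symmetric e) (e_irr : irreflexive e).
Implicit Types (u v : V) (B T Y : {set V}).
Local Notation deg := (deg e).
Local Notation edges := (edges e).
Local Notation cube := (cube m).
Implicit Types (x y z : cube) (t : 'I_m).
Local Open Scope ring_scope.

(* [pool (pid x)] is reserved for the cell of x, [avail x] is the part of it that
   still respects the neighbouring cells; [lab] bounds the blue cliques, degrees
   are measured relative to [scale], and [slack] is the spare room of a pool. *)
Record state := State {
  npool : nat;
  pid : cube -> nat;
  pool : nat -> {set V};
  avail : cube -> {set V};
  lab : nat -> nat;
  scale : nat -> R;
  slack : nat -> R }.

(** [b x t] plays two roles in direction [t]: a power of it bounds the blue degrees between two
    neighbouring cells, and its first power bounds the vertices lost there. Only the sum over [t]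
    has to stay small. *)
Definition weight := cube -> 'I_m -> R.

Record good_weight c (b : weight) : Prop := GoodWeight {
  gw_gt0 : forall x t, (t < c)%N -> 0 < b x t;
  gw_le1 : forall x t, (t < c)%N -> b x t <= 1;
  gw_flip : forall x t, (t < c)%N -> b (flip x t) t = b x t;
  gw_dep : forall x y t, (t < c)%N -> agree c x y -> b x t = b y t }.

(** In [inv_size] every point of the cube is priced at one vertex plus [2 * slack] for each drop of
    the label still possible; the term [slack * scale] is kept to outweigh the losses. In [inv_loss]
    the factor [s.+1 - lab] counts the initial cleaning and the past drops of the neighbouring
    label. *)
Record inv c (b : weight) (S : state) : Prop := Inv {
  inv_pid : forall x, (pid S x < npool S)%N;
  inv_dep : forall x y, agree c x y -> pid S x = pid S y /\ avail S x = avail S y;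
  inv_disj : forall i j, (i < npool S)%N -> (j < npool S)%N -> i != j ->
    [disjoint pool S i & pool S j];
  inv_sub : forall x, avail S x \subset pool S (pid S x);
  inv_size : forall x,
    #|[set y | pid S y == pid S x]|%:R * (1 + 2 * (lab S (pid S x)).-1%:R * slack S (pid S x))
      + slack S (pid S x) * scale S (pid S x) <= #|pool S (pid S x)|%:R;
  inv_loss : forall x, #|pool S (pid S x) :\: avail S x|%:R <=
    \sum_(t < m | (t < c)%N) (s.+1 - lab S (pid S (flip x t)))%:R * (2 * b x t * scale S (pid S x));
  inv_lab : forall x, (0 < lab S (pid S x) <= s)%N;
  inv_scale : forall x, 0 < scale S (pid S x);
  inv_slack : forall x, 0 <= slack S (pid S x);
  (* The exponent 2^(lab + lab') lets the bound survive a square root whenever a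
     label drops. *)
  inv_cross : forall x t u, (t < c)%N -> u \in avail S x ->
    (deg u (avail S (flip x t)))%:R <=
      b x t ^+ (2 ^ (lab S (pid S x) + lab S (pid S (flip x t)))) * scale S (pid S (flip x t)) }.

Definition upd (X : Type) (f : nat -> X) i (y : X) := fun j => if j == i then y else f j.

(* The new pool Y takes over the cell of x0; neighbouring cells lose the vertices
   with too many neighbours in Y. *)
Definition create c (b : weight) S (x0 : cube) Y r' (h' : R) : state := State
  (npool S).+1
  (fun x => if agree c x0 x then npool S else pid S x)
  (upd (fun i => pool S i :\: Y) (npool S) Y)
  (fun x => if agree c x0 x then Y else
    [set u in avail S x :\: Y | [forall t : 'I_m, (t < c)%N && agree c x0 (flip x t) ==>
      ((deg u Y)%:R <= b x t ^+ (2 ^ (lab S (pid S x) + r')) * (2 ^ (m - c))%:R)]])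
  (upd (lab S) (npool S) r')
  (upd (scale S) (npool S) (2 ^ (m - c))%:R)
  (upd (slack S) (npool S) h').

Lemma upd_eq (X : Type) (f : nat -> X) i (y : X) : upd f i y i = y.
Proof. by rewrite /upd eqxx. Qed.

Lemma upd_lt (X : Type) (f : nat -> X) i j (y : X) : (j < i)%N -> upd f i y j = f j.
Proof. by rewrite /upd ltn_neqAle => /andP[/negbTE->]. Qed.

Lemma expr_drop (b : R) r r' q : 0 < b -> b <= 1 -> (r' < r)%N ->
  b ^+ (2 ^ (r + q)) <= (b ^+ (2 ^ (r' + q))) ^+ 2.
Proof.
move=> b0 b1 rr; rewrite -exprM -expnSr; apply: ler_wiXn2l => //; first exact: ltW.
by rewrite leq_exp2l // -addSn leq_add2r.
Qed.

Lemma expr_le_base (b : R) k : 0 < b -> b <= 1 -> b ^+ (2 ^ k) <= b.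
Proof.
move=> b0 b1; rewrite -[X in _ <= X]expr1; apply: ler_wiXn2l => //; first exact: ltW.
by rewrite expn_gt0.
Qed.

Section Create.
Variables (c : nat) (b : weight) (S : state) (x0 : cube) (Y : {set V}) (r' : nat) (h' : R).
Hypotheses (gw : good_weight c b) (iS : inv c b S) (cm : (c <= m)%N).
Hypotheses (YA : Y \subset avail S x0) (r'0 : (0 < r' < lab S (pid S x0))%N) (h'0 : 0 <= h').
Let D : R := (2 ^ (m - c))%:R.
Hypothesis Ymax : #|Y|%:R <= D * (1 + 2 * (lab S (pid S x0)).-1%:R * slack S (pid S x0)).
Hypothesis Ymin : D * (1 + 2 * r'.-1%:R * h') + h' * D <= #|Y|%:R.
Hypothesis Y2 : #|Y|%:R <= 2 * D.

Let S' := create c b S x0 Y r' h'.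

Let D0 : 0 < D. Proof. by rewrite ltr0n expn_gt0. Qed.

Lemma create_pidC x : agree c x0 x -> pid S' x = npool S.
Proof. by rewrite /S' /= => ->. Qed.
Lemma create_pidN x : ~~ agree c x0 x -> pid S' x = pid S x.
Proof. by rewrite /S' /= => /negbTE->. Qed.
Lemma create_availC x : agree c x0 x -> avail S' x = Y.
Proof. by rewrite /S' /= => ->. Qed.
Lemma create_labN x : ~~ agree c x0 x -> lab S' (pid S' x) = lab S (pid S x).
Proof. by move=> xC; rewrite create_pidN // [LHS]upd_lt // (inv_pid iS). Qed.
Lemma create_scaleN x : ~~ agree c x0 x -> scale S' (pid S' x) = scale S (pid S x).
Proof. by move=> xC; rewrite create_pidN // [LHS]upd_lt // (inv_pid iS). Qed.
Lemma create_slackN x : ~~ agree c x0 x -> slack S' (pid S' x) = slack S (pid S x).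
Proof. by move=> xC; rewrite create_pidN // [LHS]upd_lt // (inv_pid iS). Qed.
Lemma create_poolN x : ~~ agree c x0 x -> pool S' (pid S' x) = pool S (pid S x) :\: Y.
Proof. by move=> xC; rewrite create_pidN // [LHS]upd_lt // (inv_pid iS). Qed.
Lemma create_availN x : ~~ agree c x0 x -> avail S' x \subset avail S x.
Proof.
by move=> /negbTE xC; rewrite /S' /= xC; apply/subsetP => u; rewrite !inE => /andP[/andP[]].
Qed.
Lemma create_availE x t u : (t < c)%N -> ~~ agree c x0 x -> agree c x0 (flip x t) ->
  u \in avail S' x -> (deg u Y)%:R <= b x t ^+ (2 ^ (lab S (pid S x) + r')) * D.
Proof.
move=> tc /negbTE xC xtC; rewrite /S' /= xC !inE => /andP[_ /forallP/(_ t)].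
by rewrite tc xtC.
Qed.
Lemma create_labC x : agree c x0 x -> lab S' (pid S' x) = r'.
Proof. by move=> xC; rewrite create_pidC // [LHS]upd_eq. Qed.
Lemma create_scaleC x : agree c x0 x -> scale S' (pid S' x) = D.
Proof. by move=> xC; rewrite create_pidC // [LHS]upd_eq. Qed.
Lemma create_slackC x : agree c x0 x -> slack S' (pid S' x) = h'.
Proof. by move=> xC; rewrite create_pidC // [LHS]upd_eq. Qed.
Lemma create_poolC x : agree c x0 x -> pool S' (pid S' x) = Y.
Proof. by move=> xC; rewrite create_pidC // [LHS]upd_eq. Qed.

Lemma lab_cell x : agree c x0 x -> lab S (pid S x) = lab S (pid S x0).
Proof. by rewrite agree_sym => /(inv_dep iS)[->]. Qed.

(** Since the label drops, the old degree bound from [Y] into [avail S x] is at most [w^2] times the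
    scale. Markov's inequality with threshold [w * D] uses up one factor [w]; the remaining one is
    at most [b x t], and [#|Y| <= 2 * D] gives the constant 2. *)
Lemma create_bad x t : (t < c)%N -> ~~ agree c x0 x -> agree c x0 (flip x t) ->
  #|[set u in avail S x | b x t ^+ (2 ^ (lab S (pid S x) + r')) * D < (deg u Y)%:R]|%:R
    <= 2 * b x t * scale S (pid S x).
Proof.
move=> tc xC xtC; set w := b x t ^+ _.
have b0 := gw_gt0 gw x tc; have b1 := gw_le1 gw x tc.
have w0 : 0 < w by rewrite exprn_gt0.
have d0 := inv_scale iS x.
have := markov e (w * D) (avail S x) Y; rewrite edgesC //.
set N := #|_|%:R => hN.
have hE : (edges Y (avail S x))%:R <= #|Y|%:R * (w ^+ 2 * scale S (pid S x)).
  apply: edges_ler => a aY; have aA : a \in avail S (flip x t).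
    by have [_ <-] := inv_dep iS xtC; apply: (subsetP YA).
  have := inv_cross iS tc aA; rewrite flipK (gw_flip gw) // => h.
  apply: le_trans h _; apply: ler_wpM2r; first exact: ltW.
  rewrite /w [(lab S (pid S x) + r')%N]addnC lab_cell //.
  by apply: expr_drop => //; case/andP: r'0.
have wb : w <= b x t by apply: expr_le_base.
have : N * (w * D) <= (2 * w * scale S (pid S x)) * (w * D).
  apply: le_trans hN (le_trans hE _).
  have P0 : 0 <= w ^+ 2 * scale S (pid S x) by rewrite mulr_ge0 // ?exprn_ge0 // ltW.
  apply: le_trans (ler_wpM2r P0 Y2) _.
  by rewrite le_eqVlt; apply/orP; left; apply/eqP; ring.
rewrite ler_pM2r ?mulr_gt0 // => h; apply: le_trans h _.
by apply: ler_wpM2r; [exact: ltW|rewrite ler_pM2l].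
Qed.

(** The pool out of which [Y] is cut keeps its size inequality by [Ymax]: it gives away [D] points
    together with at most their price. [Ymin] is the inequality of the new pool, and all other pools
    are disjoint from [Y]. A neighbour of the new cell loses the vertices of [create_bad], paid for
    by the larger factor [s.+1 - lab] in [inv_loss]. *)
Lemma inv_create : inv c b S'.
Proof.
have pidx x := inv_pid iS x.
have agr x y : agree c x y -> agree c x0 x = agree c x0 y.
  by move=> xy; apply/idP/idP => h; apply: agree_trans h _; rewrite // agree_sym.
have flipN x t : (t < c)%N -> agree c x0 x -> ~~ agree c x0 (flip x t).
  move=> tc xC; apply/negP => xtC; have : agree c x (flip x t).
    by apply: agree_trans xtC; rewrite agree_sym.
  by rewrite agree_flipr leqNgt tc.
split.
- move=> x; rewrite /S' /=; case: ifP => // _; exact: leqW.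
- move=> x y xy; have [pxy Axy] := inv_dep iS xy; rewrite /S' /= (agr _ _ xy); case: ifP => // _.
  split=> //; apply/setP => u; rewrite !inE Axy pxy; congr (_ && _).
  apply: eq_forallb => t; case: (ltnP t c) => //= tc.
  by rewrite (agr (flip x t) (flip y t)) ?agree_flip // (gw_dep gw tc xy).
- move=> i j; rewrite /S' /= !ltnS /upd => iK jK ij.
  have [iE|iN] := eqVneq i (npool S); have [jE|jN] := eqVneq j (npool S).
  + by rewrite iE jE eqxx in ij.
  + by rewrite disjoints_subset; apply/subsetP => u; rewrite !inE negb_and negbK => ->.
  + by rewrite disjoint_sym disjoints_subset; apply/subsetP => u; rewrite !inE negb_and negbK => ->.
  + have := inv_disj iS; move=> /(_ i j); rewrite !ltn_neqAle iN jN iK jK => /(_ isT isT ij).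
    move=> h; apply: disjointWl (subsetDl _ _) _; apply: disjointWr (subsetDl _ _) h.
- move=> x; have [xC|xN] := boolP (agree c x0 x); first by rewrite create_poolC // create_availC.
  rewrite create_poolN //; apply/subsetP => u; rewrite /S' /= (negbTE xN) !inE.
  by case/andP => /andP[-> uA] _; rewrite (subsetP (inv_sub iS x)).
- move=> x; have [xC|xN] := boolP (agree c x0 x).
    rewrite create_poolC // create_labC // create_slackC // create_scaleC // create_pidC //.
    rewrite (_ : [set y | _ == _] = [set y | agree c x0 y]) ?card_cell //.
    apply/setP => y; rewrite !inE /=; case: ifP; rewrite ?eqxx // => _.
    by apply/negbTE; rewrite neq_ltn pidx.
  rewrite create_poolN // create_labN // create_slackN // create_scaleN // create_pidN //.
  have hx := inv_size iS x; have h0 := inv_slack iS x.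
  have co0 : 0 <= 1 + 2 * (lab S (pid S x)).-1%:R * slack S (pid S x).
    by rewrite addr_ge0 // !mulr_ge0.
  have sub' : [set y | pid S' y == pid S x] \subset [set y | pid S y == pid S x].
    apply/subsetP => y; rewrite !inE /=; case: ifP => // _.
    by move=> /eqP E; have := pidx x; rewrite -E ltnn.
  have [E|NE] := eqVneq (pid S x) (pid S x0).
    have Ccls : [set y | agree c x0 y] \subset [set y | pid S y == pid S x].
      by apply/subsetP => y; rewrite !inE E => /(inv_dep iS)[->].
    have -> : [set y | pid S' y == pid S x] = [set y | pid S y == pid S x] :\: [set y | agree c x0 y].
      apply/setP => y; rewrite !inE /=; case: ifP => //= _.
      by apply/negbTE; rewrite neq_ltn pidx orbT.
    rewrite cardsD (setIidPr Ccls) card_cell // natrB; last first.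
      by rewrite -(card_cell x0 cm); apply: subset_leq_card.
    have YU : Y \subset pool S (pid S x) by apply: subset_trans YA _; rewrite E (inv_sub iS).
    rewrite cardsD (setIidPr YU) natrB; last exact: subset_leq_card.
    move: Ymax; rewrite -/D -E => YM; rewrite mulrBl; lra.
  have -> : pool S (pid S x) :\: Y = pool S (pid S x).
    apply/setDidPl; have := inv_disj iS (pidx x) (pidx x0) NE.
    by apply: disjointWr; apply: subset_trans YA (inv_sub iS x0).
  apply: le_trans hx; rewrite lerD2r; apply: ler_wpM2r => //.
  by rewrite ler_nat; apply: subset_leq_card.
- move=> x; have [xC|xN] := boolP (agree c x0 x).
    rewrite create_poolC // create_availC // setDv cards0; apply: sumr_ge0 => t tc.
    by rewrite !mulr_ge0 ?ler0n // ?create_scaleC ?(ltW D0) // ltW // (gw_gt0 gw).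
  rewrite create_poolN // create_scaleN //; set d := scale S _.
  have d0 : 0 < d := inv_scale iS x.
  pose bad t := [set u in avail S x | b x t ^+ (2 ^ (lab S (pid S x) + r')) * D < (deg u Y)%:R].
  have sub' : (pool S (pid S x) :\: Y) :\: avail S' x \subset
     (pool S (pid S x) :\: avail S x) :|: \bigcup_(t < m | (t < c)%N && agree c x0 (flip x t)) bad t.
    apply/subsetP => u; rewrite /S' /= (negbTE xN) !inE => /andP[h /andP[uY uU]].
    rewrite uU uY andbT /= in h *; case: (boolP (u \in avail S x)) h => //= uA.
    rewrite negb_forall => /existsP[t]; rewrite negb_imply -ltNge => /andP[tc ht].
    by apply/bigcupP; exists t => //; rewrite inE uA.
  apply: (@le_trans _ _ (#|pool S (pid S x) :\: avail S x|%:R +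
     \sum_(t < m | (t < c)%N && agree c x0 (flip x t)) 2 * b x t * d)).
    apply: le_trans (_ : (#|pool S (pid S x) :\: avail S x| +
        \sum_(t < m | (t < c)%N && agree c x0 (flip x t)) #|bad t|)%:R <= _).
      rewrite ler_nat; apply: leq_trans (subset_leq_card sub') _.
      apply: leq_trans (leq_card_setU _ _) _; rewrite leq_add2l.
      exact: card_bigcup_leq_sum.
    rewrite natrD lerD2l natr_sum; apply: ler_sum => t /andP[tc xtC].
    exact: create_bad.
  have hL := inv_loss iS x.
  apply: le_trans (lerD hL (lexx _)) _; rewrite -/d big_mkcondr -big_split.
  apply: ler_sum => t tc; rewrite [leLHS]/=.
  have b0 := gw_gt0 gw x tc.
  have [xtC|xtN] := boolP (agree c x0 (flip x t)); last by rewrite addr0 create_labN.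
  rewrite create_labC // -[X in _ + X]mul1r -mulrDl; apply: ler_wpM2r.
    by rewrite !mulr_ge0 ?ltW.
  have [_ ls] := andP (inv_lab iS (flip x t)); have [_ rl] := andP r'0.
  by rewrite natr1 ler_nat; apply: ltn_subS; rewrite // (lab_cell xtC).
- move=> x; have [xC|xN] := boolP (agree c x0 x); last by rewrite create_labN // (inv_lab iS).
  rewrite create_labC //; have [_ ls] := andP (inv_lab iS x0); have [r0 rl] := andP r'0.
  by rewrite r0; apply: ltnW; apply: leq_trans rl ls.
- move=> x; have [xC|xN] := boolP (agree c x0 x); first by rewrite create_scaleC.
  by rewrite create_scaleN // (inv_scale iS).
- move=> x; have [xC|xN] := boolP (agree c x0 x); first by rewrite create_slackC.
  by rewrite create_slackN // (inv_slack iS).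
move=> x t u tc.
have b0 := gw_gt0 gw x tc; have b1 := gw_le1 gw x tc.
have [xC|xN] := boolP (agree c x0 x).
  have xtN := flipN x t tc xC.
  rewrite create_availC // create_labC // create_labN // create_scaleN // => uY.
  have uA : u \in avail S x.
    by have [_ <-] := inv_dep iS xC; apply: (subsetP YA).
  have := inv_cross iS tc uA; have d0 := inv_scale iS (flip x t) => h.
  apply: (@le_trans _ _ (deg u (avail S (flip x t)))%:R).
    by rewrite ler_nat deg_sub // create_availN.
  apply: le_trans h _; apply: ler_wpM2r; first exact: ltW.
  apply: ler_wiXn2l => //; first exact: ltW.
  by rewrite leq_exp2l // leq_add2r lab_cell //; case/andP: r'0 => _ /ltnW.
have [xtC|xtN] := boolP (agree c x0 (flip x t)).
  rewrite create_labN // create_labC // create_scaleC // [in deg u _]create_availC //.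
  exact: create_availE.
move=> uA'; rewrite !create_labN // create_scaleN //.
apply: le_trans (inv_cross iS tc (subsetP (create_availN xN) _ uA')).
by rewrite ler_nat deg_sub // create_availN.
Qed.

End Create.
End Process.

Definition red_cube (V : finType) (e : rel V) (m : nat) : Prop :=
  exists f : cube m -> V, injective f /\ forall x t, ~~ e (f x) (f (flip x t)).

(** [R] need not be archimedean, so an explicit upper bound [N] supplies the integers to choose
    from. *)
Lemma nat_ceil (R : realFieldType) (a : R) (N : nat) :
  (a <= N%:R -> exists2 j : nat, a <= j%:R & (j = 0)%N \/ j%:R < a + 1)%R.
Proof.
move=> aN; have ex : exists n : nat, (a <= n%:R)%R by exists N.
case: (ex_minnP ex) => j aj jmin; exists j => //.
case: j aj jmin => [|j] aj jmin; [by left|right].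
rewrite -natr1 ltrD2r ltNge; apply/negP => /jmin; lia.
Qed.

(** * Refinement by batches of coordinates *)

Section Stages.
Variables (V : finType) (e : rel V) (m s : nat) (R : realFieldType).
Hypotheses (e_sym : symmetric e) (e_irr : irreflexive e).
Implicit Types (u v : V) (T Y : {set V}).
Local Notation deg := (deg e).
Local Notation cube := (cube m).
Local Notation state := (state V m R).
Local Notation weight := (weight m R).
Local Notation inv := (inv e s).
Implicit Types (x y z : cube) (t : 'I_m) (S : state) (b : weight).
Local Open Scope ring_scope.

Definition all_kfree S := forall x, kfree e (lab S (pid S x)) (pool S (pid S x)).
Definition light (th : R) S x :=
  [forall u in avail S x, (deg u (avail S x))%:R <= th * scale S (pid S x)].

Section Refine.
Variables (c0 c K : nat) (b : weight) (th : R).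
Hypotheses (gw : good_weight c b) (cm : (c <= m)%N).
Hypotheses (th0 : 0 < th) (thK : 2 <= th * K%:R).
Hypothesis big : (2 ^ (m - c))%:R * 2 * ((16 * K) ^ s)%:R <= th * (2 ^ (m - c0))%:R.

(** During a batch from depth [c0] to depth [c], a pool is either old, with scale at least that of a
    cell of depth [c0], or was created in this batch and is already light. The last clause makes
    [slack] worth at least one vertex at depth [c], which is needed for rounding. *)
Definition refinable S := [/\ inv c b S, all_kfree S,
  forall x, (2 ^ (m - c))%:R <= scale S (pid S x),
  forall x, light th S x \/ (2 ^ (m - c0))%:R <= scale S (pid S x) &
  forall x, 1 <= slack S (pid S x) * (2 ^ (m - c))%:R /\ (2 * s)%:R * slack S (pid S x) <= 1].

(** A cell that is not light has a vertex whose neighbourhood inside [avail] exceeds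
    [th * 2^(m - c0)]; by [big] this suffices for [sparse_subset] to return a pool for one cell of
    depth [c]. That pool is light at once, so one visit to each cell completes the batch. *)
Lemma refine_cell S x0 : refinable S -> exists S', [/\ refinable S',
  forall x, slack S' (pid S' x) = slack S (pid S x),
  forall x, light th S x -> light th S' x & light th S' x0].
Proof.
move=> [iS kS lowS hS sS].
have [l0|] := boolP (light th S x0); first by exists S.
move=> /forall_inPn[v vA]; rewrite -ltNge => hv.
have sc0 : (2 ^ (m - c0))%:R <= scale S (pid S x0).
  case: (hS x0) => // /forall_inP/(_ v vA); by rewrite leNgt hv.
have bigD := big; set D : R := (2 ^ (m - c))%:R in sS lowS bigD *.
have D0 : 0 < D by rewrite ltr0n expn_gt0.
have [_ labs] := andP (inv_lab iS x0).
have := kS x0; case El : (lab S (pid S x0)) labs => [|r'] labs; first by move/kfree_gt0.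
move=> kU; have kA := kfreeS (inv_sub iS x0) kU.
have kT := kfree_nbhd e_sym e_irr vA kA; have r'0 := kfree_gt0 kT.
have [s1 s2] := sS x0; set h := slack S (pid S x0) in s1 s2.
have h0 : 0 <= h := inv_slack iS x0.
have r's : (r'%:R : R) <= s%:R by rewrite ler_nat ltnW.
have hr : 2 * r'%:R * h <= 1.
  apply: le_trans s2; rewrite natrM; apply: ler_wpM2r => //; lra.
have r'E : (r'%:R : R) = 1 + r'.-1%:R by rewrite -{1}(prednK r'0) -natr1 addrC.
have hrD : 2 * r'%:R * h * D <= D by rewrite -[leRHS]mul1r ler_pM2r.
(* The bounds [Ymin] and [Ymax] on the size of the new pool differ by [h * D >= 1], so an integer
   [M] fits between them. *)
have [|M Mlo Mhi] := @nat_ceil R (D * (1 + 2 * r'.-1%:R * h) + h * D) (2 * 2 ^ (m - c)).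
  rewrite natrM -/D; move: hrD; rewrite r'E; nra.
have P0 : 0 <= 2 * r'.-1%:R * h by rewrite !mulr_ge0.
have M0 : (0 < M)%N.
  rewrite -(ltr0n R); apply: lt_le_trans D0 (le_trans _ Mlo).
  by rewrite mulrDr mulr1 -addrA lerDl addr_ge0 // mulr_ge0 // ltW.
case: Mhi => [M00|Mhi]; first by rewrite M00 in M0.
have Mmax : M%:R <= D * (1 + 2 * r'%:R * h).
  apply: le_trans (ltW Mhi) _; rewrite r'E; nra.
have M2 : M%:R <= 2 * D by apply: le_trans Mmax _; nra.
have K0 : (0 < K)%N by rewrite lt0n; apply: contraTneq thK => ->; rewrite mulr0 -ltNge.
have Tbig : (M * (16 * K) ^ r' <= #|nbhd e v :&: avail S x0|)%N.
  rewrite -(ler_nat R); apply: le_trans (_ : 2 * D * ((16 * K) ^ s)%:R <= _).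
    have K16 : (1 < 16 * K)%N by apply: leq_trans (leq_mul (leqnn 16) K0).
    by rewrite natrM; apply: ler_pM; rewrite ?ler0n // ler_nat (leq_exp2l _ _ K16) ltnW.
  rewrite [2 * D]mulrC; apply: le_trans bigD _; apply: le_trans (ltW hv).
  by rewrite ler_pM2l.
have [Y [YT cY hY]] := sparse_subset e_sym e_irr K0 M0 kT Tbig.
have YA : Y \subset avail S x0 by apply: subset_trans YT (subsetIr _ _).
have rl : (0 < r' < lab S (pid S x0))%N by rewrite El r'0 ltnSn.
have Ymax : #|Y|%:R <= D * (1 + 2 * (lab S (pid S x0)).-1%:R * slack S (pid S x0)) by rewrite cY El.
have Ymin : D * (1 + 2 * r'.-1%:R * h) + h * D <= #|Y|%:R by rewrite cY.
have Y2 : #|Y|%:R <= 2 * D by rewrite cY.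
have iS' := inv_create e_sym gw iS cm YA rl h0 Ymax Ymin Y2.
set S' := create e c b S x0 Y r' h in iS'.
have slS x : slack S' (pid S' x) = slack S (pid S x).
  have [xC|xN] := boolP (agree c x0 x); last by rewrite (create_slackN _ _ _ iS).
  by rewrite create_slackC // /h (inv_dep iS xC).1.
have lightC x : agree c x0 x -> light th S' x.
  move=> xC; rewrite /light create_availC // create_scaleC //; apply/forall_inP => u uY.
  have := hY u uY; rewrite -(ler_nat R) natrM => h1.
  have K0' : 0 < (K%:R : R) by rewrite ltr0n.
  rewrite -(ler_pM2r K0'); apply: le_trans h1 (le_trans M2 _); rewrite -/D.
  have -> : th * D * K%:R = th * K%:R * D by ring.
  by rewrite ler_pM2r.
have lightN x : light th S x -> light th S' x.
  have [xC|xN] := boolP (agree c x0 x); first by move=> _; apply: lightC.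
  move=> /forall_inP h1; apply/forall_inP => u uA'.
  have AA := create_availN e b S Y r' h xN.
  rewrite (create_scaleN _ _ _ iS) //; apply: le_trans (h1 u (subsetP AA _ uA')).
  by rewrite ler_nat deg_sub.
exists S'; split=> //; last by apply: lightC; apply: agree_refl.
split=> //.
- move=> x; have [xC|xN] := boolP (agree c x0 x).
    by rewrite create_labC // create_poolC //; apply: kfreeS YT kT.
  rewrite (create_labN _ _ _ iS) // (create_poolN _ _ _ iS) //.
  by apply: kfreeS (kS x); apply: subsetDl.
- move=> x; have [xC|xN] := boolP (agree c x0 x); first by rewrite create_scaleC.
  by rewrite (create_scaleN _ _ _ iS).
- move=> x; have [xC|xN] := boolP (agree c x0 x); first by left; apply: lightC.
  rewrite (create_scaleN _ _ _ iS) //; case: (hS x); [left; exact: lightN|by right].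
- by move=> x; rewrite slS; apply: sS.
Qed.

Lemma refine_seq (xs : seq cube) S : refinable S -> exists S', [/\ refinable S',
  forall x, slack S' (pid S' x) = slack S (pid S x),
  forall x, light th S x -> light th S' x & {in xs, forall x, light th S' x}].
Proof.
move=> rS; elim: xs => [|x0 xs [S1 [rS1 sl1 lN1 l1]]]; first by exists S.
have [S2 [rS2 sl2 lN2 l2]] := refine_cell x0 rS1.
exists S2; split=> //; first by move=> x; rewrite sl2.
  by move=> x /lN1/lN2.
by move=> x; rewrite inE => /orP[/eqP->|/l1/lN2].
Qed.

End Refine.

Definition subweight c0 b (beta : R) : weight := fun x t => if (t < c0)%N then b x t else beta.

Lemma good_subweight c0 c b beta : (c0 <= c)%N -> good_weight c0 b -> 0 < beta -> beta <= 1 ->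
  good_weight c (subweight c0 b beta).
Proof.
move=> cc gw b0 b1; split; rewrite /subweight.
- by move=> x t _; case: ifP => // tc; apply: (gw_gt0 gw).
- by move=> x t _; case: ifP => // tc; apply: (gw_le1 gw).
- by move=> x t _; case: ifP => // tc; apply: (gw_flip gw).
move=> x y t tc xy; case: ifP => // tc0; apply: (gw_dep gw) => //.
exact: agree_leq cc xy.
Qed.

End Stages.

Lemma ltr_nat1 (R : realFieldType) (k : nat) : (k%:R < 1 :> R)%R -> k = 0%N.
Proof. by rewrite (ltr_nat R k 1) ltnS leqn0 => /eqP. Qed.

Section Stages.
Variables (V : finType) (e : rel V) (m s : nat) (R : realFieldType).
Hypotheses (e_sym : symmetric e) (e_irr : irreflexive e) (s0 : 0 < s).
Implicit Types (u v : V) (T Y : {set V}).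
Local Notation deg := (deg e).
Local Notation cube := (cube m).
Local Notation state := (state V m R).
Local Notation weight := (weight m R).
Local Notation inv := (inv e s).
Local Notation light := (light e).
Implicit Types (x y z : cube) (t : 'I_m) (S : state) (b : weight).
Local Open Scope ring_scope.

(** In a new direction [x] and [flip x t] lie in the same old cell, so the cross bound is the bound
    on inner degrees. The exponent [2^(2 * s)] is the largest that can be asked for, since labels
    are at most [s]. *)
Lemma inv_subdiv c0 c b beta S : (c0 <= c)%N -> good_weight c0 b -> inv c0 b S ->
  0 < beta -> beta <= 1 -> (forall x, light (beta ^+ (2 ^ (2 * s))) S x) ->
  inv c (subweight c0 b beta) S.
Proof.
move=> cc gw iS b0 b1 lS; split; try solve [by case: iS].
- by move=> x y /(agree_leq cc)/(inv_dep iS).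
- move=> x; apply: le_trans (inv_loss iS x) _.
  rewrite [leRHS](bigID (fun t : 'I_m => (t < c0)%N)) /= -[leLHS]addr0; apply: lerD.
    rewrite le_eqVlt; apply/orP; left; apply/eqP.
    apply: eq_big => t; first by case: (ltnP t c0) => h; rewrite ?andbF ?andbT // (leq_trans h).
    by move=> tc0; rewrite /subweight tc0.
  apply: sumr_ge0 => t /andP[_ tc]; rewrite /subweight (negbTE tc).
  by rewrite !mulr_ge0 // ?ltW // (inv_scale iS).
move=> x t u tc uA; rewrite /subweight; case: ltnP => tc0; first exact: (inv_cross iS).
have [<- <-] : pid S x = pid S (flip x t) /\ avail S x = avail S (flip x t).
  by apply: (inv_dep iS); rewrite agree_flipr.
have /forall_inP/(_ u uA) h := lS x; apply: le_trans h _.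
apply: ler_wpM2r; first by rewrite ltW // (inv_scale iS).
apply: ler_wiXn2l => //; first exact: ltW.
have /andP[_ {}h] := inv_lab iS x.
by rewrite leq_exp2l // mul2n -addnn leq_add.
Qed.

Definition budget c b x : R := \sum_(t < m | (t < c)%N) b x t.

Lemma budget_sub c0 c b beta x : (c0 <= c <= m)%N ->
  budget c (subweight c0 b beta) x = budget c0 b x + (c - c0)%:R * beta.
Proof.
case/andP=> cc cm; rewrite /budget (bigID (fun t : 'I_m => (t < c0)%N)) /=; congr (_ + _).
  apply: eq_big => t; first by case: (ltnP t c0) => h; rewrite ?andbF ?andbT // (leq_trans h).
  by case/andP => _ tc0; rewrite /subweight tc0.
rewrite (eq_bigr (fun _ => beta)); last by move=> t /andP[_ /negbTE tc]; rewrite /subweight tc.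
rewrite sumr_const mulr_natl; congr (_ *+ _).
have card_lt n : (n <= m)%N -> #|[pred i : 'I_m | (i < n)%N]| = n.
  move=> nm; rewrite -sum1_card (eq_bigl (fun i : 'I_m => (i < n)%N)) //.
  by rewrite -(big_ord_widen _ (fun _ => 1%N) nm) sum1_card card_ord.
have c0m := leq_trans cc cm.
have E := cardID [pred i : 'I_m | (i < c0)%N] [pred i : 'I_m | (i < c)%N].
rewrite (_ : #|[predI _ & _]| = #|[pred i : 'I_m | (i < c0)%N]|) in E; last first.
  apply: eq_card => i; rewrite !inE; apply/andP/idP => [[]|h] //; split=> //.
  exact: leq_trans h cc.
rewrite !card_lt // in E; rewrite -E addKn.
by apply: eq_card => i; rewrite !inE unfold_in /= E andbC.
Qed.

Definition half_pow j : R := 2^-1 ^+ j.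

Lemma half_pow_gt0 j : 0 < half_pow j. Proof. by rewrite exprn_gt0 // invr_gt0. Qed.
Lemma half_pow_le1 j : half_pow j <= 1.
Proof. by rewrite exprn_ile1 // ?invr_ge0 // invf_le1 // ler1n. Qed.
Lemma half_powE j : half_pow j * (2 ^ j)%:R = 1.
Proof. by rewrite natrX -exprMn mulVf ?expr1n // pnatr_eq0. Qed.

(** [cF] is a depth fixed in advance that no stage may exceed: the slack must still be worth a
    vertex in cells of depth [cF]. *)
Definition stage_ok cF c b j S := [/\ inv c b S, all_kfree e S, good_weight c b,
  forall x, light (half_pow j ^+ (2 ^ (2 * s))) S x /\ (2 ^ (m - c))%:R <= scale S (pid S x) &
  forall x, 1 <= slack S (pid S x) * (2 ^ (m - cF))%:R /\ (2 * s)%:R * slack S (pid S x) <= 1].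

(** With [E = 2^(2 * s)], threshold [2^-(j.+1 * E)] and [K = 2^(j.+1 * E + 1)], the condition [big]
    of a batch asks for [1 + 5 * s + s.+1 * (j.+1 * E)] new coordinates; this is at most
    [stage_cost * j.+1]. *)
Definition stage_cost := (1 + 5 * s + s.+1 * 2 ^ (2 * s))%N.

Lemma stage_step cF c b j S : (cF <= m)%N -> (c + stage_cost * j.+1 <= cF)%N ->
  stage_ok cF c b j S -> exists b' S', [/\ stage_ok cF (c + stage_cost * j.+1) b' j.+1 S',
    forall x, slack S' (pid S' x) = slack S (pid S x) &
    forall x, budget (c + stage_cost * j.+1) b' x
        = budget c b x + (stage_cost * j.+1)%:R * half_pow j].
Proof.
move=> cFm; set k := (stage_cost * j.+1)%N; set c' := (c + k)%N => c'F.
move=> [iS kS gw ldS sS].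
have lS x := (ldS x).1; have dS x := (ldS x).2.
have cc' : (c <= c')%N := leq_addr _ _.
have c'm := leq_trans c'F cFm.
set E := (2 ^ (2 * s))%N in lS.
pose th : R := half_pow j.+1 ^+ E.
pose K := (2 ^ (j.+1 * E + 1))%N.
have th0 : 0 < th by rewrite exprn_gt0 // half_pow_gt0.
have thE : th * (2 ^ (j.+1 * E))%:R = 1 by rewrite /th -exprM half_powE.
have thK : 2 <= th * K%:R by rewrite /K expnD natrM mulrA thE; lra.
have gw' := good_subweight cc' gw (half_pow_gt0 j) (half_pow_le1 j).
have iS' := inv_subdiv cc' gw iS (half_pow_gt0 j) (half_pow_le1 j) lS.
have big : (2 ^ (m - c'))%:R * 2 * ((16 * K) ^ s)%:R <= th * (2 ^ (m - c))%:R.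
  have q0 : 0 < ((2 ^ (j.+1 * E))%:R : R) by rewrite ltr0n expn_gt0.
  rewrite -(ler_pM2r q0) mulrAC [leRHS]mulrAC thE mul1r -!natrM ler_nat.
  rewrite (_ : (16 * K = 2 ^ (j.+1 * E + 5))%N); last by rewrite /K !expnD; lia.
  rewrite -expnM -expnSr -!expnD leq_exp2l //.
  have kE : (k = (1 + 5 * s) * j.+1 + s.+1 * (j.+1 * E))%N by rewrite /k /stage_cost -/E; lia.
  have : (1 + 5 * s <= (1 + 5 * s) * j.+1)%N by rewrite leq_pmulr.
  move: c'm; rewrite /c' kE; clear.
  by set F := (j.+1 * E)%N; set G := ((1 + 5 * s) * j.+1)%N; lia.
have rS : refinable e s c c' (subweight c b (half_pow j)) th S.
  split=> //.
  - move=> x; apply: le_trans (dS x); rewrite ler_nat leq_exp2l //; lia.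
  - by move=> x; right; apply: dS.
  move=> x; have [h1 h2] := sS x; split=> //; apply: le_trans h1 _.
  by rewrite ler_wpM2l ?(inv_slack iS) // ler_nat leq_exp2l // leq_sub2l.
have [S1 [[i1 k1 d1 _ _] sl1 _ l1]] :=
  refine_seq e_sym e_irr gw' c'm th0 thK big (enum cube) rS.
exists (subweight c b (half_pow j)), S1; split=> //.
  split=> //; first by move=> x; split=> //; apply: l1; rewrite mem_enum.
  by move=> x; rewrite sl1; apply: sS.
by move=> x; rewrite budget_sub ?cc' // /c' addKn.
Qed.

(** Closed form of the sum of [i.+1 * 2^-i] over all [i >= j]. Up to the factor [stage_cost] it
    bounds the budget used by any number of stages from [j] on. *)
Definition tail j : R := (2 * j + 4)%:R * half_pow j.

Lemma tailS j : tail j - tail j.+1 = (j.+1)%:R * half_pow j.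
Proof.
rewrite /tail /half_pow exprS !natrD !natrM -[j.+1]addn1 natrD.
by field.
Qed.

Lemma stage_iter cF c b j i S : (cF <= m)%N -> (c + stage_cost * (i * (j + i)) <= cF)%N ->
  stage_ok cF c b j S -> exists c' b' S', [/\ (c' <= c + stage_cost * (i * (j + i)))%N,
    stage_ok cF c' b' (j + i) S',
    forall x, slack S' (pid S' x) = slack S (pid S x) &
    forall x, budget c' b' x = budget c b x + stage_cost%:R * (tail j - tail (j + i))].
Proof.
move=> cFm; elim: i => [|i IH]; last rewrite addnS; move=> hc oS.
  exists c, b, S; rewrite mul0n muln0 !addn0; split=> // x.
  by rewrite subrr mulr0 addr0.
have st : (i * (j + i) + (j + i).+1 <= i.+1 * (j + i).+1)%N by lia.
have st' : (c + stage_cost * (i * (j + i)) + stage_cost * (j + i).+1 <=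
    c + stage_cost * (i.+1 * (j + i).+1))%N.
  by rewrite -addnA -mulnDr leq_add2l leq_mul2l st orbT.
have [|c1 [b1 [S1 [hc1 o1 sl1 bu1]]]] := IH _ oS.
  by apply: leq_trans hc; apply: leq_trans st'; apply: leq_addr.
have [|b2 [S2 [o2 sl2 bu2]]] := stage_step cFm _ o1.
  by apply: leq_trans hc; apply: leq_trans st'; rewrite leq_add2r.
exists (c1 + stage_cost * (j + i).+1)%N, b2, S2; split=> //.
- by apply: leq_trans st'; rewrite leq_add2r.
- by move=> x; rewrite sl2.
move=> x; rewrite bu2 bu1 -addrA; congr (_ + _); rewrite natrM -mulrA -tailS; ring.
Qed.

(** * Depth [m]: pools become single vertices *)

Section Last.
Variable b : weight.
Hypothesis gw : good_weight m b.

Definition single S x := [/\ #|pool S (pid S x)| = 1%N, scale S (pid S x) = 1 &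
  forall y, pid S y = pid S x -> y = x].

Lemma loss_le S x : inv m b S ->
  #|pool S (pid S x) :\: avail S x|%:R <= (2 * s)%:R * budget m b x * scale S (pid S x).
Proof.
move=> iS; apply: le_trans (inv_loss iS x) _; rewrite /budget mulr_sumr mulr_suml.
apply: ler_sum => t tm; rewrite !mulrA; apply: ler_wpM2r; first by rewrite ltW // (inv_scale iS).
apply: ler_wpM2r; first by rewrite ltW // (gw_gt0 gw).
rewrite -natrM ler_nat; have /andP[l0 _] := inv_lab iS (flip x t).
by rewrite mulnC leq_mul2l; lia.
Qed.

Definition finishing (done : pred cube) S := [/\ inv m b S,
  {in done, forall x, single S x} &
  forall x, x \notin done -> (1 < lab S (pid S x))%N /\
    (2 * s)%:R * budget m b x <= slack S (pid S x)].

(** By [inv_size] a pool is strictly larger than [slack * scale], and this covers all its losses, so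
    [avail S x0] is not empty; any vertex in it may serve as a pool with one element. *)
Lemma finish_cell done S x0 : finishing done S ->
  exists S', finishing [predU1 x0 & done] S'.
Proof.
move=> [iS sS uS]; have [x0d|x0N] := boolP (x0 \in done).
  exists S; split=> // x; first by rewrite inE => /orP[/eqP->|]; apply: sS.
  by rewrite inE negb_or => /andP[_]; apply: uS.
have [l1 bu] := uS x0 x0N.
have d0 := inv_scale iS x0; have h0 := inv_slack iS x0.
have [y yA] : exists y : V, y \in avail S x0.
  apply/set0Pn; apply/negP => /eqP A0.
  have := loss_le x0 iS; rewrite A0 setD0 => hU.
  have := inv_size iS x0; rewrite leNgt; case/negP.
  apply: le_lt_trans hU _; apply: le_lt_trans (ler_wpM2r (ltW d0) bu) _.
  rewrite ltr_pwDl // mulr_gt0 ?ltr_wpDr ?mulr_ge0 // ltr0n card_gt0.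
  by apply/set0Pn; exists x0; rewrite inE.
have cellE x : agree m x0 x = (x == x0).
  by apply/idP/eqP => [/agree_full|->] //; apply: agree_refl.
have YA : [set y] \subset avail S x0 by rewrite sub1set.
have co : 1 <= 1 + 2 * (lab S (pid S x0)).-1%:R * slack S (pid S x0) by rewrite lerDl !mulr_ge0.
(* The label 1 is a mere counter from here on: [[set y]] does contain a clique with one vertex, and
   [all_kfree] is no longer maintained. The slack 0 suffices because a finished cell is not refined
   again. *)
have iS' : inv m b (create e m b S x0 [set y] 1 0).
  apply: inv_create => //; rewrite ?subnn ?cards1 //=; lra.
exists (create e m b S x0 [set y] 1 0); split=> //.
  move=> x; rewrite inE => xd; have [xC|xN] := boolP (agree m x0 x).
    split; rewrite ?create_poolC ?cards1 ?create_scaleC ?subnn //.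
    move=> z; rewrite (create_pidC _ _ _ _ _ _ xC); move: xC; rewrite cellE => /eqP->.
    have [zC|zN] := boolP (agree m x0 z); first by move: zC; rewrite cellE => /eqP.
    by rewrite create_pidN // => E; have := inv_pid iS z; rewrite E ltnn.
  have xd' : x \in done by move: xd xN; rewrite cellE /in_mem /=; case: eqP.
  have [p1 sc1 un] := sS x xd'.
  split.
  - rewrite (create_poolN _ _ _ iS) // (setDidPl _) //.
    have ne : pid S x != pid S x0.
      by apply/eqP => /esym E; move: xN; rewrite cellE -(un _ E) eqxx.
    have := inv_disj iS (inv_pid iS x) (inv_pid iS x0) ne.
    by apply: disjointWr; rewrite sub1set (subsetP (inv_sub iS x0)).
  - by rewrite (create_scaleN _ _ _ iS).
  move=> z; rewrite (create_pidN _ _ _ _ _ _ xN).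
  have [zC|zN] := boolP (agree m x0 z).
    by rewrite create_pidC // => E; have := inv_pid iS x; rewrite -E ltnn.
  by rewrite create_pidN //; apply: un.
move=> x; rewrite inE negb_or => /andP[xx0 xd].
have xN : ~~ agree m x0 x by rewrite cellE.
by rewrite (create_labN _ _ _ iS) // (create_slackN _ _ _ iS) //; apply: uS.
Qed.

(** Once all pools are singletons, a pool loses fewer than one vertex, hence none, and the blue
    degree between neighbouring cells is below 1, hence 0. *)
Lemma finish S : inv m b S -> (forall x, (1 < lab S (pid S x))%N) ->
  (forall x, (2 * s)%:R * budget m b x <= slack S (pid S x)) ->
  (forall x, (2 * s)%:R * budget m b x < 1) -> red_cube e m.
Proof.
move=> iS lS bS b1.
have [S' [iS' sS' _]] : exists S', finishing (mem (enum cube)) S'.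
  elim: (enum cube) => [|x0 xs [S1 f1]]; first by exists S.
  have [S2 [i2 s2 u2]] := finish_cell x0 f1; exists S2; split=> //.
have sg x : single S' x by apply: sS'; rewrite mem_enum.
have AE x : avail S' x = pool S' (pid S' x).
  apply/eqP; rewrite eqEsubset (inv_sub iS') -setD_eq0 -cards_eq0; apply/eqP.
  apply: (@ltr_nat1 R); apply: le_lt_trans (loss_le x iS') _.
  by have [_ -> _] := sg x; rewrite mulr1.
have ex x : exists y : V, avail S' x == [set y].
  by have [/eqP/cards1P[v vE] _ _] := sg x; exists v; rewrite AE vE.
pose f x := xchoose (ex x).
have fE x : avail S' x = [set f x] by apply/eqP; apply: (xchooseP (ex x)).
exists f; split.
  move=> x y fxy; have [_ _ un] := sg y; apply: un; apply/eqP; apply: contraT => ne.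
  have := inv_disj iS' (inv_pid iS' x) (inv_pid iS' y) ne.
  by rewrite -!AE !fE fxy -setI_eq0 setIid => /eqP/setP/(_ (f y)); rewrite !inE eqxx.
move=> x t; apply/negP => exy.
have tm := ltn_ord t.
have := inv_cross iS' tm (_ : f x \in avail S' x); rewrite fE set11 => /(_ isT).
rewrite fE /deg (_ : _ :&: _ = [set f (flip x t)]); last first.
  by apply/setP => v; rewrite !inE andbC; case: eqP => // ->.
have [_ -> _] := sg (flip x t); rewrite cards1 mulr1 leNgt; case/negP.
have b0 := gw_gt0 gw x tm.
have bl : b x t < 1.
  apply: le_lt_trans (b1 x); rewrite /budget (bigD1 t) //= mulrDr.
  rewrite -[leLHS]addr0; apply: lerD.
    by rewrite ler_peMl ?(ltW b0) // ler1n muln_gt0 s0.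
  by rewrite mulr_ge0 // sumr_ge0 // => t' _; rewrite ltW // (gw_gt0 gw).
by rewrite exprn_ilt1 ?(ltW b0) // -lt0n expn_gt0.
Qed.

End Last.
End Stages.

(** * From a layout of initial pools to a red cube *)

Section Embedding.
Variables (V : finType) (e : rel V) (m s : nat) (R : realFieldType).
Hypotheses (e_sym : symmetric e) (e_irr : irreflexive e).
Hypotheses (s1 : 1 < s) (Vfree : kfree e s [set: V]).
Implicit Types (u v : V) (Y : {set V}).
Local Notation deg := (deg e).
Local Notation edges := (edges e).
Local Notation cube := (cube m).
Local Notation weight := (weight m R).
Implicit Types (x y z : cube) (t : 'I_m).
Local Open Scope ring_scope.

(** The bound in [lay_cross] is a square because the initial cleaning by Markov's inequality takes
    one factor. [lay_budget] and [lay_tail] hold the losses on the given coordinates, and those of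
    all later stages, to a quarter of [eta] each. *)
Record layout (c j a : nat) (K : nat) (T : nat -> {set V}) (pi : cube -> nat)
    (b : weight) (eta : nat -> R) : Prop := Layout {
  lay_pi : forall x, (pi x < K)%N;
  lay_dep : forall x y, agree c x y -> pi x = pi y;
  lay_disj : forall i k, (i < K)%N -> (k < K)%N -> i != k -> [disjoint T i & T k];
  lay_weight : good_weight c b;
  lay_low : forall x t, (t < c)%N -> half_pow R j <= b x t;
  lay_size : forall x, #|[set y | pi y == pi x]|%:R * (1 + 2 * s.-1%:R * eta (pi x))
    + eta (pi x) * #|T (pi x)|%:R <= #|T (pi x)|%:R;
  lay_inner : forall x u, u \in T (pi x) ->
    (deg u (T (pi x)))%:R <= half_pow R j ^+ (2 ^ (2 * s)) * #|T (pi x)|%:R;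
  lay_cross : forall x t, (t < c)%N -> pi x != pi (flip x t) ->
    (edges (T (pi x)) (T (pi (flip x t))))%:R <=
      (b x t ^+ (2 ^ (2 * s))) ^+ 2 * #|T (pi x)|%:R * #|T (pi (flip x t))|%:R;
  lay_eta : forall x, half_pow R a <= eta (pi x) /\ (2 * s)%:R * eta (pi x) <= 1;
  lay_budget : forall x, (8 * s)%:R * budget c b x <= eta (pi x);
  lay_tail : forall x, (8 * s * stage_cost s)%:R * tail R j <= eta (pi x) }.

Section Init.
Variables (c j a K : nat) (T : nat -> {set V}) (pi : cube -> nat) (b : weight) (eta : nat -> R).
Hypotheses (lay : layout c j a K T pi b eta) (cm : (c <= m)%N).

Let eta0 x : 0 < eta (pi x).
Proof. by have [h _] := lay_eta lay x; apply: lt_le_trans h; apply: half_pow_gt0. Qed.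

Let TC x : (2 ^ (m - c))%:R <= (#|T (pi x)|%:R : R).
Proof.
apply: le_trans (lay_size lay x); have := eta0 x => h.
apply: le_trans (_ : #|[set y | pi y == pi x]|%:R <= _).
  rewrite -(card_cell x cm) ler_nat; apply/subset_leq_card/subsetP => y.
  by rewrite !inE => /(lay_dep lay)->.
rewrite -[leLHS]addr0; apply: lerD; last by rewrite mulr_ge0 // ltW.
by rewrite ler_peMr // lerDl !mulr_ge0 // ltW.
Qed.

Let T0 x : 0 < (#|T (pi x)|%:R : R).
Proof. by apply: lt_le_trans (TC x); rewrite ltr0n expn_gt0. Qed.

Definition init_avail x := [set u in T (pi x) |
  [forall t : 'I_m, (t < c)%N && (pi x != pi (flip x t)) ==>
    ((deg u (T (pi (flip x t))))%:R <= b x t ^+ (2 ^ (2 * s)) * #|T (pi (flip x t))|%:R)]].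

Definition init : state V m R :=
  State K pi T init_avail (fun=> s) (fun i => #|T i|%:R) eta.

Lemma init_sub x : init_avail x \subset T (pi x).
Proof. by apply/subsetP => u; rewrite inE => /andP[]. Qed.

Lemma inv_init : inv e s c b init.
Proof.
have gw := lay_weight lay.
have depf x y t : agree c x y -> pi (flip x t) = pi (flip y t).
  by move=> xy; apply: (lay_dep lay); rewrite agree_flip.
split=> //=.
- exact: (lay_pi lay).
- move=> x y xy; have pxy := lay_dep lay xy; split=> //.
  apply/setP => u; rewrite !inE pxy; congr (_ && _); apply: eq_forallb => t.
  rewrite (depf _ _ _ xy); case: (ltnP t c) => //= tc.
  by rewrite (gw_dep gw tc xy).
- exact: (lay_disj lay).
- exact: init_sub.
- move=> x; have := lay_size lay x; lra.
- move=> x.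
  pose bad t := [set u in T (pi x) | b x t ^+ (2 ^ (2 * s)) * #|T (pi (flip x t))|%:R
    < (deg u (T (pi (flip x t))))%:R].
  have sub' : T (pi x) :\: init_avail x \subset
      \bigcup_(t < m | (t < c)%N && (pi x != pi (flip x t))) bad t.
    apply/subsetP => u; rewrite !inE => /andP[h uT]; rewrite uT /= in h.
    move: h; rewrite negb_forall => /existsP[t]; rewrite negb_imply -ltNge => /andP[tc ht].
    by apply/bigcupP; exists t => //; rewrite inE uT.
  apply: le_trans (_ : (\sum_(t < m | (t < c)%N && (pi x != pi (flip x t))) #|bad t|)%:R <= _).
    by rewrite ler_nat; apply: leq_trans (subset_leq_card sub') (card_bigcup_leq_sum _ _).
  rewrite natr_sum big_mkcondr; apply: ler_sum => t tc; rewrite subSnn mul1r.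
  have b0 := gw_gt0 gw x tc; have b1 := gw_le1 gw x tc.
  case: ifP => [ne|_]; last by rewrite !mulr_ge0 // ltW.
  have w0 : 0 < b x t ^+ (2 ^ (2 * s)) by rewrite exprn_gt0.
  have wb : b x t ^+ (2 ^ (2 * s)) <= b x t by apply: expr_le_base.
  have P0 : 0 < b x t ^+ (2 ^ (2 * s)) * #|T (pi (flip x t))|%:R by rewrite mulr_gt0.
  have := le_trans (markov e (b x t ^+ (2 ^ (2 * s)) * #|T (pi (flip x t))|%:R) _ _) (lay_cross lay tc ne).
  rewrite -/(bad t) => h.
  have : #|bad t|%:R <= b x t ^+ (2 ^ (2 * s)) * #|T (pi x)|%:R.
    rewrite -(ler_pM2r P0); apply: le_trans h _; rewrite le_eqVlt; apply/orP; left.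
    by apply/eqP; ring.
  move/le_trans; apply; apply: ler_wpM2r => //; lra.
- by move=> x; rewrite leqnn andbT ltnW.
- by move=> x; rewrite ltW.
move=> x t u tc uA.
have b0 := gw_gt0 gw x tc; have b1 := gw_le1 gw x tc.
rewrite addnn -mul2n.
have [E|NE] := eqVneq (pi x) (pi (flip x t)).
  apply: (@le_trans _ _ (deg u (T (pi x)))%:R).
    by rewrite ler_nat deg_sub // E init_sub.
  rewrite -E; apply: le_trans (lay_inner lay (subsetP (init_sub x) _ uA)) _.
  apply: ler_wpM2r => //; apply: lerXn2r; rewrite ?nnegrE ?(ltW b0) ?(ltW (half_pow_gt0 _ _)) //.
  exact: (lay_low lay).
apply: (@le_trans _ _ (deg u (T (pi (flip x t))))%:R).
  by rewrite ler_nat deg_sub // init_sub.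
by move: uA; rewrite inE => /andP[_ /forallP/(_ t)]; rewrite tc NE.
Qed.

Lemma stage_ok_init cF : (1 <= half_pow R a * (2 ^ (m - cF))%:R) ->
  stage_ok e s cF c b j init.
Proof.
move=> hF; split=> //.
- exact: inv_init.
- by move=> x; apply: kfreeS Vfree; apply: subsetT.
- exact: (lay_weight lay).
- move=> x; split=> //=; apply/forall_inP => u uA; apply: le_trans (lay_inner lay (subsetP (init_sub x) _ uA)).
  by rewrite ler_nat deg_sub // init_sub.
move=> x /=; have [h1 h2] := lay_eta lay x; split=> //.
by apply: le_trans hF _; apply: ler_wpM2r.
Qed.

End Init.

Theorem embedding c j a lg K T pi b eta : layout c j a K T pi b eta ->
  (m <= 2 ^ lg)%N ->
  (c + stage_cost s * ((a + lg + s + 3) * (j + (a + lg + s + 3))) + a <= m)%N ->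
  red_cube e m.
Proof.
(* After [i] more stages, [8 * s * m * 2^-i <= 2^-a], because [8 * s * m <= 2^(3 + s + lg)]. All
   remaining coordinates can then be opened at once with weight [2^-(j + i)]. *)
move=> lay mlg hm; set i := (a + lg + s + 3)%N in hm.
have cFm : (m - a <= m)%N by apply: leq_subr.
have am : (a <= m)%N by apply: leq_trans hm; apply: leq_addl.
have hF : 1 <= half_pow R a * (2 ^ (m - (m - a)))%:R by rewrite subKn // half_powE.
have cm : (c <= m)%N by apply: leq_trans hm; rewrite -addnA leq_addr.
have ok := stage_ok_init lay cm hF.
have [|c' [b' [S [hc' [iS kS gw ldS sS] slS buS]]]] := stage_iter e_sym e_irr (ltnW s1) cFm _ ok (i := i).
  by rewrite leq_subRL // addnC.
have c'm : (c' <= m)%N.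
  by apply: leq_trans hc' _; apply: leq_trans hm; apply: leq_addr.
have h0 := half_pow_gt0 R (j + i); have h1 := half_pow_le1 R (j + i).
have lS x := (ldS x).1.
have iS' := inv_subdiv c'm gw iS h0 h1 lS.
have gw' := good_subweight c'm gw h0 h1.
have s0 : (0 < s)%N by apply: ltnW.
(* Three contributions of at most a quarter of [eta] each: the coordinates of the layout, the
   stages, and the final subdivision down to depth [m]. *)
have bu x : (2 * s)%:R * budget m (subweight c' b' (half_pow R (j + i))) x < eta (pi x).
  rewrite budget_sub ?c'm ?leqnn // buS /=.
  have [e1 e2] := lay_eta lay x; have := lay_budget lay x; have := lay_tail lay x.
  have t0 : 0 <= tail R (j + i) by rewrite mulr_ge0 // ltW.
  have l0 : (8 * s)%:R * ((m - c')%:R * half_pow R (j + i)) <= eta (pi x).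
    apply: le_trans e1; have q0 : 0 < ((2 ^ i)%:R : R) by rewrite ltr0n expn_gt0.
    rewrite -(ler_pM2r q0) {3}/i; apply: le_trans (_ : (8 * s * m)%:R <= _).
      rewrite !natrM -!mulrA; apply: ler_wpM2l => //; apply: ler_wpM2l => //.
      apply: le_trans (_ : m%:R * 1 <= _); last by rewrite mulr1.
      apply: ler_pM; rewrite ?mulr_ge0 ?(ltW h0) // ?ler_nat ?leq_subr //.
      apply: le_trans (_ : half_pow R i * (2 ^ i)%:R <= _); last by rewrite half_powE.
      rewrite ler_pM2r // /half_pow; apply: ler_wiXn2l.
      - by rewrite invr_ge0.
      - by rewrite invf_le1 // ler1n.
      exact: leq_addl.
    rewrite -!addnA expnD [X in _ <= _ * X]natrM mulrA half_powE mul1r ler_nat !expnD.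
    have : (s <= 2 ^ s)%N by apply/ltnW/ltn_expl.
    move: mlg; clear; set A := (2 ^ lg)%N; set B := (2 ^ s)%N => h1 h2.
    rewrite -[(8 * s * m)%N]mulnA mulnC [(s * m)%N]mulnC mulnA; apply: leq_mul => //.
    exact: leq_mul.
  have se0 : 0 < eta (pi x) by apply: lt_le_trans e1; apply: half_pow_gt0.
  move: l0 t0 se0; rewrite !natrM.
  have sc0 : 0 <= ((s%:R : R) * (stage_cost s)%:R) by rewrite mulr_ge0.
  set A := budget _ _ _; set t1 := tail _ j; set t2 := tail _ _; set B := _ * half_pow _ _.
  set E := eta _; set q := (stage_cost s)%:R in sc0 *; set p := s%:R in sc0 *.
  move=> hB ht2 hE ht1 hA.
  have := mulr_ge0 sc0 ht2.
  have -> : 2 * p * (A + q * (t1 - t2) + B) = 2 * p * A + 2 * p * q * t1 - 2 * (p * q * t2) + 2 * p * B.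
    by ring.
  move=> h2.
  have : 2 * p * A <= E / 4 by move: hA; lra.
  have : 2 * p * q * t1 <= E / 4 by move: ht1; lra.
  have : 2 * p * B <= E / 4 by move: hB; lra.
  by lra.
apply: (finish e_sym s0 gw' iS').
- move=> x; have := kS x; case: (lab _ _) => [/kfree_gt0//|[|//]] /kfree1 U0.
  have := inv_size iS x; rewrite U0 cards0 leNgt; case/negP.
  rewrite ltr_pwDl ?mulr_ge0 ?(inv_slack iS) ?(ltW (inv_scale iS x)) //.
  rewrite mulr_gt0 //; first by rewrite ltr0n card_gt0; apply/set0Pn; exists x; rewrite inE.
  by rewrite ltr_wpDr // !mulr_ge0 // (inv_slack iS).
- by move=> x; rewrite slS; apply/ltW/bu.
move=> x; apply: lt_le_trans (bu x) _; have [_ h2] := lay_eta lay x.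
apply: le_trans h2; rewrite ler_peMl ?ler1n ?muln_gt0 ?s0 //.
by have [h _] := lay_eta lay x; apply: le_trans h; rewrite ltW ?half_pow_gt0.
Qed.

End Embedding.

(** * Exact embedding into a sparse set *)

Section Parity.
Variable n : nat.
Implicit Types (x : cube n) (t : 'I_n).

Definition parity x := odd (\sum_i (x i : nat)).

Lemma parity_flip x t : parity (flip x t) = ~~ parity x.
Proof.
rewrite /parity (bigD1 t) //= [in RHS](bigD1 t) //= !oddD ffunE eqxx /=.
rewrite (eq_bigr (fun i => (x i : nat))); last by move=> i /negbTE it; rewrite ffunE it.
by case: (x t) => /=; case: (odd _).
Qed.

Lemma card_parity (c : bool) : 0 < n -> #|[set x | parity x == c]| * 2 = 2 ^ n.
Proof.
move=> n0; pose t := Ordinal n0.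
have E : #|[set x | parity x == ~~ c]| = #|[set x | parity x == c]|.
  rewrite -(card_imset _ (can_inj (@flipK _ t))); apply: eq_card => x.
  apply/imsetP/idP => [[y]|]; rewrite inE => h.
    by move: h; rewrite inE => /eqP h ->; rewrite parity_flip h negbK.
  exists (flip x t); last by rewrite flipK.
  by rewrite inE parity_flip (eqP h).
have : #|[set x | parity x == c]| + #|[set x | parity x == ~~ c]| = 2 ^ n.
  rewrite (_ : [set x | parity x == ~~ c] = ~: [set x | parity x == c]).
    by rewrite cardsC card_ffun card_bool card_ord.
  by apply/setP => x; rewrite !inE; clear; case: (parity x); case: c.
by rewrite E addnn -muln2.
Qed.

End Parity.

Lemma card_bigcup_le (I T : finType) (F : I -> {set T}) (P : pred I) k :
  (forall i, P i -> #|F i| <= k) -> #|\bigcup_(i | P i) F i| <= #|[pred i | P i]| * k.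
Proof.
move=> h; apply: leq_trans (card_bigcup_leq_sum _ _) _.
by rewrite -sum_nat_const; apply: leq_sum.
Qed.

Lemma exact_count E z P b1 b2 b3 b12 b i d : E * 2 = P -> b1 <= z -> b2 * 64 <= P ->
  b3 * 64 <= P -> 8 * z <= P -> b12 <= b1 + b2 -> b <= b12 + b3 -> i + d = E -> i <= b ->
  0 < P -> 0 < d.
Proof. lia. Qed.

Section Exact.
Variables (V : finType) (e : rel V) (n : nat) (U Z : {set V}).
Hypotheses (e_sym : symmetric e) (n0 : 0 < n).
Hypotheses (UZ : [disjoint U & Z]) (cUZ : #|U| + #|Z| = 2 ^ n) (cZ : 8 * #|Z| <= 2 ^ n).
Hypothesis sparse : {in U :|: Z, forall y, deg e y U * (64 * n) <= 2 ^ n}.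
Implicit Types (x w : cube n) (t : 'I_n).
Local Notation deg := (deg e).

(* The vertices of Z are kept on cells of even parity, hence pairwise non-adjacent;
   swapping images at even positions reduces the number of conflicts. *)
Definition placement (g : cube n -> V) := [/\ injective g,
  forall x, g x \in U :|: Z & forall x, parity x -> g x \in U].

Definition conflict (g : cube n -> V) :=
  [set x | ~~ parity x & [exists t, e (g x) (g (flip x t))]].

(** Even positions are listed before odd ones and [Z] before [U]; as [Z] is shorter than the list of
    even positions, it ends before the odd ones begin. *)
Lemma placement_exists : exists g, placement g.
Proof.
pose L := enum [set x : cube n | ~~ parity x] ++ enum [set x : cube n | parity x].
pose W := enum Z ++ enum U.
have [v0 _] : exists v0 : V, v0 \in U :|: Z.
  by apply/set0Pn; rewrite -card_gt0 cardsU (disjoint_setI0 UZ) cards0 subn0 cUZ expn_gt0.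
have cE : #|[set x : cube n | ~~ parity x]| * 2 = 2 ^ n.
  by rewrite -(card_parity false n0); congr (_ * _); apply: eq_card => x; rewrite !inE eqbF_neg.
have cO : #|[set x : cube n | parity x]| * 2 = 2 ^ n.
  by rewrite -(card_parity true n0); congr (_ * _); apply: eq_card => x; rewrite !inE eqb_id.
have sW : size W = 2 ^ n by rewrite size_cat -!cardE addnC.
have sL : size L = 2 ^ n by rewrite size_cat -!cardE; lia.
have xL x : x \in L by rewrite mem_cat !mem_enum !inE; case: (parity x).
have uW : uniq W.
  rewrite cat_uniq !enum_uniq andbT /=; apply/hasPn => u; rewrite !mem_enum => uU.
  by rewrite (disjointFr UZ).
have iL x : index x L < size W by rewrite sW -sL index_mem.
exists (fun x => nth v0 W (index x L)); split.
- move=> x y /eqP; rewrite nth_uniq // => /eqP.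
  by move=> h; rewrite -(nth_index x (xL x)) h (nth_index x (xL y)).
- by move=> x; have := mem_nth v0 (iL x); rewrite mem_cat !mem_enum inE orbC.
move=> x px; rewrite nth_cat -cardE /=.
have ge : #|Z| <= index x L.
  rewrite index_cat mem_enum inE px /= -cardE; apply: leq_trans (leq_addr _ _); lia.
rewrite ltnNge ge /= -mem_enum mem_nth // -cardE.
by have := iL x; rewrite size_cat -!cardE; lia.
Qed.

(** [B1], [B2] and [B3] collect the even [w] whose exchange with [x] might leave a conflict; [g w]
    must avoid [Z] because only degrees into [U] are bounded. They fill at most [1/8 + 1/64 + 1/64]
    of the cube, while half of it is even. Odd positions do not move, so no other position acquires
    a conflict. *)
Lemma placement_swap g x : placement g -> x \in conflict g ->
  exists2 g', placement g' & #|conflict g'| < #|conflict g|.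
Proof.
move=> [gi gU go]; rewrite inE => /andP[px xc].
pose B1 := [set w | g w \in Z].
pose B2 := \bigcup_t [set w | g w \in nbhd e (g (flip x t)) :&: U].
pose B3 := \bigcup_t [set w | g (flip w t) \in nbhd e (g x) :&: U].
have cpre (h : cube n -> V) (A : {set V}) : injective h -> #|[set w | h w \in A]| <= #|A|.
  move=> hi; rewrite -(card_imset _ hi); apply/subset_leq_card/subsetP => v /imsetP[w].
  by rewrite inE => hw ->.
have c1 : #|B1| <= #|Z| by apply: cpre.
have degb y : y \in U :|: Z -> n * deg y U * 64 <= 2 ^ n by move=> /sparse; lia.
have c2 : #|B2| * 64 <= 2 ^ n.
  have : #|B2| * 64 <= #|[pred t : 'I_n | true]| * (2 ^ n %/ (64 * n)) * 64.
    rewrite leq_mul2r; apply/orP; right; apply: card_bigcup_le => t _.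
    apply: leq_trans (cpre g _ gi) _; rewrite leq_divRL ?muln_gt0 //.
    exact: (sparse (gU (flip x t))).
  move/leq_trans; apply; rewrite card_ord; have := leq_trunc_div (2 ^ n) (64 * n); lia.
have c3 : #|B3| * 64 <= 2 ^ n.
  have : #|B3| * 64 <= #|[pred t : 'I_n | true]| * (2 ^ n %/ (64 * n)) * 64.
    rewrite leq_mul2r; apply/orP; right; apply: card_bigcup_le => t _.
    apply: leq_trans (cpre (fun w => g (flip w t)) _ _) _.
      by move=> w w' /gi/(can_inj (@flipK _ t)).
    by rewrite leq_divRL ?muln_gt0 //; apply: (sparse (gU x)).
  move/leq_trans; apply; rewrite card_ord; have := leq_trunc_div (2 ^ n) (64 * n); lia.
have cE : #|[set w : cube n | ~~ parity w]| * 2 = 2 ^ n.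
  by rewrite -(card_parity false n0); congr (_ * _); apply: eq_card => w; rewrite !inE eqbF_neg.
have [w] : exists w, w \in [set w | ~~ parity w] :\: (B1 :|: B2 :|: B3).
  apply/set0Pn; rewrite -card_gt0.
  apply: (exact_count cE c1 c2 c3 cZ (leq_card_setU B1 B2).1 (leq_card_setU (B1 :|: B2) B3).1
    (cardsID (B1 :|: B2 :|: B3) [set w : cube n | ~~ parity w])).
    exact/subset_leq_card/subsetIr.
  by rewrite expn_gt0.
rewrite inE !in_setU !negb_or [in X in _ && X]inE => /andP[/andP[/andP[w1 w2] w3] pw].
have wU : g w \in U by move: w1 (gU w); rewrite !inE => /negbTE->; rewrite orbF.
have ok2 t : ~~ e (g w) (g (flip x t)).
  apply: contra w2 => ewx; apply/bigcupP; exists t => //.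
  by rewrite !inE wU andbT e_sym.
have ok3 t : ~~ e (g x) (g (flip w t)).
  apply: contra w3 => exw; apply/bigcupP; exists t => //.
  by rewrite !inE exw go // parity_flip.
pose g' := g \o tperm x w.
have g'odd y : parity y -> g' y = g y.
  by move=> py; rewrite /g' /= tpermD //; apply: contraNneq px => xy; rewrite ?xy // -xy // (negbTE pw) in py *.
exists g'.
  split.
  - by apply: inj_comp => //; apply: perm_inj.
  - by move=> y; apply: gU.
  - by move=> y py; rewrite g'odd //; apply: go.
apply: (@leq_ltn_trans #|conflict g :\ x|); last by rewrite [X in _ < X](cardsD1 x) inE px xc.
apply/subset_leq_card/subsetP => y; rewrite inE => /andP[py /existsP[t]].
rewrite [g' (flip y t)]g'odd; last by rewrite parity_flip.
rewrite /g' /=; case: tpermP => [->|->|/eqP yx /eqP yw]; rewrite ?(negbTE (ok2 _)) ?(negbTE (ok3 _)) //.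
by move=> he; rewrite !inE yx py; apply/existsP; exists t.
Qed.

Theorem exact_cube : red_cube e n.
Proof.
have [g] := placement_exists.
have [k] := ubnP #|conflict g|; elim: k g => // k IH g hk pg.
have [c0|[x xc]] := set_0Vmem (conflict g); last first.
  have [g' pg' lt] := placement_swap pg xc.
  by apply: (IH g') => //; apply: leq_trans lt _.
have noc x t : ~~ parity x -> ~~ e (g x) (g (flip x t)).
  move=> px; apply/negP => he; have := in_set0 x; rewrite -c0 inE px /=.
  by move/negbT; rewrite negb_exists => /forallP/(_ t); rewrite he.
case: pg => gi _ _; exists g; split=> // x t.
have [px|px] := boolP (parity x); last exact: noc.
by rewrite e_sym -[x in e _ (g x)](flipK t); apply: noc; rewrite parity_flip px.
Qed.

End Exact.

(** * Dense families of sets, and the lower bound *)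

Section Meet.
Variables (V : finType) (e : rel V).
Hypotheses (e_sym : symmetric e) (e_irr : irreflexive e).
Local Notation deg := (deg e).
Implicit Types (X Y A B W : {set V}).

Definition meets g h X Y := forall A B, A \subset X -> B \subset Y -> g <= #|A| -> g <= #|B| ->
  exists2 v, v \in A & h <= deg v B.

Lemma meets_sub g h X X' Y Y' : X' \subset X -> Y' \subset Y -> meets g h X Y -> meets g h X' Y'.
Proof. by move=> XX YY h1 A B AX BY; apply: h1; apply: subset_trans; eassumption. Qed.

(* Scales g 0 > g 1 > ...: a vertex of the first set with many neighbours in all
   the others leaves neighbourhoods to which the next scale applies. *)
Lemma clique_build (N : nat) (g : nat -> nat) (Ws : seq {set V}) l :
  size Ws <= N -> (forall k, l <= k < l + size Ws -> 0 < g k) ->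
  (forall i j k, i < j < size Ws -> l <= k < l + size Ws ->
     meets (g k) (N * g k.+1) (nth set0 Ws i) (nth set0 Ws j)) ->
  {in Ws, forall W, N * g l <= #|W|} ->
  exists C : {set V}, [/\ clique e C, #|C| = size Ws & forall v, v \in C -> has (fun W => v \in W) Ws].
Proof.
elim: {Ws}(size Ws) {-2}Ws (erefl (size Ws)) l => [|n IH] [|W Ws] //= => [_|[Wn]] l sN gpos hm hW.
  by exists set0; split=> [||v]; rewrite ?clique0 ?cards0 ?inE.
have gl : 0 < g l by apply: gpos; rewrite leqnn /= addnS ltnS leq_addr.
have Wl : N * g l <= #|W| by apply: hW; rewrite mem_head.
(* A bad set of [g l] vertices would contradict [meets]; so fewer than [N * g l] vertices of [W] are
   bad for some [j], and one vertex is good for all. *)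
pose bad (j : 'I_(size Ws)) := [set v in W | deg v (nth set0 Ws j) < N * g l.+1].
have badl j : true -> #|bad j| <= (g l).-1.
  move=> _; rewrite leqNgt prednK //; apply/negP => hb.
  have h1 : 0 < j.+1 < (size Ws).+1 by apply/andP; split; rewrite ?ltnS ?ltn_ord.
  have h2 : l <= l < l + (size Ws).+1 by rewrite leqnn addnS ltnS leq_addr.
  have [||||v] := hm 0 j.+1 l h1 h2 (bad j) (nth set0 Ws j).
  - by apply/subsetP => v; rewrite inE => /andP[].
  - exact: subxx.
  - exact: hb.
  - have := hW (nth set0 Ws j); rewrite inE mem_nth ?orbT // => /(_ isT) h; apply: leq_trans h.
    by rewrite leq_pmull //; apply: leq_trans sN.
  by rewrite inE => /andP[_]; rewrite ltnNge => /negbTE->.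
have [v /setDP[vW vb]] : exists v, v \in W :\: \bigcup_j bad j.
  apply/set0Pn; rewrite -card_gt0 cardsD subn_gt0.
  apply: leq_ltn_trans (subset_leq_card (subsetIr _ _)) _.
  apply: leq_ltn_trans (card_bigcup_le badl) _; rewrite card_ord; apply: leq_trans Wl.
  move: sN gl; rewrite /=; set a := size Ws; set b := g l; nia.
have vdeg j : j < size Ws -> N * g l.+1 <= deg v (nth set0 Ws j).
  move=> js; rewrite leqNgt; apply: contra vb => h; apply/bigcupP; exists (Ordinal js) => //.
  by rewrite inE vW.
pose Ws' := map (fun W => nbhd e v :&: W) Ws.
have sW' : size Ws' = n by rewrite size_map.
have [||||C [cC sC CW]] := IH Ws' sW' l.+1.
- by rewrite sW' -Wn ltnW.
- by move=> k; rewrite sW' -Wn => hk; apply: gpos; lia.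
- move=> i j k; rewrite sW' -Wn => /andP[ij js] hk.
  rewrite !(nth_map set0) //; last exact: ltn_trans ij js.
  have := hm i.+1 j.+1 k; rewrite /= !ltnS ij js => /(_ isT) h.
  by apply: meets_sub (h _); rewrite ?subsetIr //; lia.
- move=> W' /mapP[W'' W''s ->]; rewrite -(nth_index set0 W''s); apply: vdeg.
  by rewrite index_mem.
have Cv : C \subset nbhd e v.
  apply/subsetP => u /CW/hasP[W' /mapP[W'' _ ->]]; by rewrite inE => /andP[].
exists (v |: C); split.
- exact: (clique_cons e_sym).
- by rewrite (card_cons_nbhd e_irr Cv) sC sW' -Wn.
move=> u; rewrite inE => /orP[/set1P->|uC]; first by rewrite vW.
have /hasP[W' /mapP[W'' W''s ->]] := CW u uC; rewrite inE => /andP[_ uW].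
by apply/orP; right; apply/hasP; exists W''.
Qed.

End Meet.

Section Reduction.
Variables (s n : nat).

Lemma ramsey_upper N :
  (forall e : rel 'I_N, symmetric e -> irreflexive e -> kfree e s [set: 'I_N] -> red_cube e n) ->
  ramsey_prop (complete_graph s) (hypercube n) N.
Proof.
move=> H c; pose e := colour_adj c blue.
have [kf|] := boolP (kfree e s [set: 'I_N]).
  right; have [f [fi fe]] := H e (colour_sym c blue) (colour_irr c blue) kf.
  exists f; split=> // x y; rewrite /adj /= /hypercube_adj => /cards1P[t ht].
  have yE : y = flip x t.
    apply/ffunP => i; rewrite ffunE; have := in_set1 i t; rewrite -ht inE.
    by case: (i == t); case: (x i); case: (y i).
  have nxy : f x != f y.
    rewrite (inj_eq fi) yE; apply/negP => /eqP/ffunP/(_ t); rewrite ffunE eqxx.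
    by case: (x t).
  have := fe x t; rewrite -yE /e /colour_adj /adj /= nxy /=; by case: (c _).
rewrite negb_forall => /existsP[C]; rewrite negb_imply -leqNgt => /andP[/andP[_ /cliqueP cC] sC].
left; pose f (i : 'I_s) : 'I_N := enum_val (widen_ord sC i).
have fi : injective f by move=> i j /enum_val_inj/(congr1 val) /= /val_inj.
exists f; split=> // i j; rewrite {1}/adj /= => ij.
by apply: cC; rewrite ?enum_valP // (inj_eq fi).
Qed.

Lemma cube_connected (P : cube n -> nat) : (forall x t, P (flip x t) = P x) -> forall x y, P x = P y.
Proof.
move=> h x y; have [k] := ubnP #|[set i | x i != y i]|; elim: k x => // k IH x.
have [E _|[t tE] hk] := set_0Vmem [set i | x i != y i].
  congr P; apply/ffunP => i; apply/eqP; apply: negbNE.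
  by have := in_set0 i; rewrite -E inE => ->.
rewrite -(h x t); apply: IH; rewrite -ltnS; apply: leq_trans hk; rewrite !ltnS (cardsD1 t [set i | x i != y i]) tE.
apply/subset_leq_card/subsetP => i; rewrite !inE ffunE.
have [->|it] //= := eqVneq i t.
by move: tE; rewrite inE; case: (x t); case: (y t).
Qed.

Lemma ramsey_lower M : 0 < s -> 0 < n -> ramsey_prop (complete_graph s) (hypercube n) M ->
  (s - 1) * (2 ^ n - 1) + 1 <= M.
Proof.
move=> spos n0 H; rewrite leqNgt addn1 ltnS; apply/negP => hM.
have n2 : 1 < 2 ^ n by rewrite -{1}(expn0 2) ltn_exp2l.
pose q := 2 ^ n - 1; have q0 : 0 < q by rewrite /q; lia.
pose c (A : {set complete_graph M}) := [forall x in A, forall y in A, (x %/ q == y %/ q :> nat)].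
have cE (x y : 'I_M) : c [set x; y] = (x %/ q == y %/ q).
  apply/forall_inP/eqP => [h|h z].
    by have /forall_inP/(_ y) := h x (set21 _ _); rewrite set22 => /(_ isT)/eqP.
  by rewrite !inE => /orP[]/eqP->; apply/forall_inP => w; rewrite !inE => /orP[]/eqP->; rewrite ?eqxx ?h.
case: (H c) => [[f [fi fe]]|[f [fi fe]]].
  have s0 (i : 'I_s) : f i %/ q < s - 1 by rewrite ltn_divLR //; apply: leq_trans hM.
  pose g i := Ordinal (s0 i).
  have gi : injective g.
    move=> i j [/eqP E]; apply/eqP; apply: contraT => ij.
    have : colour_adj c blue (f i) (f j) := fe i j ij.
    by rewrite /colour_adj cE E; case/andP.
  have := leq_card g gi; rewrite !card_ord.
  by lia.
have E x y : f x %/ q = f y %/ q.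
  apply: (@cube_connected (fun x => f x %/ q)) => z t; apply/eqP.
  suff : adj (flip z t : hypercube n) z.
    move/fe => h; have : colour_adj c red (f (flip z t)) (f z) := h.
    by rewrite /colour_adj cE => /andP[_ /eqP].
  rewrite /adj /= /hypercube_adj; apply/cards1P; exists t; apply/setP => i.
  by rewrite !inE ffunE; case: (i == t); case: (z i).
pose x0 : cube n := [ffun=> false].
pose g x : 'I_q := Ordinal (ltn_pmod (f x) q0).
have gi : injective g.
  move=> x y [h]; apply/fi/val_inj.
  by rewrite /= (divn_eq (f x) q) (divn_eq (f y) q) h (E x y).
have := leq_card g gi; rewrite card_ffun card_bool !card_ord /q; lia.
Qed.

End Reduction.

(** * Paths of sparse sets *)

(** [f] stands for the level sizes of the cube. The ratio of consecutive terms is [(c - k) / k.+1]: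
    up to the middle it is about 1 or more, and [i] steps starting at or before the middle cost at
    most a factor [1 - 2 * i^2 / c] altogether. *)
Lemma binomial_growth (f : nat -> nat) c k i :
  (forall k, k < c -> (c - k) * f k = k.+1 * f k.+1) -> 2 * k <= c -> 4 * i ^ 2 <= c ->
  f k * (c - 2 * i ^ 2) <= c * f (k + i).
Proof.
move=> hf kc; elim: i => [|i IH] hi; first by rewrite addn0 mulnC leq_mul2r leq_subr orbT.
have {}IH : f k * (c - 2 * i ^ 2) <= c * f (k + i) by apply: IH; move: hi; rewrite !expnS !expn0; nia.
have kic : k + i < c by move: hi; rewrite !expnS !expn0; nia.
have := hf _ kic; rewrite addnS; set F := f (k + i) in IH *; set G := f (k + i).+1 => hG.
have P0 : 0 < (k + i).+1 by [].
rewrite -(leq_pmul2l P0) [_ * (c * G)]mulnCA -hG.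
apply: (@leq_trans ((c - (k + i)) * (f k * (c - 2 * i ^ 2)))); last first.
  by rewrite [leqRHS]mulnCA leq_mul2l IH orbT.
rewrite mulnCA [leqRHS]mulnCA leq_mul2l; apply/orP; right.
move: hi kc; rewrite !expnS !expn0 !muln1; clear.
move=> hi kc.
set A := c - 2 * (i.+1 * i.+1); set p := c - (k + i).
have hB : c - 2 * (i * i) = A + (4 * i + 2) by rewrite /A; nia.
have hA : A <= 2 * p by rewrite /A /p; nia.
have hk : (k + i).+1 <= p + (2 * i + 1) by rewrite /p; lia.
rewrite hB; clearbody A p; nia.
Qed.

(** The [L] terms from [k] on are each at least half of [f k]; above the middle the sequence is
    reflected first, which is why [f] is generalised together with [k]. This replaces an estimate of
    the central binomial coefficient. *)
Lemma binomial_spread (f : nat -> nat) c k L :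
  (forall k, k < c -> (c - k) * f k = k.+1 * f k.+1) -> k <= c -> 4 * L ^ 2 <= c ->
  f k * L <= 2 * \sum_(j < c.+1) f j.
Proof.
wlog kc : f k / 2 * k <= c => [W hf kc hL|hf _ hL].
  have [|ck] := leqP (2 * k) c; first by move=> h; apply: W.
  rewrite (reindex_inj rev_ord_inj) /=.
  have := W (fun j => f (c - j)) (c - k); rewrite subKn //.
  move=> -> //; first by lia.
    move=> j jc; have := hf (c - j.+1); rewrite subKn // => ->; last by lia.
    by rewrite subnSK.
  exact: leq_subr.
have hb i : i < L -> f k <= 2 * f (k + i).
  move=> iL; have i2 : 4 * i ^ 2 <= c by apply: leq_trans hL; rewrite leq_mul2l leq_exp2r // ltnW.
  have := binomial_growth hf kc i2; have [c0|c0] := posnP c.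
    have : L = 0 by move: hL; rewrite c0; case: (L) => // L'; rewrite !expnS; lia.
    by move=> L0; rewrite L0 in iL.
  move=> h; rewrite -(leq_pmul2r c0); move: h i2; set F := f _; set G := f (k + i); set q := i ^ 2.
  nia.
have [->|L0] := posnP L; first by rewrite muln0.
have kL : k + L <= c.+1 by move: hL; rewrite !expnS expn0; nia.
apply: (@leq_trans (\sum_(i < L) 2 * f (k + i))).
  by rewrite mulnC -[X in X * _]card_ord -sum_nat_const; apply: leq_sum => i _; apply: hb.
rewrite -big_distrr leq_mul2l /=.
rewrite -(big_mkord xpredT (fun j => f j)) (big_cat_nat (n := k)) //=; last by lia.
rewrite (big_cat_nat (n := k + L) (m := k)) //=; last by lia.
have -> : \sum_(k <= j < k + L) f j = \sum_(i < L) f (k + i).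
  by rewrite -{1}[k]add0n big_addn addKn big_mkord; apply: eq_bigr => i _; rewrite addnC.
by rewrite addnCA leq_addr ?orbT.
Qed.

(** * Hamming levels in the first [c] coordinates *)

Section Levels.
Variables (n c : nat).
Hypothesis cn : c <= n.
Implicit Types (x : cube n) (t : 'I_n).

Definition wt x := \sum_(i < n | i < c) (x i : nat).

Lemma wt_dep x y : agree c x y -> wt x = wt y.
Proof. by move=> /agreeP h; apply: eq_bigr => i ic; rewrite h. Qed.

Lemma wt_flip x t : t < c -> wt (flip x t) = if x t then (wt x).-1 else (wt x).+1.
Proof.
move=> tc; have wE y : wt y = y t + \sum_(i < n | (i < c) && (i != t)) y i by rewrite /wt (bigD1 t).
rewrite !wE ffunE eqxx /=.
rewrite (eq_bigr (fun i => (x i : nat))); last by move=> i /andP[_ /negbTE it]; rewrite ffunE it.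
by case: (x t).
Qed.

Lemma wt_pos x t : t < c -> x t -> 0 < wt x.
Proof. by move=> tc xt; rewrite /wt (bigD1 t) //= xt. Qed.

Lemma card_lt_ord : #|[pred i : 'I_n | i < c]| = c.
Proof.
rewrite -sum1_card (eq_bigl (fun i : 'I_n => i < c)) //.
by rewrite -(big_ord_widen _ (fun _ => 1) cn) sum1_card card_ord.
Qed.

Lemma wt_le x : wt x <= c.
Proof.
rewrite -[leqRHS]card_lt_ord -sum1_card; apply: leq_sum => i _; exact: leq_b1.
Qed.

Lemma wt_compl x : \sum_(i < n | i < c) (~~ x i : nat) = c - wt x.
Proof.
have : \sum_(i < n | i < c) (~~ x i : nat) + wt x = c.
  rewrite -big_split /= -[RHS]card_lt_ord -sum1_card; apply: eq_bigr => i _.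
  by case: (x i).
by move=> H; apply: (canRL (addnK (wt x))).
Qed.

Definition level k := #|[set x | wt x == k]|.

(** Double counting of the cube edges between the two levels, in directions below [c]. *)
Lemma level_rec k : k < c -> (c - k) * level k = k.+1 * level k.+1.
Proof.
move=> kc.
transitivity (\sum_(x | wt x == k) \sum_(t < n | t < c) (~~ x t : nat)).
  rewrite mulnC /level cardsE -sum_nat_const; apply: eq_bigr => x /eqP <-.
  by rewrite wt_compl.
transitivity (\sum_(x | wt x == k.+1) \sum_(t < n | t < c) (x t : nat)); last first.
  rewrite mulnC /level cardsE -sum_nat_const; apply: eq_bigr => x /eqP <- //.
rewrite exchange_big [RHS]exchange_big /=; apply: eq_bigr => t tc.
rewrite [RHS](reindex_inj (can_inj (@flipK _ t))) /= big_mkcond [RHS]big_mkcond /=.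
apply: eq_bigr => x _; rewrite wt_flip // ffunE eqxx /=.
by case xt: (x t) => //=; case: ifP => //; case: ifP.
Qed.

Lemma level_sum : \sum_(k < c.+1) level k = 2 ^ n.
Proof.
rewrite -[2]card_bool -[n in RHS]card_ord -card_ffun -sum1_card.
rewrite (partition_big (fun x : cube n => inord (wt x) : 'I_c.+1) xpredT) //=.
apply: eq_bigr => k _; rewrite /level cardsE -sum1_card; apply: eq_bigl => x.
rewrite unfold_in -val_eqE /= inordK // ltnS; exact: wt_le.
Qed.

Lemma level_small Y k : 4 * (2 ^ Y.+1) ^ 2 <= c -> level k * 2 ^ Y <= 2 ^ n.
Proof.
move=> hc; have [kc|ck] := leqP k c.
  have := binomial_spread level_rec kc hc; rewrite level_sum expnS; lia.
rewrite /level (_ : [set x | _] = set0) ?cards0 //.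
by apply/setP => x; rewrite !inE; apply/negbTE; rewrite neq_ltn (leq_ltn_trans (wt_le x)).
Qed.

End Levels.

(** Fill the bins in order and open the next one when the next item does not fit. A closed bin then
    holds more than [q i - nu], so the strict inequality on the totals prevents bin [l] from being
    opened; a fresh bin can always take one item since [nu <= q i]. *)
Lemma greedy_fill (m q : nat -> nat) nu l c :
  (forall k, m k <= nu) -> (forall i, nu <= q i) ->
  \sum_(k < c.+1) m k < \sum_(i < l) (q i - nu) ->
  exists sg : nat -> nat, [/\ forall k, k <= c -> sg k < l,
    forall k, k < c -> sg k.+1 = sg k \/ sg k.+1 = (sg k).+1 &
    forall i, \sum_(k < c.+1 | sg k == i) m k <= q i].
Proof.
move=> mn nq hS.
suff [sg [h1 h2 h3 h4]] : exists sg : nat -> nat, [/\ forall k, k <= c -> sg k <= sg c,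
    forall k, k < c -> sg k.+1 = sg k \/ sg k.+1 = (sg k).+1,
    forall i, \sum_(k < c.+1 | sg k == i) m k <= q i &
    \sum_(i < sg c) (q i - nu) + \sum_(k < c.+1 | sg k == sg c) m k <= \sum_(k < c.+1) m k].
  exists sg; split=> // k /h1 kc; apply: leq_ltn_trans kc _; rewrite ltnNge; apply/negP => lc.
  move: hS; rewrite ltnNge; case/negP; apply: leq_trans (leq_trans (leq_addr _ _) h4).
  rewrite -!(big_mkord xpredT (fun i => q i - nu)) (big_cat_nat (n := l) (p := sg c)) //=.
  exact: leq_addr.
elim: {hS}c => [|c [sg [h1 h2 h3 h4]]].
  exists (fun=> 0); split=> [[]|||] //; last by rewrite big_ord0.
  move=> i; rewrite big_mkcond big_ord1; case: eqP => // _; exact: leq_trans (nq i).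
have sumE v i : \sum_(k < c.+2 | (if k == c.+1 :> nat then v else sg k) == i) m k =
    \sum_(k < c.+1 | sg k == i) m k + (if v == i then m c.+1 else 0).
  rewrite big_mkcond big_ord_recr /= eqxx; congr (_ + _); rewrite [RHS]big_mkcond /=.
  by apply: eq_bigr => k _; rewrite (ltn_eqF (ltn_ord k)).
set used := \sum_(k < c.+1 | sg k == sg c) m k in h4.
have [le|gt] := leqP (used + m c.+1) (q (sg c)).
  exists (fun k => if k == c.+1 then sg c else sg k); split.
  - by move=> k; rewrite eqxx; case: eqP => // kc; rewrite leq_eqVlt => /orP[/eqP//|/h1].
  - move=> k; rewrite ltnS eqSS leq_eqVlt => /orP[/eqP->|kc]; first by rewrite eqxx ltn_eqF //; left.
    by rewrite !ltn_eqF //; [exact: h2|exact: leqW].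
  - by move=> i; rewrite sumE; case: eqP => [<-|_] //; rewrite addn0.
  by rewrite eqxx sumE eqxx addnA [leqRHS]big_ord_recr leq_add2r.
exists (fun k => if k == c.+1 then (sg c).+1 else sg k); split.
- move=> k; rewrite eqxx; case: eqP => // kc; rewrite leq_eqVlt => /orP[/eqP//|/h1].
  exact: leqW.
- move=> k; rewrite ltnS eqSS leq_eqVlt => /orP[/eqP->|kc]; first by rewrite eqxx ltn_eqF //; right.
  by rewrite !ltn_eqF //; [exact: h2|exact: leqW].
- move=> i; rewrite sumE; case: eqP => [<-|_]; last by rewrite addn0.
  rewrite big1 ?add0n; first exact: leq_trans (mn _) (nq _).
  by move=> k /eqP E; have := h1 k (ltn_ord k); rewrite E ltnn.
rewrite eqxx sumE eqxx [leqRHS]big_ord_recr /= big_ord_recr /= addnA leq_add2r.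
rewrite [X in _ + X]big1 ?addn0; last by move=> k /eqP E; have := h1 k (ltn_ord k); rewrite E ltnn.
apply: leq_trans h4; rewrite leq_add2l.
by have := mn c.+1; have := nq (sg c); move: gt; clear; lia.
Qed.

Lemma poly_exp A B t : 4 * (A + B + 40) <= t -> A + B * (t + A) ^ 2 <= 2 ^ t.
Proof.
move=> /subnKC <-; elim: (t - _) => [|d IH].
  rewrite addn0; set k := A + B + 40; rewrite [4 * k]mulnC expnM.
  have k2 : k <= 2 ^ k by apply/ltnW/ltn_expl.
  have : k ^ 4 <= (2 ^ k) ^ 4 by rewrite leq_exp2r.
  apply: leq_trans; rewrite !expnS !expn0 !muln1.
  have h1 : A <= k by rewrite /k; lia.
  have h2 : B <= k by rewrite /k; lia.
  have h3 : 40 <= k by rewrite /k; lia.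
  have h4 : k * 4 + A <= 5 * k by lia.
  apply: (@leq_trans (k + k * (5 * k * (5 * k)))).
    by apply: leq_add => //; apply: leq_mul => //; apply: leq_mul.
  nia.
rewrite addnS [2 ^ _.+1]expnS; move: IH; set q := 2 ^ _; set t' := _ + d => IH.
have : 3 <= t' by rewrite /t'; lia.
move: IH; clearbody q t'; rewrite addSn; set v := t' + A => IH t3.
have h : v.+1 ^ 2 <= 2 * v ^ 2 by rewrite -!mulnn /v; nia.
apply: (leq_trans _ (leq_mul (leqnn 2) IH)); rewrite mulnDr [2 * (B * _)]mulnCA.
by apply: leq_add; [rewrite leq_pmull|rewrite leq_mul2l h orbT].
Qed.

(** The embedding needs a number of coordinates that is quadratic in [log n]; this turns the
    requirement into a lower bound on [n] alone. *)
Lemma log_poly A B n : 2 ^ (4 * (A.+1 + B + 40)) <= n ->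
  A + B * ((trunc_log 2 n).+1 + A) ^ 2 <= n.
Proof.
move=> hn; have n0 : 0 < n by apply: leq_trans hn; rewrite expn_gt0.
have h1 := trunc_logP (isT : 1 < 2) n0.
have h2 : 4 * (A.+1 + B + 40) <= trunc_log 2 n by apply: trunc_log_max.
apply: (leq_trans _ h1); apply: (leq_trans _ (poly_exp h2)).
by rewrite addSnnS leq_add2r.
Qed.

Section Tail.
Variable R : realFieldType.
Local Open Scope ring_scope.

Lemma half_powD j k : half_pow R (j + k) = half_pow R j * half_pow R k.
Proof. exact: exprD. Qed.

Lemma half_powX j k : half_pow R j ^+ k = half_pow R (j * k).
Proof. by rewrite /half_pow exprM. Qed.

Lemma half_pow_nat (x y k : nat) : (x * 2 ^ k <= y)%N -> (x%:R : R) <= half_pow R k * y%:R.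
Proof.
have h0 := half_pow_gt0 R k; rewrite -(ler_nat R) natrM => h.
have -> : (x%:R : R) = half_pow R k * (x%:R * (2 ^ k)%:R).
  by rewrite mulrCA [half_pow _ _ * _]mulrC [_%:R * half_pow _ _]mulrC half_powE mulr1.
by apply: ler_wpM2l; [exact: ltW|exact: h].
Qed.

(** [tail] has a factor linear in its argument; with argument [2 * i], one half of the exponent
    absorbs it and [tail R (2 * i) <= 4 * 2^-i]. *)
Lemma tail_small a k B : (B <= 2 ^ k)%N ->
  B%:R * tail R (2 * (a + k + 2)) <= half_pow R a.
Proof.
move=> Bk; set i := (a + k + 2)%N.
have t4 : tail R (2 * i) <= 4 * half_pow R i.
  rewrite /tail [half_pow R _](_ : _ = half_pow R i * half_pow R i); last by rewrite -half_powD addnn mul2n.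
  rewrite mulrA; apply: ler_wpM2r; first exact/ltW/half_pow_gt0.
  have : (2 * (2 * i) + 4 <= 4 * 2 ^ i)%N by have := ltn_expl i (isT : (1 < 2)%N); lia.
  rewrite -(ler_nat R) => h; have h0 := half_pow_gt0 R i.
  apply: le_trans (ler_wpM2r (ltW h0) h) _.
  by rewrite natrM -mulrA [_%:R * half_pow _ _]mulrC half_powE mulr1.
have B0 : 0 <= (B%:R : R) by [].
apply: le_trans (ler_wpM2l B0 t4) _.
rewrite mulrCA /i !half_powD.
have hk : B%:R * half_pow R k <= 1.
  apply: le_trans (_ : (2 ^ k)%:R * half_pow R k <= _); last by rewrite mulrC half_powE.
  by apply: ler_wpM2r; [exact/ltW/half_pow_gt0|rewrite ler_nat].
have ha := half_pow_gt0 R a.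
have h2 : half_pow R 2 = 4^-1 by rewrite /half_pow exprVn -natrX.
rewrite h2; have := ler_wpM2l (ltW ha) hk.
by set p := half_pow R a; set q := half_pow R k => h; lra.
Qed.

Lemma half_pow_mul B a : (B <= 2 ^ a)%N -> B%:R * half_pow R a <= 1.
Proof.
move=> Bk; apply: le_trans (_ : (2 ^ a)%:R * half_pow R a <= _); last by rewrite mulrC half_powE.
by apply: ler_wpM2r; [exact/ltW/half_pow_gt0|rewrite ler_nat].
Qed.

(** With [h = 2^-a] the point is that [(1 - 2 * s * h) * (1 + 2 * (s - 1) * h) + h <= 1]. *)
Lemma size_bound N t s a : (0 < s)%N -> (2 * s <= 2 ^ a)%N ->
  (N * 2 ^ a <= t * (2 ^ a - 2 * s))%N ->
  N%:R * (1 + 2 * s.-1%:R * half_pow R a) + half_pow R a * t%:R <= t%:R.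
Proof.
move=> s0 s2; rewrite -(ler_nat R) !natrM natrB // => hN.
have h0 := half_pow_gt0 R a; have hE := half_powE R a.
have ss : (s%:R : R) = s.-1%:R + 1 by rewrite natr1 prednK.
have s10 : 0 <= (s.-1%:R : R) by [].
have {}hN : N%:R <= t%:R * (1 - 2 * s%:R * half_pow R a).
  have := ler_wpM2r (ltW h0) hN.
  have -> : N%:R * (2 ^ a)%:R * half_pow R a = N%:R by rewrite -mulrA [(2 ^ a)%:R * _]mulrC hE mulr1.
  move=> /le_trans; apply; rewrite le_eqVlt; apply/orP; left; apply/eqP.
  transitivity (t%:R * (half_pow R a * (2 ^ a)%:R - (2 * s)%:R * half_pow R a)); first by ring.
  by rewrite hE natrM.
have t0 : 0 <= (t%:R : R) by [].
have hh1 := half_pow_mul s2.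
rewrite natrM ss in hh1; rewrite ss in hN.
move: h0 hh1 t0 s10 hN; clear.
set h := half_pow R a; set t' := (t%:R : R); set p := (s.-1%:R : R); set N' := N%:R.
move=> h0 h1 t0 p0 hN.
have ph : 0 <= p * h by rewrite mulr_ge0 // ltW.
have hf : 0 <= 1 + 2 * p * h by lra.
have := ler_wpM2r hf hN; move=> /lerD /(_ (lexx (h * t'))) /le_trans; apply.
rewrite -subr_ge0.
have -> : t' - (t' * (1 - 2 * (p + 1) * h) * (1 + 2 * p * h) + h * t') = t' * (h + 4 * (p * h) * ((p + 1) * h)) by ring.
rewrite mulr_ge0 // addr_ge0 ?(ltW h0) // !mulr_ge0 // ?ltW //; lra.
Qed.

Lemma half_tail j : half_pow R j <= tail R j.
Proof.
by rewrite /tail; apply: ler_peMl; [exact/ltW/half_pow_gt0|rewrite ler1n; lia].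
Qed.
End Tail.

(** The case of one weight [2^-j] and one slack [2^-a] everywhere, with hypotheses over [nat], so
    that all later counting stays within integers. *)
Lemma uniform_embedding s a c k n lg (V : finType) (e : rel V) l (T : nat -> {set V}) (pi : cube n -> nat) :
  let j := 2 * (a + k + 2) in
  symmetric e -> irreflexive e -> 1 < s -> kfree e s [set: V] -> c <= n ->
  8 * s * stage_cost s + 8 * s * c <= 2 ^ k -> 2 * s <= 2 ^ a ->
  (forall x, pi x < l) -> (forall x x', agree c x x' -> pi x = pi x') ->
  (forall i k, i < l -> k < l -> i != k -> [disjoint T i & T k]) ->
  (forall x, #|[set x' | pi x' == pi x]| * 2 ^ a <= #|T (pi x)| * (2 ^ a - 2 * s)) ->
  (forall x u, u \in T (pi x) -> deg e u (T (pi x)) * 2 ^ (j * 2 ^ (2 * s)) <= #|T (pi x)|) ->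
  (forall x (t : 'I_n), t < c -> pi x != pi (flip x t) ->
    edges e (T (pi x)) (T (pi (flip x t))) * 2 ^ (j * 2 ^ (2 * s) * 2) <= #|T (pi x)| * #|T (pi (flip x t))|) ->
  n <= 2 ^ lg -> c + stage_cost s * ((a + lg + s + 3) * (j + (a + lg + s + 3))) + a <= n ->
  red_cube e n.
Proof.
move=> j e_sym e_irr s1 kf cn hk s2 pil pid dis size inner cross hlg.
pose R : realFieldType := rat.
pose b : weight n R := fun _ _ => half_pow R j.
pose eta (i : nat) : R := half_pow R a.
apply: (embedding e_sym e_irr s1 kf _ hlg (T := T) (pi := pi) (b := b) (eta := eta) (K := l)).
split=> //.
- by split=> *; rewrite /b ?half_pow_gt0 ?half_pow_le1.
- by move=> x; exact: size_bound (ltnW s1) s2 (size x).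
- by move=> x u uT; rewrite half_powX; apply: half_pow_nat; apply: inner.
- move=> x t tc ne; rewrite -exprM half_powX -mulrA -natrM; apply: half_pow_nat.
  by rewrite mulnA; apply: cross.
- by move=> x; split=> //; apply: half_pow_mul.
- move=> x; rewrite /budget (eq_bigr (fun _ => half_pow R j)) // sumr_const (_ : #|_| = c); last exact: card_lt_ord.
  rewrite -[(half_pow R j *+ c)%R]mulr_natl mulrA -natrM.
  apply: le_trans (_ : (8 * s * c)%:R * tail R j <= _)%R; last first.
    by apply: tail_small; apply: leq_trans hk; apply: leq_addl.
  by apply: ler_wpM2l => //; exact: half_tail.
- by move=> x; apply: tail_small; apply: leq_trans hk; apply: leq_addr.
Qed.

(** Of a set with [t] vertices, the slack takes a proportion [2 * s / 2^a] and greedy filling may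
    waste [2^(n - (y + z + 3))]. Both are small against [t / 2^z], so all but a proportion
    [2^-(z + 1)] can be filled. *)
Lemma bulk_share n t y z s a q :
  y + z + 3 <= n -> 2 ^ n <= t * 2 ^ y -> 2 * s * 2 ^ (z + 3) <= 2 ^ a ->
  q = (t * (2 ^ a - 2 * s)) %/ 2 ^ a ->
  t * (2 ^ z.+1).-1 <= (q - 2 ^ (n - (y + z + 3))) * 2 ^ z.+1 /\ 2 ^ (n - (y + z + 3)) <= q.
Proof.
move=> hn ht hs hq; set nu := 2 ^ (n - _).
have nuE : nu * (2 ^ y * 2 ^ z * 8) = 2 ^ n by rewrite (_ : 2 ^ y * 2 ^ z * 8 = 2 ^ (y + z + 3)); [rewrite /nu -expnD subnK|rewrite !expnD].
have h1 : nu * (2 ^ z * 8) <= t.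
  by rewrite -(leq_pmul2r (expn_gt0 2 y)); apply: leq_trans ht; rewrite -nuE; lia.
have nu0 : 0 < nu by rewrite expn_gt0.
have := divn_eq (t * (2 ^ a - 2 * s)) (2 ^ a); rewrite -hq.
have := ltn_pmod (t * (2 ^ a - 2 * s)) (expn_gt0 2 a); set r := _ %% _.
move: hs h1; rewrite expnD -[2 ^ 3]/8 [2 ^ z.+1]expnS; set Z := 2 ^ z; set E := 2 ^ a.
have Z0 : 0 < Z by rewrite expn_gt0.
have E0 : 0 < E by rewrite expn_gt0.
clearbody nu Z E r; clear -nu0 Z0 E0 => hs h1 hr hq.
have h2 : t * 2 * s * (Z * 8) <= t * E by rewrite -!mulnA leq_mul2l; apply/orP; right; lia.
have h3 : t * E <= q * E + r + t * 2 * s by rewrite -hq mulnBr; lia.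
have h4 : (t * (Z * 8 - 1)) * E <= (q + 1) * (Z * 8) * E.
  have : (q + 1) * E + t * 2 * s >= t * E by lia.
  move=> h; have : ((q + 1) * E + t * 2 * s) * (Z * 8) >= t * E * (Z * 8) by rewrite leq_mul2r h orbT.
  rewrite mulnBr muln1 mulnBl; lia.
rewrite leq_pmul2r // in h4.
have h5 : t * (Z * 8) <= q * (Z * 8) + Z * 8 + t by move: h4; rewrite mulnBr; lia.
have h6 : nu <= q.
  rewrite leqNgt; apply/negP => h; have : q.+1 * (Z * 8) <= t by apply: leq_trans h1; rewrite leq_mul2r h orbT.
  rewrite mulSn => h7; have : t * (Z * 8) <= 2 * t by lia.
  nia.
split=> //; have -> : (2 * Z).-1 = 2 * Z - 1 by lia.
rewrite mulnBl mulnBr muln1.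
have : t * (Z * 2) + 3 * t <= q * (2 * Z) * 4 + Z * 8 + t - t * (Z * 2) * 3 + 3 * t by lia.
have : Z * 8 <= t by apply: leq_trans h1; rewrite leq_pmull.
lia.
Qed.

(** * Distribution of the levels along a path of sets *)

Section Path.
Variables s y z : nat.
Hypotheses (s1 : 1 < s) (z0 : 0 < z).
(** The slack [2^-a] is small against the excess [2^-z] of the path; [2^(n - Y)] is small against a
    single set, and [c] is large enough for [level_small] to bound every level by it; [k] and [j]
    are those of [uniform_embedding]. *)
Let a := z + s + 4.
Let Y := y + z + 3.
Let c := 4 * (2 ^ Y.+1) ^ 2.
Let k := 8 * s * stage_cost s + 8 * s * c.
Let j := 2 * (a + k + 2).

Definition path_density := j * 2 ^ (2 * s) * 2.
Definition path_dim :=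
  let A := c + a + s + 3 + Y + j + z in 2 ^ (4 * (A.+1 + stage_cost s * 2 + 40)).

(* The cells are cut out by the first c coordinates and are given to the sets Ts
   by increasing Hamming weight, so that adjacent cells get equal or consecutive
   sets. *)
Lemma path_embedding n (V : finType) (e : rel V) (Ts : seq {set V}) :
  path_dim <= n -> symmetric e -> irreflexive e -> kfree e s [set: V] ->
  (forall i k, i < size Ts -> k < size Ts -> i != k -> [disjoint nth set0 Ts i & nth set0 Ts k]) ->
  {in Ts, forall T : {set V}, 2 ^ n <= #|T| * 2 ^ y} ->
  {in Ts, forall (T : {set V}) u, u \in T -> deg e u T * 2 ^ path_density <= #|T|} ->
  (forall i, i.+1 < size Ts -> edges e (nth set0 Ts i) (nth set0 Ts i.+1) * 2 ^ path_density
     <= #|nth set0 Ts i| * #|nth set0 Ts i.+1|) ->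
  2 ^ n * (2 ^ z).+1 <= 2 ^ z * \sum_(i < size Ts) #|nth set0 Ts i| ->
  red_cube e n.
Proof.
move=> hn e_sym e_irr kf dis big inner cross total.
set l := size Ts in dis cross total *; pose T i := nth set0 Ts i.
set A := c + a + s + 3 + Y + j + z in hn.
have hlog := log_poly hn; set lg := (trunc_log 2 n).+1 in hlog.
have An : A <= n by apply: leq_trans hlog; apply: leq_addr.
have cn : c <= n by apply: leq_trans An; rewrite /A; clearbody c a Y j; lia.
have Yn : Y <= n by apply: leq_trans An; rewrite /A; clearbody c a Y j; lia.
have bigT i : i < l -> 2 ^ n <= #|T i| * 2 ^ y by move=> il; apply: big; apply: mem_nth.
pose nu := 2 ^ (n - Y).
(* The value [nu] past the end of the path only serves to make [nu <= q i] hold for every [i], as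
   [greedy_fill] requires. *)
pose q i := if i < l then (#|T i| * (2 ^ a - 2 * s)) %/ 2 ^ a else nu.
have s2a : 2 * s * 2 ^ (z + 3) <= 2 ^ a.
  rewrite (_ : a = (s + 1) + (z + 3)); last by rewrite /a; clear; lia.
rewrite [2 ^ (s + 1 + _)]expnD leq_mul2r; apply/orP; right; rewrite addn1 [leqRHS]expnS leq_mul2l.
  by apply/orP; right; apply/ltnW/ltn_expl.
have nuE : nu * 2 ^ Y = 2 ^ n by rewrite /nu -expnD subnK.
have qlow i : i < l -> #|T i| * ((2 ^ z.+1).-1) <= (q i - nu) * 2 ^ z.+1 /\ nu <= q i.
  move=> il; apply: bulk_share Yn (bigT i il) s2a _.
  by rewrite /q il.
have lev k0 : level n c k0 <= nu.
  by rewrite -(leq_pmul2r (expn_gt0 2 Y)) nuE; apply: level_small.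
have nq i : nu <= q i.
  by have [il|il] := ltnP i l; [case: (qlow i il)|rewrite /q ltnNge il].
(* The usable room is at least [(1 - 2^-(z + 1)) * (1 + 2^-z) * 2^n], which exceeds [2^n] as soon as
   [z > 0]. *)
have hS : \sum_(k0 < c.+1) level n c k0 < \sum_(i < l) (q i - nu).
  rewrite level_sum // -(ltn_pmul2r (expn_gt0 2 z.+1)) big_distrl /=.
  apply: (@leq_trans (\sum_(i < l) #|T i| * (2 ^ z.+1).-1)); last first.
    by apply: leq_sum => i _; case: (qlow i (ltn_ord i)).
  rewrite -big_distrl /= -(ltn_pmul2l (expn_gt0 2 z)) [ltnRHS]mulnA.
  apply: (leq_trans _ (leq_mul total (leqnn _))); rewrite -mulnA mulnCA ltn_pmul2l ?expn_gt0 //.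
  have : 1 < 2 ^ z by rewrite -{1}(expn0 2) ltn_exp2l.
  rewrite expnS; set Z := 2 ^ z; clearbody Z; clear; move=> hZ; nia.
have [sg [sgl sgs sgq]] := greedy_fill lev nq hS.
pose pi (x : cube n) := sg (wt c x).
have pil x : pi x < l by apply: sgl; apply: wt_le.
have pistep (x : cube n) (t : 'I_n) : t < c -> pi (flip x t) = pi x \/ pi (flip x t) = (pi x).+1 \/ pi x = (pi (flip x t)).+1.
  move=> tc; rewrite /pi wt_flip //; case xt: (x t).
    have w0 := wt_pos tc xt; have wc := wt_le cn x.
    have := sgs (wt c x).-1; rewrite prednK // => /(_ wc) [->|->]; [by left|by right; right].
  have wc : wt c x < c.
    have := wt_le cn (flip x t); rewrite wt_flip // xt.
    exact.
  by case: (sgs _ wc) => ->; [left|right; left].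
have s2 : 2 * s <= 2 ^ a by apply: leq_trans s2a; rewrite leq_pmulr ?expn_gt0.
apply: (uniform_embedding (k := k) e_sym e_irr s1 kf cn _ s2 pil (T := T) _ dis (lg := lg)).
- by apply/ltnW/ltn_expl.
- by move=> x x' /wt_dep E; rewrite /pi E.
- move=> x; have -> : #|[set x' | pi x' == pi x]| = \sum_(k0 < c.+1 | sg k0 == pi x) level n c k0.
    rewrite -sum1_card (partition_big (fun x' : cube n => inord (wt c x') : 'I_c.+1) (fun k0 => sg k0 == pi x)) /=.
      apply: eq_bigr => k0 /eqP sk; rewrite /level -sum1_card; apply: eq_bigl => x'.
      rewrite !inE -val_eqE /= inordK ?ltnS ?wt_le //.
      case: (wt c x' =P k0) => [E|_]; rewrite ?andbF // andbT; apply/eqP; exact: etrans (congr1 sg E) sk.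
    by move=> x'; rewrite inE inordK ?ltnS ?wt_le.
  apply: leq_trans (leq_mul (sgq (pi x)) (leqnn _)) _; rewrite /q pil; exact: leq_trunc_div.
- move=> x u uT; have := inner (T (pi x)) (mem_nth _ (pil x)) u uT; apply: leq_trans.
  by rewrite leq_mul2l leq_exp2l // /path_density leq_pmulr ?orbT.
- move=> x t tc ne; have [E|[E|E]] := pistep x t tc; first by rewrite E eqxx in ne.
    by rewrite E; apply: cross; rewrite -E; apply: pil.
  by rewrite edgesC // E [leqRHS]mulnC; apply: cross; rewrite -E; apply: pil.
- by apply/ltnW/trunc_log_ltn.
apply: leq_trans hlog; set a' := a + lg + s + 3.
have h1 : a' <= lg + A by rewrite /a' /A; clearbody c a Y j; clear; lia.
have h2 : j + a' <= lg + A by rewrite /a' /A; clearbody c a Y j; clear; lia.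
have h3 : c + a <= A by rewrite /A; clearbody c a Y j; clear; lia.
rewrite addnAC; apply: leq_add => //; rewrite -mulnA leq_mul2l; apply/orP; right.
by rewrite -mulnn; apply: leq_trans (leq_mul h1 h2) _; rewrite leq_pmull.
Qed.

End Path.

(** * Partition into s - 1 dense classes *)

Section Colouring.
Variables (V : finType) (e : rel V).
Hypotheses (e_sym : symmetric e) (e_irr : irreflexive e).
Local Notation deg := (deg e).
Implicit Types (phi : V -> nat) (lab : nat -> nat).

Definition cls phi k : {set V} := [set v | phi v == k].

(** Only the colours below [K0] are cleaned. While one of them has a vertex of large inner degree,
    exactly [theta] of its neighbours move to a fresh colour with a label smaller by one. So each
    fresh colour lowers the sum of labels by [theta] and adds [theta] vertices to the colours from
    [K0] on: these are the two final accounts. *)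
Lemma recolour_stage phi lab K0 K theta :
  0 < theta -> K0 <= K -> (forall v, phi v < K) -> (forall k, kfree e (lab k) (cls phi k)) ->
  exists phi' lab' K', [/\ K0 <= K', forall v, phi' v < K', forall k, kfree e (lab' k) (cls phi' k),
    forall u, phi' u < K0 -> deg u (cls phi' (phi' u)) < theta &
    [/\ \sum_v lab' (phi' v) + K' * theta <= \sum_v lab (phi v) + K * theta &
      K' * theta + #|[set v | K0 <= phi v]| = K * theta + #|[set v | K0 <= phi' v]|]].
Proof.
move=> t0; have [p] := ubnP (\sum_v lab (phi v)); elim: p phi lab K => // p IH phi lab K hp KK hphi hlab.
have [/existsP[v /andP[vK hv]]|/existsPn hD] :=
    boolP [exists v, (phi v < K0) && (theta <= deg v (cls phi (phi v)))]; last first.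
  exists phi, lab, K; split=> // u uK; rewrite ltnNge; apply/negP => h.
  by have := hD u; rewrite uK h.
have [N NX cN] := card_subset_exists hv.
pose phi' v := if v \in N then K else phi v.
pose lab' k := if k == K then (lab (phi v)).-1 else lab k.
have Nphi u : u \in N -> phi u = phi v.
  by move/(subsetP NX); rewrite !inE => /andP[_ /eqP].
have l0 : 0 < lab (phi v) := kfree_gt0 (hlab (phi v)).
have kN : kfree e (lab (phi v)).-1 N.
  apply: kfreeS NX _; apply: kfree_nbhd => //; first by rewrite inE.
  by rewrite prednK.
have E : \sum_u lab' (phi' u) + theta = \sum_u lab (phi u).
  rewrite -cN -sum1_card [X in _ + X]big_mkcond -big_split /=; apply: eq_bigr => u _.
  rewrite /lab' /phi'; case uN: (u \in N); first by rewrite eqxx Nphi // addn1 prednK.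
  by rewrite ltn_eqF // addn0.
have [||||phi2 [lab2 [K2 [h1 h2 h3 h4 [h5 h6]]]]] := IH phi' lab' K.+1.
- by move: hp; rewrite -E; lia.
- exact: leqW.
- by move=> u; rewrite /phi'; case: ifP => // _; apply: ltnW; rewrite ltnS.
- move=> k; rewrite /lab'; case: eqP => [->|kK].
    apply: kfreeS kN; apply/subsetP => u; rewrite inE /phi'; case: ifP => // _.
    by rewrite ltn_eqF.
  apply: kfreeS (hlab k); apply/subsetP => u; rewrite !inE /phi'; case: ifP => // _ /eqP E'.
  by case: kK.
exists phi2, lab2, K2; split=> //; split.
  by move: h5; rewrite -E mulSn; lia.
have E2 : #|[set u | K0 <= phi' u]| = theta + #|[set u | K0 <= phi u]|.
  rewrite -cN -!sum1_card [RHS]addnC [X in _ + X]big_mkcond /= [X in _ = X + _]big_mkcond -big_split big_mkcond /=.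
  apply: eq_bigr => u _; rewrite !inE /phi'; case uN: (u \in N); last by rewrite addn0.
  by rewrite KK leqNgt Nphi // vK.
by move: h6; rewrite E2 mulSn; lia.
Qed.

(* The sum of the labels drops by more than 2^n / 2^y in each unfinished round. *)
Lemma gap_colouring (F : nat -> nat) s y n t x phi lab K :
  let G z := z + F z + s + 1 in
  iter t G x <= n -> #|V| <= s * 2 ^ n -> \sum_v lab (phi v) * 2 ^ y < t * 2 ^ n ->
  K <= 2 ^ x -> (forall v, phi v < K) -> (forall k, kfree e (lab k) (cls phi k)) ->
  exists x' phi' K', [/\ x' <= iter t G x, K' <= 2 ^ x', #|[set v | K' <= phi' v]| * 2 ^ y <= 2 ^ n &
    forall u, phi' u < K' -> deg u (cls phi' (phi' u)) * 2 ^ F x' <= 2 ^ n].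
Proof.
move=> G; elim: t x phi lab K => [|t IH] x phi lab K; first by rewrite mul0n.
rewrite iterSr => hn hV hpot hK hphi hlab.
have Gle i z : z <= iter i G z by elim: i => //= i h; apply: (leq_trans h); rewrite /G; lia.
have Fn : F x <= n by apply: leq_trans hn; apply: leq_trans (Gle t _); rewrite /G; lia.
have th0 : 0 < 2 ^ (n - F x) by rewrite expn_gt0.
have [phi' [lab' [K' [h1 h2 h3 h4 [h5 h6]]]]] := recolour_stage th0 (leqnn K) hphi hlab.
have c0 : #|[set v | K <= phi v]| = 0.
  by apply: eq_card0 => v; rewrite inE leqNgt hphi.
set W := [set v | K <= phi' v] in h6; rewrite c0 addn0 in h6.
have thE : 2 ^ (n - F x) * 2 ^ F x = 2 ^ n by rewrite -expnD subnK.
have [hW|hW] := leqP (#|W| * 2 ^ y) (2 ^ n).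
  exists x, phi', K; split=> //; first by apply: leq_trans (Gle t _); rewrite /G; lia.
  move=> u uK; rewrite -thE leq_mul2r; apply/orP; right; exact/ltnW/h4.
have [||x2 [phi2 [K2 [k1 k2 k3 k4]]]] := IH (G x) phi' lab' K' hn hV _ _ h2 h3; last by exists x2, phi2, K2.
- move: hpot hW; rewrite -!big_distrl /= mulSn; move: h5 h6; clear.
  set P' := \sum_v _; set P := \sum_v lab _; set w := #|W|; set Z := 2 ^ y; set N := 2 ^ n; set T := 2 ^ (n - _).
  move=> h5 h6 hp hw; have : P' + w <= P by lia.
  move=> h; have : (P' + w) * Z <= P * Z by rewrite leq_mul2r h orbT.
  rewrite mulnDl; lia.
- have hW2 : #|W| <= s * 2 ^ n by apply: leq_trans hV; apply: max_card.
  have : K' * 2 ^ (n - F x) <= (2 ^ x + s * 2 ^ F x) * 2 ^ (n - F x).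
    rewrite h6 mulnDl; apply: leq_add; first by rewrite leq_mul2r hK orbT.
    by rewrite -mulnA [2 ^ F x * _]mulnC thE.
  rewrite leq_pmul2r // => /leq_trans; apply.
  have s2 : s <= 2 ^ s by apply/ltnW/ltn_expl.
  rewrite /G !expnD expn1; have p1 : 0 < 2 ^ x by rewrite expn_gt0.
  have p2 : 0 < 2 ^ F x by rewrite expn_gt0.
  have p3 : 0 < 2 ^ s by rewrite expn_gt0.
  move: s2 p1 p2 p3; set a := 2 ^ x; set b := 2 ^ F x; set c := 2 ^ s; clearbody a b c; clear.
  move=> h pa pb pc.
  have : a <= a * b * c by rewrite -mulnA leq_pmulr // muln_gt0 pb.
  have : s * b <= a * b * c.
    by rewrite [a * b]mulnC -mulnA mulnC leq_mul2l; apply/orP; right; apply: (leq_trans h); rewrite leq_pmull.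
  lia.
Qed.

End Colouring.

(** Start from one colour of label [s]. The sum of labels is at most [s * s * 2^n], so the number of
    rounds, and with it [X], does not depend on [n]. The colours from [K] on are the waste of the
    last round. *)
Lemma gap (F : nat -> nat) s y : exists X, forall n (V : finType) (e : rel V),
  symmetric e -> irreflexive e -> kfree e s [set: V] -> X <= n -> #|V| <= s * 2 ^ n ->
  exists x (phi : V -> nat) K, [/\ x <= X, K <= 2 ^ x, #|[set v | K <= phi v]| * 2 ^ y <= 2 ^ n &
    forall u, phi u < K -> deg e u (cls phi (phi u)) * 2 ^ F x <= 2 ^ n].
Proof.
exists (iter (s * s * 2 ^ y).+1 (fun z => z + F z + s + 1) 0) => n V e e_sym e_irr kf hn hV.
have [||||x [phi [K []]]] := @gap_colouring V e e_sym e_irr F s y n (s * s * 2 ^ y).+1 0 (fun=> 0) (fun=> s) 1 hn hV.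
- rewrite /= sum_nat_const mulSn (_ : #|_| = #|V|) //; have : 0 < 2 ^ n by rewrite expn_gt0.
  have : #|V| * s * 2 ^ y <= s * 2 ^ n * s * 2 ^ y by rewrite !leq_mul2r hV !orbT.
  set a := 2 ^ n; set b := 2 ^ y; set c := #|V|; clearbody a b c; clear; nia.
- by [].
- by [].
- by move=> k; apply: kfreeS kf; apply: subsetT.
by exists x, phi, K.
Qed.

Section Attach.
Variables (V : finType) (e : rel V).
Hypotheses (e_sym : symmetric e) (e_irr : irreflexive e).
Local Notation deg := (deg e).

(** Otherwise [clique_build] applies to the neighbourhoods of [y] in the [p] sets, and [y] extends
    the clique found there to [p + 1] vertices. *)
Lemma nbhd_light (N : nat) (g : nat -> nat) p (W : nat -> {set V}) l y : p <= N ->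
  kfree e p.+1 [set: V] -> (forall k, l <= k < l + p -> 0 < g k) ->
  (forall i j k, i < p -> j < p -> i != j -> l <= k < l + p -> meets e (g k) (N * g k.+1) (W i) (W j)) ->
  exists2 i, i < p & deg y (W i) < N * g l.
Proof.
move=> pN kf gpos hm.
have [/existsP[i hi]|/existsPn h] := boolP [exists i : 'I_p, deg y (W i) < N * g l].
  by exists i.
pose Ws := mkseq (fun i => nbhd e y :&: W i) p.
have sW : size Ws = p by rewrite size_mkseq.
have [||||C [cC sC CW]] := @clique_build V e e_sym e_irr N g Ws l.
- by rewrite sW.
- by rewrite sW.
- move=> i j k; rewrite sW => /andP[ij jp] hk; have ip := ltn_trans ij jp.
  rewrite !nth_mkseq //; apply: meets_sub (hm i j k ip jp _ hk); rewrite ?subsetIr //.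
  by rewrite ltn_eqF.
- move=> S /(nthP set0)[i]; rewrite sW => ip <-; rewrite nth_mkseq //.
  by have := h (Ordinal ip); rewrite -leqNgt.
have Cy : C \subset nbhd e y.
  apply/subsetP => v /CW/hasP[S /(nthP set0)[i]]; rewrite sW => ip <-.
  by rewrite nth_mkseq // inE => /andP[].
have := kfreeP _ _ _ kf (y |: C) (subsetT _) (clique_cons e_sym Cy cC).
by rewrite (card_cons_nbhd e_irr Cy) sC sW ltnn.
Qed.

(** Every vertex is light to some [W i]. By [meets] at the first scale at most [g 0] vertices of
    [W i] are light to a given other set; once these are deleted, a vertex of [U i] can only be
    light to its own set. *)
Lemma attach (N : nat) (g : nat -> nat) p (W : nat -> {set V}) : p <= N ->
  kfree e p.+1 [set: V] -> (forall k, k <= p -> 0 < g k) ->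
  (forall i j k, i < p -> j < p -> i != j -> k <= p -> meets e (g k) (N * g k.+1) (W i) (W j)) ->
  (forall i, i < p -> g 0 <= #|W i|) ->
  exists U : nat -> {set V}, [/\ forall i, i < p -> U i \subset W i /\ #|W i| <= #|U i| + p * g 0,
    forall i, i < p -> {in U i, forall u, deg u (U i) < N * g 1} &
    forall y, exists2 i, i < p & deg y (U i) < N * g 1].
Proof.
move=> pN kf gpos hm hW.
have light y : exists2 i, i < p & deg y (W i) < N * g 1.
  apply: nbhd_light => // [k hk|i j k ip jp ij hk]; first by apply: gpos; lia.
  by apply: hm => //; lia.
pose bad i (j : 'I_p) := [set y in W i | deg y (W j) < N * g 1].
pose U i := W i :\: \bigcup_(j < p | j != i :> nat) bad i j.
have UW i : U i \subset W i by apply: subsetDl.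
exists U; split=> [i ip|i ip u|y].
- split=> //; have badl (j : 'I_p) : j != i :> nat -> #|bad i j| <= g 0.
    move=> ji; rewrite leqNgt; apply/negP => h.
    have ij : i != j by rewrite eq_sym.
    have [||||v] := hm i j 0 ip (ltn_ord j) ij (leq0n p) (bad i j) (W j).
    + by apply/subsetP => v; rewrite inE => /andP[].
    + exact: subxx.
    + exact: ltnW.
    + exact: hW.
    by rewrite inE => /andP[_]; rewrite ltnNge => /negbTE->.
  rewrite /U cardsD; set B := \bigcup_(_ < _ | _) _.
  have hB : #|B| <= p * g 0.
    by apply: leq_trans (card_bigcup_le badl) _; rewrite leq_mul2r -[leqRHS]card_ord max_card orbT.
  have := subset_leq_card (subsetIr (W i) B); have := subset_leq_card (subsetIl (W i) B).
  lia.
- rewrite inE => /andP[ub uW]; have [j jp hj] := light u.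
  have [E|ji] := eqVneq j i; first by apply: leq_ltn_trans (deg_sub _ _ (UW i)) _; rewrite -E.
  by case/negP: ub; apply/bigcupP; exists (Ordinal jp) => //; rewrite inE uW.
by have [i ip hi] := light y; exists i => //; apply: leq_ltn_trans (deg_sub _ _ (UW i)) hi.
Qed.

End Attach.

Section Link.
Variables (V : finType) (e : rel V).
Hypotheses (e_sym : symmetric e) (e_irr : irreflexive e).
Local Notation deg := (deg e).
Local Notation edges := (edges e).
Implicit Types (A B : {set V}).

Lemma half_light A B D L : 0 < L -> edges A B * D <= #|A| * L ->
  #|A| <= 2 * #|[set a in A | deg a B * D <= 2 * L]|.
Proof.
move=> L0 h; set G := [set a in A | _].
have GA : G \subset A by apply/subsetP => a; rewrite inE => /andP[].
have cAG : #|A :\: G| + #|G| = #|A| by rewrite addnC -(cardsID G A) (setIidPr GA).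
suff : #|A :\: G| * (2 * L) <= #|A| * L by rewrite [2 * L]mulnC mulnCA mulnC -mulnA; nia.
apply: leq_trans h; rewrite /edges big_distrl /= (big_setID G) /= -sum_nat_const.
apply: leq_trans (leq_addl _ _); apply: leq_sum => a; rewrite !inE => /andP[ha aA].
by move: ha; rewrite aA /= -ltnNge => /ltnW.
Qed.

(** First [B] is reduced to the vertices with at most twice the average degree into [A], and [B'] is
    taken there; then [A] is treated likewise with respect to [B']. Each reduction keeps half of the
    set and costs a factor 2 in density. *)
Lemma sparse_link r K D p q A B : 0 < K -> 0 < p -> 0 < q -> kfree e r A -> kfree e r B ->
  edges A B * D <= #|A| * #|B| -> 2 * (p * (16 * K) ^ r) <= #|A| -> 2 * (q * (16 * K) ^ r) <= #|B| ->
  exists A' B', [/\ [/\ A' \subset A, #|A'| = p & {in A', forall u, deg u A' * K <= p}],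
    [/\ B' \subset B, #|B'| = q & {in B', forall u, deg u B' * K <= q}] & edges A' B' * D <= 4 * (p * q)].
Proof.
move=> K0 p0 q0 kA kB hE hA hB.
have A0 : 0 < #|A| by apply: leq_trans hA; rewrite !muln_gt0 p0 expn_gt0 muln_gt0 K0.
have hE' : edges B A * D <= #|B| * #|A| by rewrite edgesC // [leqRHS]mulnC.
have := half_light A0 hE'; set B1 := [set b in B | _] => hB1.
have B1B : B1 \subset B by apply/subsetP => b; rewrite inE => /andP[].
have [|B' [B'B cB' iB']] := sparse_subset e_sym e_irr K0 q0 (kfreeS B1B kB).
  by rewrite -(leq_pmul2l (isT : 0 < 2)); apply: leq_trans hB1.
have hE2 : edges A B' * D <= #|A| * (2 * q).
  apply: (@leq_trans (\sum_(b in B') 2 * #|A|)); last by rewrite sum_nat_const cB'; lia.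
  rewrite edgesC // /edges big_distrl /=; apply: leq_sum => b bB.
  by have := subsetP B'B b bB; rewrite inE => /andP[].
have L0 : 0 < 2 * q by rewrite muln_gt0.
have := half_light L0 hE2; set A1 := [set a in A | _] => hA1.
have A1A : A1 \subset A by apply/subsetP => a; rewrite inE => /andP[].
have [|A' [A'A cA' iA']] := sparse_subset e_sym e_irr K0 p0 (kfreeS A1A kA).
  by rewrite -(leq_pmul2l (isT : 0 < 2)); apply: leq_trans hA1.
exists A', B'; split; [split=> //|split=> //|].
- exact: subset_trans A1A.
- exact: subset_trans B1B.
rewrite mulnCA [4 * q](_ : _ = 2 * (2 * q)); last by rewrite mulnA.
rewrite -{1}cA' -sum_nat_const /edges big_distrl /=; apply: leq_sum => a aA.
by have := subsetP A'A a aA; rewrite inE => /andP[].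
Qed.
End Link.

Lemma walk_cover (I : finType) (r : rel I) (a : I) (S : seq I) :
  connect_sym r -> {in S, forall b, connect r a b} ->
  exists2 p, path r a p & {subset S <= a :: p} /\ size p <= size S * #|I|.
Proof.
move=> csym; elim: S => [|b S IH] hS; first by exists [::].
have [|p pp [Sp sp]] := IH; first by move=> c cS; apply: hS; rewrite inE cS orbT.
have : connect r (last a p) b.
  apply: connect_trans (hS b (mem_head _ _)); rewrite csym; apply/connectP; by exists p.
case/connectP => p0 + lb; rewrite lb; case/shortenP => p2 pp2 up2 _; exists (p ++ p2).
  by rewrite cat_path pp.
split.
  move=> c; rewrite inE => /orP[/eqP->|/Sp]; last by rewrite !inE mem_cat orbA => ->.
  by rewrite -cat_cons -last_cat; apply: mem_last.
rewrite size_cat mulSn addnC leq_add // -(card_uniqP (_ : uniq p2)) ?max_card //.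
by case/andP: up2.
Qed.

(** * A cube along a walk through a link component *)

Section Snake.
Variables (s x u z n : nat).
(** [2^(n - v)] is the size of the pieces cut out for one link: [2 * x] pays for the length of the
    walk, at most [2^(2 * x)], and [4 * s] for the factor [16^s] in [sparse_link]. *)
Let v := u + 2 * x + 4 * s + 4.
Definition snake_density := path_density s v z.
Variables (V : finType) (e : rel V) (K : nat) (X : 'I_K -> {set V}) (F : nat).
Hypotheses (e_sym : symmetric e) (e_irr : irreflexive e) (Vfree : kfree e s [set: V]).
Hypotheses (s1 : 1 < s) (z0 : 0 < z) (Kx : K <= 2 ^ x).
Hypothesis Xdis : forall a b, a != b -> [disjoint X a & X b].
Hypothesis Xbig : forall a, 2 ^ n <= #|X a| * 2 ^ u.
Hypothesis Xinner : forall a w, w \in X a -> deg e w (X a) * 2 ^ F <= 2 ^ n.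
Hypotheses (hF : v + snake_density <= F) (hn : path_dim s v z <= n) (vn : v <= n).
Local Notation deg := (deg e).
Local Notation edges := (edges e).

(** Four spare bits of density: removing the vertices already used may halve both sets, and
    [sparse_link] loses a factor 4. *)
Definition link (a b : 'I_K) := (a != b) && [exists A : {set V}, exists B : {set V},
  [&& A \subset X a, B \subset X b, 2 ^ n <= #|A| * 2 ^ u, 2 ^ n <= #|B| * 2 ^ u &
      edges A B * 2 ^ (snake_density + 4) <= #|A| * #|B|]].

Lemma link_sym : symmetric link.
Proof.
suff h a b : link a b -> link b a by move=> a b; apply/idP/idP; apply: h.
case/andP=> ab /existsP[A /existsP[B /and5P[h1 h2 h3 h4 h5]]].
rewrite /link eq_sym ab; apply/existsP; exists B; apply/existsP; exists A.
by rewrite h1 h2 h3 h4 edgesC // [leqRHS]mulnC.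
Qed.

Let q := 2 ^ (n - v).
Let q0 : 0 < q. Proof. by rewrite expn_gt0. Qed.
Let qE : q * 2 ^ v = 2 ^ n. Proof. by rewrite -expnD subnK. Qed.

Let usedE : 2 ^ (2 * x) * (2 * q) * 2 ^ u.+1 <= 2 ^ n.
Proof.
rewrite -qE [2 * q]mulnC mulnCA -!mulnA leq_mul2l -expnS -expnD leq_exp2l // /v.
by apply/orP; right; lia.
Qed.

(* [(a, Some A)] is a subset A of X a used by a link; [(a, None)] is all that is
   left of X a in the end. *)
Local Notation item := ('I_K * option {set V})%type.
Definition linked (i j : item) := (i.1 == j.1) || (if (i.2, j.2) is (Some A, Some B)
  then edges A B * 2 ^ snake_density <= #|A| * #|B| else false).
Definition used (S : seq item) : {set V} := \bigcup_(i <- S) oapp id set0 i.2.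

Record snake_ok (a : 'I_K) p (S : seq item) := SnakeOk {
  snake_sorted : exists o S', S = (a, o) :: S' /\ path linked (a, o) S';
  snake_uniq : uniq S;
  snake_bulk : {in a :: p, forall b, (b, None) \in S};
  snake_sub : forall b A, (b, Some A) \in S -> A \subset X b /\ #|A| = q;
  snake_dis : forall b A c B, (b, Some A) \in S -> (c, Some B) \in S ->
    (b, Some A) != (c, Some B) -> [disjoint A & B];
  snake_used : #|used S| <= size p * (2 * q) }.

Lemma used_sub (S : seq item) b A : (b, Some A) \in S -> A \subset used S.
Proof.
rewrite /used; elim: S => //= i S IH; rewrite inE big_cons => /orP[/eqP<-|/IH h]; first exact: subsetUl.
by apply: subset_trans h (subsetUr _ _).
Qed.

(** Induction from the end of the walk. Each step cuts a fresh pair of pieces outside all earlier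
    ones. Items of one class may always follow each other, so a walk that returns to a class does no
    harm; only the remainder [(a, None)] must not occur twice. *)
Lemma snake_exists a p : path link a p -> size p <= 2 ^ (2 * x) -> exists S, snake_ok a p S.
Proof.
elim: p a => [|b p IH] a.
  move=> _ _; exists [:: (a, None)]; split=> //.
  - by exists None, [::].
  - by move=> b; rewrite !inE => /eqP->.
  - by move=> b A; rewrite inE => /eqP[].
  - by move=> b A c B; rewrite inE => /eqP[].
  - by rewrite /used big_seq1 cards0.
rewrite [path _ _ _]/= => /andP[ab pp] sp; have sp' : size p <= 2 ^ (2 * x) by apply: ltnW.
have [|S hS] := IH b pp; first exact: sp'.
case/andP: ab => ab /existsP[A /existsP[B /and5P[AX BX cA cB hE]]].
have hU : #|used S| * 2 ^ u.+1 <= 2 ^ n.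
  apply: leq_trans (leq_mul (snake_used hS) (leqnn _)) _.
  apply: leq_trans (_ : 2 ^ (2 * x) * (2 * q) * 2 ^ u.+1 <= _).
    by rewrite !leq_mul2r sp' !orbT.
  exact: usedE.
have halve (C : {set V}) : 2 ^ n <= #|C| * 2 ^ u -> #|C| <= 2 * #|C :\: used S|.
  move=> cC; have : 2 * #|C :&: used S| <= #|C|.
    rewrite -(leq_pmul2r (expn_gt0 2 u)) mulnAC -expnS; apply: leq_trans cC; apply: leq_trans hU.
    by rewrite mulnC leq_mul2r subset_leq_card ?subsetIr ?orbT.
  by have := cardsID (used S) C; lia.
have kf (C : {set V}) : kfree e s C by apply: kfreeS Vfree; apply: subsetT.
have big (C : {set V}) : 2 ^ n <= #|C| * 2 ^ u -> 2 * (q * (16 * 1) ^ s) <= #|C :\: used S|.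
  move=> cC; rewrite -(leq_pmul2l (isT : 0 < 2)); apply: leq_trans (halve C cC).
  rewrite -(leq_pmul2r (expn_gt0 2 u)); apply: leq_trans cC.
  rewrite (_ : 2 * _ * 2 ^ u = q * (2 ^ (2 + 4 * s + u))); last first.
    have h16 : 16 ^ s = 2 ^ (4 * s) by rewrite expnM.
    by rewrite muln1 h16 !expnD; set a1 := 2 ^ u; set a2 := 2 ^ (4 * s); clearbody a1 a2; lia.
  by rewrite -qE leq_mul2l leq_exp2l // /v; apply/orP; right; lia.
have hE1 : edges (A :\: used S) (B :\: used S) * 2 ^ snake_density.+2 <= #|A :\: used S| * #|B :\: used S|.
  rewrite -(leq_pmul2l (isT : 0 < 4)); apply: leq_trans (_ : #|A| * #|B| <= _); last first.
    by have := leq_mul (halve A cA) (halve B cB); lia.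
  apply: leq_trans hE; rewrite addn4 mulnCA !expnS !mulnA -!mulnA.
  by rewrite leq_mul ?edgesS ?subsetDl //; lia.
(* The value [K = 1] asks for no inner sparsity: the pieces inherit it from the classes, through
   [Xinner]. *)
have [A' [B' [[A'A cA' _] [B'B cB' _] hE']]] := sparse_link e_sym e_irr (isT : 0 < 1) q0 q0
  (kf _) (kf _) hE1 (big A cA) (big B cB).
have {hE'} hE' : edges A' B' * 2 ^ snake_density <= #|A'| * #|B'|.
  by rewrite cA' cB' -(leq_pmul2l (isT : 0 < 4)); move: hE'; rewrite !expnS; lia.
have [A'X A'U] : A' \subset X a /\ [disjoint A' & used S].
  by move: A'A; rewrite subsetD => /andP[h1 ->]; rewrite (subset_trans h1).
have [B'X B'U] : B' \subset X b /\ [disjoint B' & used S].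
  by move: B'B; rewrite subsetD => /andP[h1 ->]; rewrite (subset_trans h1).
have nS c (C : {set V}) : [disjoint C & used S] -> #|C| = q -> (c, Some C) \notin S.
  move=> CU cC; apply/negP => /used_sub CS; move: CU; rewrite -setI_eq0 (setIidPl CS) => /eqP C0.
  by move: q0; rewrite -cC C0 cards0.
have AB : [disjoint A' & B'].
  by apply: disjointWl A'X _; apply: disjointWr B'X _; apply: Xdis.
have usedD (C : {set V}) c (D : {set V}) : [disjoint C & used S] -> (c, Some D) \in S -> [disjoint C & D].
  by move=> CU /used_sub DS; apply: disjointWr DS CU.
case: hS => [[o [S' [ES pS]]] uS bS sS dS cS].
set S1 := [:: (a, Some A'), (b, Some B') & S].
have u1 : uniq S1.
  by rewrite /= inE negb_or !nS // uS !andbT xpair_eqE negb_and ab.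
have sub1 c C : (c, Some C) \in S1 -> C \subset X c /\ #|C| = q.
  by rewrite !inE => /or3P[/eqP[-> ->]|/eqP[-> ->]|/sS].
have dis1 c C d D : (c, Some C) \in S1 -> (d, Some D) \in S1 -> (c, Some C) != (d, Some D) -> [disjoint C & D].
  rewrite !inE => /or3P[/eqP[-> ->]|/eqP[-> ->]|cC] /or3P[/eqP[-> ->]|/eqP[-> ->]|dD] //; rewrite ?eqxx // => ne.
  - exact: usedD dD.
  - by rewrite disjoint_sym.
  - exact: usedD dD.
  - by rewrite disjoint_sym; apply: usedD cC.
  - by rewrite disjoint_sym; apply: usedD cC.
  - exact: dS cC dD ne.
have used1 : #|used S1| <= (size p).+1 * (2 * q).
  rewrite /used !big_cons /= -/(used S) mulSn.
  apply: leq_trans (leq_card_setU _ _).1 _; rewrite cA' mul2n -addnn -addnA leq_add2l.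
  by apply: leq_trans (leq_card_setU _ _).1 _; rewrite cB' leq_add2l addnn -mul2n.
have p1 : path linked (a, Some A') ((b, Some B') :: S).
  by rewrite ES /= pS /linked /= hE' eqxx orbT.
have [aS|aS] := boolP ((a, None) \in S).
  exists S1; split=> //; first by exists (Some A'), ((b, Some B') :: S).
  by move=> c; rewrite inE => /orP[/eqP->|/bS cSb]; rewrite !inE ?aS ?cSb ?orbT.
exists ((a, None) :: S1); split=> //.
- by exists None, S1; split=> //=; rewrite /linked /= eqxx; exact: p1.
- by rewrite cons_uniq u1 andbT !inE !negb_or aS !xpair_eqE !andbF.
- by move=> c; rewrite inE => /orP[/eqP->|/bS cSb]; rewrite !inE ?eqxx ?cSb ?orbT.
- by move=> c C; rewrite inE => /orP[/eqP[]//|/sub1].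
- by move=> c C d D; rewrite inE => /orP[/eqP[]//|h1]; rewrite inE => /orP[/eqP[]//|h2]; apply: dis1 h1 h2.
- by rewrite /used big_cons set0U.
Qed.

Definition content (S : seq item) (i : item) : {set V} :=
  if i.2 is Some A then A else X i.1 :\: used S.

Lemma snake_embed a p S : snake_ok a p S -> size p <= 2 ^ (2 * x) ->
  2 ^ n * (2 ^ z).+1 <= 2 ^ z * #|\bigcup_(b in a :: p) X b| -> red_cube e n.
Proof.
move=> hS sp total; have [[o [S' [ES pS]]] uS bS sS dS cS] := hS.
pose Ts := map (content S) S.
have sTs : size Ts = size S by rewrite size_map.
have nthT i : i < size S -> nth set0 Ts i = content S (nth (a, None) S i).
  by move=> iS; rewrite (nth_map (a, None)).
have sub i : i \in S -> content S i \subset X i.1.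
  by case: i => b [A /sS[]|_] //; apply: subsetDl.
have big i : i \in S -> 2 ^ n <= #|content S i| * 2 ^ v.
  case: i => b [A /sS[_ cA]|_]; first by rewrite /content /= cA qE.
  rewrite /content /= cardsD; have := subset_leq_card (subsetIr (X b) (used S)).
  have : #|used S| * 2 ^ u.+1 <= 2 ^ n.
    apply: leq_trans (leq_mul cS (leqnn _)) _.
    apply: leq_trans (_ : 2 ^ (2 * x) * (2 * q) * 2 ^ u.+1 <= _).
      by rewrite !leq_mul2r sp !orbT.
    exact: usedE.
  have := Xbig b; have : 2 ^ v = 2 ^ u.+1 * 2 ^ (v - u.+1) by rewrite -expnD subnKC // /v; lia.
  move=> ->; have : 0 < 2 ^ (v - u.+1) by rewrite expn_gt0.
  rewrite expnS; set P := 2 ^ (v - _); set N := 2 ^ n; set U := 2 ^ u; set t := #|X b|; set w := #|used S|; set w' := #|_ :&: _|.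
  move=> P0 h1 h2 h3.
  have : N <= (t - w') * (2 * U).
    have : w' * (2 * U) <= N by apply: leq_trans h2; rewrite leq_mul2r h3 orbT.
    by rewrite mulnBl; move: h1; clear; lia.
  by move=> /leq_trans; apply; rewrite leq_mul2l leq_pmulr ?orbT.
have inner i j : i \in S -> j \in S -> i.1 == j.1 -> forall w, w \in content S i ->
    deg w (content S j) * 2 ^ snake_density <= #|content S j|.
  move=> iS jS /eqP ij w wi; rewrite -(leq_pmul2r (expn_gt0 2 v)); apply: leq_trans (big j jS).
  have wX := subsetP (sub i iS) w wi; apply: leq_trans (Xinner wX).
  rewrite -mulnA -expnD addnC; apply: leq_mul; last by rewrite leq_exp2l.
  by apply: deg_sub; rewrite ij; apply: sub.
apply: (@path_embedding s v z s1 z0 n V e Ts) => //.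
- move=> i k; rewrite sTs => iS kS ik; rewrite !nthT //.
  have := mem_nth (a, None) iS; have := mem_nth (a, None) kS.
  have : nth (a, None) S i != nth (a, None) S k by rewrite nth_uniq.
  case: (nth _ S i) => b o1; case: (nth _ S k) => c o2 ne cI bI.
  have usD d (D Y : {set V}) : (d, Some D) \in S -> [disjoint D & Y :\: used S].
    by move=> /used_sub DU; apply: disjointWl DU _; rewrite -setI_eq0 setIDA setDIl setDv set0I.
  case: o1 o2 ne cI bI => [A|] [B|] ne cI bI; rewrite /content /=.
  + exact: dS bI cI ne.
  + exact: usD bI.
  + by rewrite disjoint_sym; apply: usD cI.
  + apply: disjointWl (subsetDl _ _) _; apply: disjointWr (subsetDl _ _) _; apply: Xdis.
    by apply: contra ne => /eqP->.
- by move=> T /mapP[i iS ->]; apply: big.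
- by move=> T /mapP[i iS ->] w; apply: inner.
- move=> i; rewrite sTs => iS; have iS' := ltnW iS; rewrite !nthT //.
  have pw := pathP (a, None) pS i; have {pw} : linked (nth (a, None) S i) (nth (a, None) S i.+1).
    by rewrite ES in iS *; have := pw iS; rewrite /=.
  set I := nth _ S i; set J := nth _ S i.+1; have II : I \in S by apply: mem_nth.
  have JI : J \in S by apply: mem_nth.
  case/orP => [IJ|].
    rewrite /edges big_distrl /= -sum_nat_const; apply: leq_sum => w wI; exact: inner IJ w wI.
  by rewrite /content; case: I.2 => // A; case: J.2.
apply: leq_trans total _; rewrite leq_mul2l; apply/orP; right.
rewrite sTs; apply: leq_trans (_ : #|\bigcup_(i <- S) content S i| <= _).
  apply/subset_leq_card/bigcupsP => b bp; apply/subsetP => w wX.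
  have [wU|wU] := boolP (w \in used S).
    have : exists2 i, i \in S & w \in oapp id set0 i.2.
      move: wU; rewrite /used; elim: (S) => [|i T IH]; first by rewrite big_nil inE.
      rewrite big_cons inE => /orP[h|/IH[j jT hj]]; first by exists i; rewrite ?mem_head.
      by exists j; rewrite ?inE ?jT ?orbT.
    case=> [[c [A|]]] iS /= wA; last by rewrite inE in wA.
    by rewrite (big_rem _ iS) /= inE /content /= wA.
  by rewrite (big_rem _ (bS b bp)) /= !inE wX wU.
rewrite (big_nth (a, None)) big_mkord; apply: leq_trans (card_bigcup_leq_sum _ _) _.
by apply: leq_sum => i _; rewrite nthT.
Qed.

Theorem snake_component a :
  2 ^ n * (2 ^ z).+1 <= 2 ^ z * #|\bigcup_(b | connect link a b) X b| -> red_cube e n.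
Proof.
have csym : connect_sym link by apply: sym_connect_sym; exact: link_sym.
move=> total; have [|p pp [Sp sp]] := @walk_cover _ link a (enum (connect link a)) csym.
  by move=> b; rewrite mem_enum.
have {sp} sp : size p <= 2 ^ (2 * x).
  apply: (leq_trans sp); rewrite mul2n -addnn expnD card_ord leq_mul // -cardE.
  by apply: leq_trans (max_card _) _; rewrite card_ord.
have [S hS] := snake_exists pp sp.
apply: (snake_embed hS sp); apply: leq_trans total _; rewrite leq_mul2l; apply/orP; right.
apply/subset_leq_card/bigcupsP => b ab; apply: bigcup_sup; apply: Sp.
by rewrite mem_enum.
Qed.

End Snake.

Lemma card_bigcup_disjoint (T : finType) (W : nat -> {set T}) p :
  (forall i j, i < p -> j < p -> i != j -> [disjoint W i & W j]) ->
  #|\bigcup_(i < p) W i| = \sum_(i < p) #|W i|.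
Proof.
elim: p => [|p IH] h; first by rewrite !big_ord0 cards0.
rewrite !big_ord_recr /= -IH; last by move=> i j ip jp; apply: h; apply: ltnW; rewrite ltnS.
rewrite cardsU disjoint_setI0 ?cards0 ?subn0 // disjoint_sym disjoints_subset.
apply/subsetP => x xW; rewrite inE; apply/bigcupP => -[i _ xi].
have := h i p (ltnW (ltn_ord i)) (ltnSn p); rewrite ltn_eqF // => /(_ isT) /pred0P/(_ x).
by rewrite /= xi xW.
Qed.

Section State.
Variables (V : finType) (e : rel V).
Local Notation deg := (deg e).

(* Parts of at least 2^n - D vertices, with degrees at most 2^n / 2^j. *)
Definition near_partition n j p D (U : nat -> {set V}) : Prop :=
  [/\ forall i k, i < p -> k < p -> i != k -> [disjoint U i & U k],
      forall i, i < p -> 2 ^ n <= #|U i| + D,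
      forall i, i < p -> {in U i, forall u, deg u (U i) * 2 ^ j <= 2 ^ n} &
      forall w, exists2 i, i < p & deg w (U i) * 2 ^ j <= 2 ^ n].

Hypotheses (e_sym : symmetric e) (e_irr : irreflexive e).

(** By [clique_build], [s] of these sets would yield a blue clique of size [s]; fewer than [s - 1]
    sets of at most [2^n + B] vertices cannot reach the total. So there are [s - 1], each close to
    [2^n], and [attach] makes them sparse inside. *)
Lemma classes_near_partition s n j P R B D (W : nat -> {set V}) (g : nat -> nat) :
  1 < s -> kfree e s [set: V] -> (forall k, k < s -> 0 < g k) ->
  (forall i k l, i < P -> k < P -> i != k -> l < s -> meets e (g l) (s * g l.+1) (W i) (W k)) ->
  (forall i, i < P -> s * g 0 <= #|W i| <= 2 ^ n + B) ->
  (forall i k, i < P -> k < P -> i != k -> [disjoint W i & W k]) ->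
  s.-1 * 2 ^ n <= \sum_(i < P) #|W i| + R -> R + s * B + s * g 0 <= D -> D < 2 ^ n ->
  s * g 1 * 2 ^ j <= 2 ^ n ->
  exists2 U, near_partition n j s.-1 D U & forall i, i < s.-1 -> U i \subset W i.
Proof.
move=> s1 kf gpos hm hW dis total hD Dn g1.
have Ps : P < s.
  rewrite ltnNge; apply/negP => sP.
  have sW : size (mkseq W s) = s by rewrite size_mkseq.
  have [||||C [cC sC _]] := @clique_build V e e_sym e_irr s g (mkseq W s) 0.
  - by rewrite sW.
  - by rewrite sW.
  - move=> i k l; rewrite sW => /andP[ik ks] ls; have is_ := ltn_trans ik ks.
    rewrite !nth_mkseq //; apply: hm; rewrite ?(leq_trans _ sP) // ltn_eqF //.
  - move=> S /(nthP set0)[i]; rewrite sW => ip <-; rewrite nth_mkseq //.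
    by have /andP[] := hW i (leq_trans ip sP).
  by have := kfreeP _ _ _ kf C (subsetT _) cC; rewrite sC sW ltnn.
have upper (Q : pred 'I_P) : \sum_(i < P | Q i) #|W i| <= #|[pred i | Q i]| * (2 ^ n + B).
  rewrite -sum_nat_const; apply: leq_sum => i _; by have /andP[] := hW i (ltn_ord i).
have sE : s = s.-1.+1 by rewrite prednK // ltnW.
have sP : P = s.-1.
  apply/eqP; rewrite eqn_leq -ltnS -sE Ps /=; rewrite leqNgt; apply/negP => PP.
  have := leq_trans total (leq_add (upper xpredT) (leqnn R)).
  rewrite (_ : #|_| = P) ?card_ord //.
  have h1 : P * (2 ^ n + B) + (2 ^ n + B) <= s.-1 * (2 ^ n + B) by rewrite -mulSnr leq_mul2r PP orbT.
  have h2 : s.-1 * B <= s * B by rewrite leq_mul2r leq_pred orbT.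
  move: h1; rewrite mulnDr; move: hD Dn h2; clear; set a := P * _; set b := s.-1 * B; set c := s * B; set d := _ * _; lia.
rewrite sP in hm hW dis total upper.
have low i : i < s.-1 -> 2 ^ n <= #|W i| + (R + s * B).
  move=> ip; have := total; rewrite (bigD1 (Ordinal ip)) //=.
  have := upper (fun k => k != Ordinal ip); rewrite (_ : #|[pred k | k != Ordinal ip]| = s.-2); last first.
    by have := cardC1 (Ordinal ip); rewrite card_ord => <-; apply: eq_card => k; rewrite !inE.
  have s2E : s.-1 = s.-2.+1 by rewrite prednK //; lia.
  have h2 : s.-2 * B <= s * B by rewrite leq_mul2r; apply/orP; right; lia.
  rewrite [s.-1 * 2 ^ n](_ : _ = 2 ^ n + s.-2 * 2 ^ n); last by rewrite -mulSn -s2E.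
  rewrite mulnDr; move: h2; clear; set a := \sum_(_ < _ | _) _; set b := s.-2 * B; set c := s * B; set d := s.-2 * _; lia.
have p0 : 0 < s.-1 by lia.
have hs : s.-1 <= s by exact: leq_pred.
rewrite sE in kf; have [|||U [h1 h2 h3]] := attach e_sym e_irr (W := W) (g := g) hs kf.
- by move=> k kp; apply: gpos; rewrite sE.
- by move=> i k l ip kp ik lp; apply: hm => //; rewrite sE.
- by move=> i ip; have /andP[h _] := hW i ip; apply: leq_trans h; rewrite leq_pmull // ltnW.
exists U; last by move=> i ip; case: (h1 i ip).
split.
- move=> i k ip kp ik; have [Ui _] := h1 i ip; have [Uk _] := h1 k kp.
  exact: disjointWl Ui (disjointWr Uk (dis i k ip kp ik)).
- move=> i ip; have [_ Ui] := h1 i ip; have := low i ip.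
  have h4 : s.-1 * g 0 <= s * g 0 by rewrite leq_mul2r leq_pred orbT.
  by move: Ui hD h4; clear; set a := s.-1 * g 0; set b := s * g 0; lia.
- move=> i ip u uU; apply: leq_trans g1; rewrite leq_mul2r; apply/orP; right.
  by apply/ltnW/(h2 i ip).
- move=> w; have [i ip hi] := h3 w; exists i => //; apply: leq_trans g1.
  by rewrite leq_mul2r ltnW ?orbT.
Qed.

End State.

Lemma pigeonhole (T : finType) (f : nat -> T) s Q : s.-1 * #|T| < Q ->
  exists kk : nat -> nat, [/\ forall i, i < s -> kk i < Q,
    forall i k, i < k < s -> kk i < kk k & forall i k, i < s -> k < s -> f (kk i) = f (kk k)].
Proof.
move=> hQ; pose F t := [seq k <- iota 0 Q | f k == t].
have [/existsP[t ht]|/existsPn h] := boolP [exists t, s <= size (F t)]; last first.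
  suff : Q <= s.-1 * #|T| by rewrite leqNgt hQ.
  have -> : Q = \sum_(t : T) size (F t).
    under eq_bigr => t _ do rewrite size_filter -sum1_count big_mkcond.
    rewrite exchange_big /= -[LHS](size_iota 0) -sum1_size; apply: eq_bigr => k _.
    by rewrite (bigD1 (f k)) //= eqxx big1 // => t; rewrite eq_sym => /negbTE->.
  rewrite mulnC -sum_nat_const; apply: leq_sum => t _; have := h t; rewrite -ltnNge; lia.
have mF i : i < s -> nth 0 (F t) i \in F t by move=> is_; apply: mem_nth; apply: leq_trans ht.
have sF : sorted ltn (F t) by apply: sorted_filter (iota_ltn_sorted 0 Q); exact: ltn_trans.
exists (nth 0 (F t)); split=> [i /mF|i k /andP[ik ks]|i k /mF + /mF].
- by rewrite mem_filter mem_iota => /and3P[].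
- apply: (sorted_ltn_nth ltn_trans 0 sF) => //; rewrite inE; apply: leq_trans ht => //; exact: ltn_trans ik ks.
- by rewrite !mem_filter => /andP[/eqP-> _] /andP[/eqP->].
Qed.

Lemma expn_leq a b k : a <= b -> a ^ k <= b ^ k.
Proof. by case: k => // k ab; rewrite leq_exp2r. Qed.

Section Unlinked.
Variables (V : finType) (e : rel V) (K : nat) (X : 'I_K -> {set V}).
Variables (s x u z n : nat).
Hypothesis Kx : K <= 2 ^ x.

Lemma big_trace (P : pred 'I_K) (A : {set V}) :
  A \subset \bigcup_(a | P a) X a -> 2 ^ n * 2 ^ x <= #|A| * 2 ^ u ->
  exists2 a, P a & 2 ^ n <= #|A :&: X a| * 2 ^ u.
Proof.
move=> AP cA; have [/existsP[a /andP[Pa ha]]|/existsPn h] :=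
    boolP [exists a, P a && (2 ^ n <= #|A :&: X a| * 2 ^ u)]; first by exists a.
have hs : #|A| <= \sum_(a | P a) #|A :&: X a|.
  apply: (@leq_trans #|\bigcup_(a | P a) (A :&: X a)|).
    rewrite -[X in X <= _](_ : #|A :&: \bigcup_(a | P a) X a| = _); last by rewrite (setIidPl AP).
    by rewrite big_distrr.
  exact: card_bigcup_leq_sum.
have : #|A| * 2 ^ u <= K * (2 ^ n).-1.
  apply: leq_trans (leq_mul hs (leqnn _)) _; rewrite big_distrl /=.
  apply: (@leq_trans (\sum_(a | P a) (2 ^ n).-1)).
    by apply: leq_sum => a Pa; have := h a; rewrite Pa /= -ltnNge => ha; rewrite -ltnS prednK ?expn_gt0.
  by rewrite sum_nat_const leq_mul2r -[X in _ <= X]card_ord max_card orbT.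
have : K * (2 ^ n).-1 <= 2 ^ x * (2 ^ n).-1 by rewrite leq_mul2r Kx orbT.
have : 0 < 2 ^ x by rewrite expn_gt0.
have : 0 < 2 ^ n by rewrite expn_gt0.
move: cA; clear; set a := 2 ^ x; set b := 2 ^ n; set c := _ * 2 ^ u; set d := K * _; clearbody a b c d; nia.
Qed.

(** Large [A] and [B] each have a large trace on a single class. These two classes are not linked,
    so the traces have many edges in between and averaging gives the vertex. *)
Lemma unlinked_meets (P1 P2 : pred 'I_K) g h :
  (forall a b, P1 a -> P2 b -> a != b /\ ~~ link s x u z n e X a b) ->
  2 ^ n * 2 ^ x <= g * 2 ^ u -> h * 2 ^ (u + (snake_density s x u z + 4)) <= 2 ^ n ->
  meets e g h (\bigcup_(a | P1 a) X a) (\bigcup_(a | P2 a) X a).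
Proof.
move=> nl hg hh A B AP BP gA gB.
have [a Pa cA] := big_trace AP (leq_trans hg (leq_mul gA (leqnn _))).
have [b Pb cB] := big_trace BP (leq_trans hg (leq_mul gB (leqnn _))).
have [ab] := nl a b Pa Pb; rewrite /link ab /= negb_exists => /forallP/(_ (A :&: X a)).
rewrite negb_exists => /forallP/(_ (B :&: X b)); rewrite !subsetIr cA cB /= -ltnNge => hE.
set d := snake_density s x u z + 4 in hE hh.
have [v vA hv] := dense_vertex hE; exists v; first by case/setIP: vA.
rewrite -(leq_pmul2r (expn_gt0 2 (u + d))); apply: (leq_trans hh); apply: (leq_trans cB).
rewrite addnC expnD mulnA leq_mul2r; apply/orP; right; apply: (leq_trans hv).
by rewrite leq_mul2r deg_sub ?orbT // subsetIl.
Qed.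

End Unlinked.

(** * The first near partition *)

Section Start.
Variables (s j y : nat).
Hypotheses (s1 : 1 < s) (y0 : 0 < y).
Let z := y + s + 3.
Let y1 := y + 4.
(** Links at scale [k] involve sets of at least [2^(n - link_scale x k)] vertices. The increment
    contains the link density, so that a vertex given by [meets] at one scale has a neighbourhood
    that is large at the next one. *)
Definition link_scale x k := iter k (fun u => u + snake_density s x u z + 4 + s + x) (2 * x + s + y1 + y + j).
(** A partition into link components is recorded as a map from classes to roots; there are at most
    [(2^x)^(2^x)] such maps, so among [Q x] scales some [s] share the same one. *)
Let Q x := s * (2 ^ x) ^ (2 ^ x) + 1.
Let vv x k := link_scale x k + 2 * x + 4 * s + 4.
Definition start_gap x := \sum_(k < Q x) (vv x k + snake_density s x (link_scale x k) z).

Lemma link_scale_lt x i k : i < k -> link_scale x i + snake_density s x (link_scale x i) z + 4 + s + x <= link_scale x k.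
Proof.
elim: k => // k IH; rewrite ltnS leq_eqVlt => /orP[/eqP->//|ik].
by apply: leq_trans (IH ik) _; rewrite /link_scale iterS -/(link_scale x k); lia.
Qed.

Lemma link_scale_ge x k : 2 * x + s + y1 + y + j <= link_scale x k.
Proof. by elim: k => // k IH; apply: leq_trans IH _; rewrite /link_scale iterS; lia. Qed.

Lemma near_partition_start : exists n0, forall n (V : finType) (e : rel V), n0 <= n ->
  symmetric e -> irreflexive e -> kfree e s [set: V] ->
  s.-1 * (2 ^ n - 1) <= #|V| <= s * 2 ^ n ->
  red_cube e n \/ exists D U, D * 2 ^ y <= 2 ^ n /\ near_partition e n j s.-1 D U.
Proof.
have [X hX] := gap start_gap s y1.
(* The exponent [x] returned by [gap] is only known to be at most [X]; the double sum dominates the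
   requirement for every [x] and every scale. *)
pose n1 := \sum_(x < X.+1) \sum_(k < Q x) (path_dim s (vv x k) z + vv x k).
exists (X + n1 + (y1 + s + z)) => n V e hn e_sym e_irr kf /andP[Vlow Vup].
have [|x [phi [K [xX Kx hwaste hinner]]]] := hX n V e e_sym e_irr kf _ Vup; first by lia.
have dimk k : k < Q x -> path_dim s (vv x k) z <= n /\ vv x k <= n.
  move=> kQ; have xX' : x < X.+1 by [].
  have : path_dim s (vv x k) z + vv x k <= n.
    apply: leq_trans (_ : n1 <= n); last by lia.
    rewrite /n1 (bigD1 (Ordinal xX')) //=; apply: leq_trans (leq_addr _ _).
    by rewrite (bigD1 (Ordinal kQ)) //= leq_addr.
  by set a := path_dim _ _ _; lia.
pose ks := [seq k <- iota 0 K | 2 ^ n <= #|cls phi k| * 2 ^ (x + y1)].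
have uks : uniq ks by rewrite filter_uniq // iota_uniq.
have ksP k : k \in ks -> k < K /\ 2 ^ n <= #|cls phi k| * 2 ^ (x + y1).
  by rewrite mem_filter mem_iota => /and3P[-> _ ->].
pose K' := size ks; pose C (a : 'I_K') := cls phi (nth 0 ks a).
have K'x : K' <= 2 ^ x by apply: leq_trans Kx; rewrite /K' size_filter (leq_trans (count_size _ _)) ?size_iota.
have mks (a : 'I_K') : nth 0 ks a \in ks by apply: mem_nth.
have Cdis a b : a != b -> [disjoint C a & C b].
  move=> ab; rewrite -setI_eq0; apply/eqP/setP => w; rewrite !inE; apply/negP => /andP[/eqP-> ].
  by rewrite nth_uniq // (_ : (a == b :> nat) = false) //; apply: negbTE ab.
have Cbig k a : 2 ^ n <= #|C a| * 2 ^ (link_scale x k).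
  have [_ h] := ksP _ (mks a); apply: (leq_trans h); rewrite leq_mul2l leq_exp2l //.
  by apply/orP; right; apply: leq_trans (link_scale_ge x k); lia.
have Cinner a w : w \in C a -> deg e w (C a) * 2 ^ start_gap x <= 2 ^ n.
  by rewrite inE => /eqP E; rewrite /C -E; apply: hinner; rewrite E; case: (ksP _ (mks a)).
have Fk k : k < Q x -> vv x k + snake_density s x (link_scale x k) z <= start_gap x.
  by move=> kQ; rewrite /start_gap (bigD1 (Ordinal kQ)) //= leq_addr.
have [red|nred] := boolP [exists k : 'I_(Q x), exists a, 2 ^ n * (2 ^ z).+1 <=
    2 ^ z * #|\bigcup_(b | connect (link s x (link_scale x k) z n e C) a b) C b|].
  left; case/existsP: red => k /existsP[a ha]; have [d1 d2] := dimk k (ltn_ord k).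
  have z0 : 0 < z by rewrite /z addn3.
  exact: (snake_component e_sym e_irr kf s1 z0 K'x Cdis (Cbig k) Cinner (Fk k (ltn_ord k)) d1 d2 ha).
right.
have ldis k a : k < Q x -> 2 ^ z * #|\bigcup_(b | connect (link s x (link_scale x k) z n e C) a b) C b| < 2 ^ n * (2 ^ z).+1.
  move=> kQ; move: nred; rewrite negb_exists => /forallP/(_ (Ordinal kQ)).
  by rewrite negb_exists => /forallP/(_ a); rewrite -ltnNge.
pose rt k := [ffun a => fingraph.root (link s x (link_scale x k) z n e C) a].
have [|kk [kkQ kkm kkr]] := @pigeonhole _ rt s (Q x).
  rewrite card_ffun card_ord /Q addn1 ltnS; apply: leq_mul; first exact: leq_pred.
  apply: leq_trans (_ : (2 ^ x) ^ K' <= _); first exact: expn_leq.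
  by rewrite leq_pexp2l // expn_gt0.
have s0 : 0 < s by exact: ltnW.
(* From here on the partition is the same at all [s] chosen scales, so classes in different [W i]
   are unlinked at each of them; this is what [classes_near_partition] needs. *)
pose rt0 := rt (kk 0); have rtE l : l < s -> rt (kk l) = rt0 by move=> ls; apply: kkr.
pose rs := undup (codom rt0); have urs : uniq rs := undup_uniq _.
have rsP a : rt0 a \in rs by rewrite mem_undup codom_f.
have indE a b : (index (rt0 a) rs == index (rt0 b) rs) = (rt0 a == rt0 b).
  apply/eqP/eqP => [E|->] //.
  by rewrite -(nth_index (rt0 a) (rsP a)) E nth_index.
pose W i := \bigcup_(b | index (rt0 b) rs == i) C b.
have conE l a b : l < s -> connect (link s x (link_scale x (kk l)) z n e C) a b = (rt0 a == rt0 b).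
  move=> ls; rewrite -(rtE l ls) !ffunE root_connect //.
  by apply: sym_connect_sym; apply: link_sym.
have repr i : i < size rs -> exists a, index (rt0 a) rs = i.
  move=> irs; have [r0 _] : exists r0 : 'I_K', true by case: (rs) irs => // r0; exists r0.
  have : nth r0 rs i \in rs by apply: mem_nth.
  by rewrite mem_undup => /codomP[a E]; exists a; rewrite -E index_uniq.
have WE i a : index (rt0 a) rs = i -> W i = \bigcup_(b | connect (link s x (link_scale x (kk 0)) z n e C) a b) C b.
  by move=> <-; apply: eq_bigl => b; rewrite conE // indE eq_sym.
have scn l : l < s -> link_scale x (kk l) <= n.
  by move=> ls; have [_] := dimk _ (kkQ l ls); apply: leq_trans; rewrite /vv; lia.
(* Past the last scale the threshold is 0: nothing more is asked of the neighbourhoods. *)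
pose g l := if l < s then 2 ^ (n - link_scale x (kk l) + x) else 0.
have s2 : s <= 2 ^ s by apply/ltnW/ltn_expl.
have sg l m : l < s -> s + x + m <= link_scale x (kk l) -> s * g l * 2 ^ m <= 2 ^ n.
  move=> ls hm; rewrite /g ls; apply: leq_trans (_ : 2 ^ s * 2 ^ (n - link_scale x (kk l) + x) * 2 ^ m <= _).
    by rewrite !leq_mul2r s2 !orbT.
  by rewrite -!expnD leq_exp2l //; have := scn l ls; lia.
have ge0 := link_scale_ge x (kk 0).
have y1n : y1 <= n by lia.
have zn : z <= n by lia.
have yn : y <= n by lia.
(* Three losses are at most [r] each: the waste colours from [K] on, the classes that are too small,
   and the [s - 1] by which [(s - 1) * (2^n - 1)] falls short of [(s - 1) * 2^n]. *)
pose r := 2 ^ (n - y1); have rE : r * 2 ^ y1 = 2 ^ n by rewrite -expnD subnK.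
have Wdis i k : i < size rs -> k < size rs -> i != k -> [disjoint W i & W k].
  move=> ip kp ik; rewrite -setI_eq0; apply/eqP/setP => w; rewrite !inE.
  apply/negP => /andP[/bigcupP[a /eqP ai wa] /bigcupP[b /eqP bk wb]].
  have [E|ne] := eqVneq a b; first by rewrite -ai -bk E eqxx in ik.
  by have := Cdis a b ne => /pred0P/(_ w); rewrite /= wa wb.
have [U hU _] : exists2 U, near_partition e n j s.-1 (2 ^ (n - y)) U & forall i, i < s.-1 -> U i \subset W i.
  apply: (@classes_near_partition V e e_sym e_irr s n j (size rs) (3 * r) (2 ^ (n - z)) (2 ^ (n - y)) W g) => //.
  - by move=> l ls; rewrite /g ls expn_gt0.
  - move=> i k l ip kp ik ls; apply: (unlinked_meets (s := s) (x := x) (u := link_scale x (kk l)) (z := z) (n := n)) => //.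
    + move=> a b /eqP ai /eqP bk; have ne : rt0 a != rt0 b by rewrite -indE ai bk.
      split; first by apply: contra ne => /eqP->.
      by apply: contra ne => hl; rewrite -(conE l) // connect1.
    + by rewrite /g ls -!expnD leq_exp2l //; have := scn l ls; lia.
    have [ls'|ls'] := ltnP l.+1 s; last by rewrite /g ltnNge ls' muln0 mul0n.
    apply: sg => //; have := link_scale_lt x (kkm l l.+1 _); rewrite ltnSn ls' => /(_ isT); lia.
  - move=> i irs; have [a ai] := repr i irs; apply/andP; split.
      apply: leq_trans (_ : #|C a| <= _); last first.
        by apply/subset_leq_card/bigcup_sup; apply/eqP.
      have [_ h] := ksP _ (mks a); rewrite -(leq_pmul2r (expn_gt0 2 (x + y1))); apply: leq_trans h.
      by apply: sg => //; lia.
    rewrite -(leq_pmul2l (expn_gt0 2 z)) (WE i a ai); apply: leq_trans (ltnW (ldis _ a (kkQ 0 s0))) _.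
    have zE : 2 ^ z * 2 ^ (n - z) = 2 ^ n by rewrite -expnD subnKC.
    by rewrite mulnS mulnDr zE addnC [2 ^ n * _]mulnC.
  - rewrite -card_bigcup_disjoint; last exact: Wdis.
    pose small := \bigcup_(k < K | (k : nat) \notin ks) cls phi k.
    have hs : #|small| <= r.
      rewrite -(leq_pmul2r (expn_gt0 2 (x + y1))) [leqRHS](_ : _ = 2 ^ x * 2 ^ n); last by rewrite expnD mulnCA rE.
      apply: leq_trans (_ : (\sum_(k < K | (k : nat) \notin ks) #|cls phi k|) * 2 ^ (x + y1) <= _).
        by rewrite leq_mul2r card_bigcup_leq_sum orbT.
      rewrite big_distrl /=; apply: leq_trans (_ : K * 2 ^ n <= _); last by rewrite leq_mul2r Kx orbT.
      rewrite -[K in leqRHS]card_ord -sum_nat_const [leqRHS](bigID (fun k : 'I_K => (k : nat) \notin ks)) /=.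
      apply: leq_trans (leq_addr _ _); apply: leq_sum => k; rewrite mem_filter mem_iota leq0n add0n ltn_ord !andbT.
      by rewrite -ltnNge => /ltnW.
    have hu : #|[set w | K <= phi w]| <= r by rewrite -(leq_pmul2r (expn_gt0 2 y1)) rE.
    have hV : #|V| <= #|\bigcup_(i < size rs) W i| + (#|[set w | K <= phi w]| + #|small|).
      rewrite -cardsT; apply: leq_trans (_ : #|\bigcup_(i < size rs) W i :|: ([set w | K <= phi w] :|: small)| <= _); last first.
        apply: leq_trans (leq_card_setU _ _).1 _; rewrite leq_add2l; exact: (leq_card_setU _ _).1.
      apply/subset_leq_card/subsetP => w _; rewrite in_setU in_setU [w \in [set _ | _]]inE.
      have [wK|wK] := leqP K (phi w); rewrite ?orbT //=; apply/orP.
      have [wk|wk] := boolP (phi w \in ks).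
        have iK : index (phi w) ks < K' by rewrite index_mem.
        left; apply/bigcupP; have a0 : index (rt0 (Ordinal iK)) rs < size rs by rewrite index_mem.
        exists (Ordinal a0) => //; apply/bigcupP; exists (Ordinal iK) => //.
        by rewrite inE /= nth_index.
      by right; apply/bigcupP; exists (Ordinal wK) => //; rewrite inE.
    have hr : s.-1 <= r.
      apply: leq_trans (leq_pred s) _; apply: (leq_trans s2); rewrite leq_exp2l //; lia.
    move: Vlow hV hs hu hr; rewrite mulnBr muln1; clear.
    set a := #|V|; set b := #|\bigcup_(_ < _) _|; set c := s.-1 * _; lia.
  - have h1 : s * 2 ^ (n - z) <= 2 * r.
      apply: leq_trans (leq_mul s2 (leqnn _)) _; rewrite /r -expnS -expnD leq_exp2l //; rewrite /z /y1; lia.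
    have h2 : s * g 0 <= r.
      by rewrite -(leq_pmul2r (expn_gt0 2 y1)) rE; apply: sg => //; lia.
    have h3 : 2 ^ (n - y) = 16 * r.
      rewrite /r -[16]/(2 ^ 4) -expnD; congr (2 ^ _); rewrite /y1; lia.
    by rewrite h3; move: h1 h2; clear; set a := s * _; set b := s * g 0; lia.
  - by rewrite ltn_exp2l //; lia.
  - by apply: sg => //; have := link_scale_ge x (kk 1); lia.
by exists (2 ^ (n - y)), U; split=> //; rewrite -expnD subnK.
Qed.

End Start.

(** * Improving the degree bound *)

Lemma packing (V I : finType) (supp : I -> {set V}) (Pr : pred I) (x0 : I) L :
  exists fs : seq I, [/\ size fs <= L, all Pr fs,
    forall i k, i < size fs -> k < size fs -> i != k ->
      [disjoint supp (nth x0 fs i) & supp (nth x0 fs k)] &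
    size fs = L \/ forall i, Pr i -> ~~ [disjoint supp i & \bigcup_(f <- fs) supp f]].
Proof.
elim: L => [|L [fs [h1 h2 h3 h4]]]; first by exists [::]; split=> //; left.
have [/existsP[i /andP[Pi di]]|/existsPn h] :=
    boolP [exists i, Pr i && [disjoint supp i & \bigcup_(f <- fs) supp f]]; last first.
  by exists fs; split=> // [|]; [exact: leqW|right=> i Pi; have := h i; rewrite Pi].
case: h4 => [sL|h4]; last by exists fs; split=> //; [exact: leqW|right].
exists (i :: fs); split=> /=; rewrite ?sL ?Pi //; last by left.
have dk k : k < size fs -> [disjoint supp i & supp (nth x0 fs k)].
  move=> ks; apply: disjointWr di; have := mem_nth x0 ks; move: (nth _ _ _).
  by move=> f fF; rewrite (big_rem _ fF) /=; apply: subsetUl.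
rewrite -sL; case=> [|a] [|b] //= aL bL ab; first exact: dk.
  by rewrite disjoint_sym; apply: dk.
exact: h3.
Qed.

(** * Hamming distance and codes *)

Section Distance.
Variable c : nat.
Implicit Types (w : cube c) (t : 'I_c).

Definition dist w w' := #|[set t | w t != w' t]|.

Lemma dist_sym w w' : dist w w' = dist w' w.
Proof. by apply: eq_card => t; rewrite !inE eq_sym. Qed.

Lemma dist_triangle w2 w1 w3 : dist w1 w3 <= dist w1 w2 + dist w2 w3.
Proof.
apply: leq_trans (leq_card_setU _ _).1; apply/subset_leq_card/subsetP => t; rewrite !inE.
by case: (w1 t) (w2 t) (w3 t) => [] [] [].
Qed.

Lemma dist0 w w' : (dist w w' == 0) = (w == w').
Proof.
rewrite cards_eq0; apply/eqP/eqP => [/setP h|->]; last by apply/setP => t; rewrite !inE eqxx.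
by apply/ffunP => t; have := h t; rewrite !inE => /negbFE/eqP.
Qed.

Lemma dist_flip w t : dist w (flip w t) = 1.
Proof.
rewrite /dist (_ : [set _ | _] = [set t]) ?cards1 //.
by apply/setP => i; rewrite !inE ffunE; case: (i == t); case: (w i).
Qed.

Lemma dist1P w w' : reflect (exists t, w' = flip w t) (dist w w' == 1).
Proof.
apply: (iffP idP) => [/cards1P[t h]|[t ->]]; last by rewrite dist_flip.
exists t; apply/ffunP => i; have /setP/(_ i) := h; rewrite !inE ffunE.
by case: (i == t); case: (w i); case: (w' i).
Qed.

Lemma dist_step w w' : w != w' -> exists t, dist w w' = (dist w (flip w' t)).+1.
Proof.
move=> ne; have [t] : exists t, t \in [set t | w t != w' t].
  by apply/set0Pn; rewrite -cards_eq0 -/(dist w w') dist0.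
move=> h; exists t; rewrite /dist (cardsD1 t) h add1n; congr _.+1; apply: eq_card => i.
rewrite !inE ffunE; have [->|_] := eqVneq i t; last by [].
by move: h; rewrite inE /=; case: (w t); case: (w' t).
Qed.

Lemma card_ball w k : #|[set w' | dist w w' <= k]| <= c.+1 ^ k.
Proof.
elim: k => [|k IH].
  rewrite (_ : [set _ | _] = [set w]) ?cards1 //.
  by apply/setP => w'; rewrite !inE leqn0 dist0 eq_sym.
pose oflip (o : option 'I_c) w' := if o is Some t then flip w' t else w'.
apply: leq_trans (_ : #|\bigcup_(o : option 'I_c) (oflip o @: [set w' | dist w w' <= k])| <= _).
  apply/subset_leq_card/subsetP => w'; rewrite inE leq_eqVlt => /orP[/eqP h|h].
    have [|t ht] := @dist_step w w'; first by rewrite -dist0 h.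
    apply/bigcupP; exists (Some t) => //; apply/imsetP; exists (flip w' t); last by rewrite /= flipK.
    by rewrite inE -ltnS -ht h.
  by apply/bigcupP; exists None => //; apply/imsetP; exists w'; rewrite ?inE.
rewrite expnS; apply: leq_trans (card_bigcup_le (k := c.+1 ^ k) _) _.
  by move=> o _; apply: leq_trans (leq_imset_card _ _) IH.
by rewrite leq_mul2r (leq_trans (max_card _)) ?orbT // card_option card_ord.
Qed.

(** Greedy choice: by [card_ball] the balls of radius 3 around the words chosen so far do not cover
    [C]. *)
Lemma code_exists L (C : {set cube c}) : L * c.+1 ^ 3 <= #|C| ->
  exists code : seq (cube c), [/\ size code = L, {subset code <= C}, uniq code &
    {in code &, forall w w', w != w' -> 3 < dist w w'}].
Proof.
elim: L => [|L IH] hL; first by exists [::].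
have [|code [sc sub uc hc]] := IH; first by apply: leq_trans hL; rewrite mulSn leq_addl.
have [w /setDP[wC wB]] : exists w, w \in C :\: \bigcup_(i < size code) [set w' | dist (nth (finfun (fun=> false)) code i) w' <= 3].
  apply/set0Pn; rewrite -card_gt0 cardsD subn_gt0; apply: leq_ltn_trans (subset_leq_card (subsetIr _ _)) _.
  apply: leq_ltn_trans (card_bigcup_le (k := c.+1 ^ 3) _) _; first by move=> i _; apply: card_ball.
  apply: leq_trans hL; rewrite mulSn -[X in X < _]add0n -addSn leq_add ?expn_gt0 //.
  by rewrite leq_mul2r -sc -[X in _ <= X]card_ord max_card orbT.
have far w' : w' \in code -> 3 < dist w w'.
  move=> /(nthP (finfun (fun=> false)))[i ic <-]; rewrite ltnNge; apply: contra wB => h.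
  by apply/bigcupP; exists (Ordinal ic) => //; rewrite inE dist_sym.
have wc : w \notin code.
  by apply/negP => /far; rewrite (_ : dist w w = 0) //; apply/eqP; rewrite dist0.
exists (w :: code); split=> /=; rewrite ?sc ?wc //.
  by move=> w'; rewrite inE => /orP[/eqP->|/sub].
move=> w1 w2; rewrite !inE => /orP[/eqP->|c1] /orP[/eqP->|c2] ne; rewrite ?eqxx // in ne *.
- exact: far.
- by rewrite dist_sym; apply: far.
- exact: hc.
Qed.

(** Code cells are taken in one corner and leaves in the opposite one: they differ in three
    coordinates, so a leaf is not adjacent to a neighbour of a code cell. *)
Definition corner (b : bool) : {set cube c} := [set w | agree 3 (finfun (fun=> b)) w].

Lemma corner_dist w w' : 2 < c -> w \in corner true -> w' \in corner false -> 2 < dist w w'.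
Proof.
move=> c3; rewrite !inE => /agreeP h /agreeP h'; rewrite -[X in X <= _](card_lt_ord c3).
apply/subset_leq_card/subsetP => t; rewrite !inE => t3.
by rewrite -h // -h' // !ffunE.
Qed.

Lemma card_corner_even : 3 < c -> #|[set w in corner true | ~~ parity w]| = 2 ^ (c - 4).
Proof.
move=> c3; pose t := Ordinal c3; set A := [set w in _ | _].
have E : #|[set w in corner true | parity w]| = #|A|.
  rewrite -(card_imset (mem A) (can_inj (@flipK _ t))); apply: eq_card => w.
  have cf w' : (flip w' t \in corner true) = (w' \in corner true).
    rewrite !inE; apply/idP/idP => h; apply: (agree_trans h); last by rewrite agree_flipr.
    by rewrite agree_sym agree_flipr.
  apply/idP/imsetP => [h|[w' hw ->]].
    move: h; rewrite inE => /andP[h1 h2]; exists (flip w t); rewrite ?flipK //.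
    by rewrite inE cf h1 parity_flip negbK.
  by move: hw; rewrite [w' \in _]inE => /andP[h1 h2]; rewrite inE cf h1 parity_flip.
have : #|corner true| = 2 ^ (c - 3) by apply: card_cell; apply: ltnW.
rewrite -(cardsID [set w | parity w]) (_ : _ :&: _ = [set w in corner true | parity w]); last by apply/setP => w; rewrite !inE.
rewrite E (_ : _ :\: _ = A); last by apply/setP => w; rewrite !inE andbC.
rewrite addnn -mul2n (_ : c - 3 = (c - 4).+1); last by lia.
by rewrite expnS => /eqP; rewrite eqn_pmul2l // => /eqP.
Qed.

End Distance.

Section Plan.
Variables (c L G : nat).
Hypotheses (c3 : 3 < c) (hL : L * c.+1 ^ 3 <= 2 ^ (c - 3)) (hG : G <= 2 ^ (c - 4)).
Implicit Types (w : cube c) (t : 'I_c).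

Definition touching (i k : nat) := [\/ i = 0 /\ (exists2 q, q < L & k = 3 * q + 1),
  i = 0 /\ (exists2 g, g < G & k = 3 * g + 3) | exists2 q, q < L & i = 3 * q + 1 /\ k = 3 * q + 2].

(* Class 0 is the bulk; a code cell has class 3q+2, its neighbours 3q+1; the
   isolated cells reserved for leaves have class 3g+3. *)
Lemma cell_plan : exists pc : cube c -> nat,
  [/\ #|[set w | pc w == 0]| + G + L * c.+1 <= 2 ^ c,
      forall w, pc w != 0 -> (exists2 q, q < L & pc w = 3 * q + 1 \/ pc w = 3 * q + 2) \/
        (exists2 g, g < G & pc w = 3 * g + 3),
      forall q, #|[set w | pc w == 3 * q + 1]| <= c,
      forall i, (forall q, i != 3 * q + 1) -> i != 0 -> #|[set w | pc w == i]| <= 1 &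
      forall w t, pc w != pc (flip w t) -> touching (pc w) (pc (flip w t)) \/ touching (pc (flip w t)) (pc w)].
Proof.
pose w0 : cube c := finfun (fun=> false).
have [|code [sc subc uc far]] := @code_exists c L (corner c false).
  by rewrite (card_cell _ (ltnW c3)).
have [E0 E0sub cE0] : exists2 E0 : {set cube c}, E0 \subset [set w in corner c true | ~~ parity w] & #|E0| = G.
  by apply: card_subset_exists; rewrite card_corner_even.
pose E := enum E0; have sE : size E = G by rewrite -cE0 cardE.
have uE : uniq E by apply: enum_uniq.
have EP w : w \in E -> w \in corner c true /\ ~~ parity w.
  by rewrite mem_enum => /(subsetP E0sub); rewrite inE => /andP[].
have farE w w' : w \in E -> w' \in code -> 2 < dist w w'.
  by move=> /EP[h _] /subc; apply: corner_dist => //; apply: ltnW.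
pose adj w w' := dist w w' == 1.
pose pc w := if w \in E then 3 * index w E + 3 else if w \in code then 3 * index w code + 2
  else if has (adj w) code then 3 * find (adj w) code + 1 else 0.
(* Minimum distance 4: a cell has at most one code word at distance 1, and neighbours of different
   code words are not adjacent, since their distances 1 and 2 would add up to 3 only. *)
have adj_uniq w w1 w2 : w1 \in code -> w2 \in code -> dist w w1 <= 1 -> dist w w2 <= 2 -> w1 = w2.
  move=> h1 h2 d1 d2; apply/eqP; apply/negPn/negP => ne; have := far _ _ h1 h2 ne.
  have := dist_triangle w w1 w2; rewrite [dist w1 w]dist_sym; lia.
have findE w w' : w' \in code -> adj w w' -> find (adj w) code = index w' code /\ has (adj w) code.
  move=> wc ww; have hs : has (adj w) code by apply/hasP; exists w'.
  split=> //; have hm : nth w0 code (find (adj w) code) \in code by rewrite mem_nth // -has_find.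
  rewrite (@adj_uniq w w' (nth w0 code (find (adj w) code)) wc hm); first by rewrite index_uniq // -has_find.
    by rewrite (eqP ww).
  by have /eqP-> := nth_find w0 hs.
have pcA w q : pc w = 3 * q + 1 -> [/\ w \notin E, w \notin code, q < L & adj w (nth w0 code q)].
  rewrite /pc; case: ifP => wE; first by lia.
  case: ifP => wc; first by lia.
  case: ifP => hs; last by lia.
  move=> h; have -> : q = find (adj w) code by lia.
  by split=> //; [rewrite -sc -has_find|apply: nth_find].
have pcB w q : pc w = 3 * q + 2 -> q < L /\ w = nth w0 code q.
  rewrite /pc; case: ifP => wE; first by lia.
  case: ifP => wc; last by case: ifP => _; lia.
  by move=> h; have -> : q = index w code by [lia]; rewrite nth_index // -sc index_mem.
have pcG w g : pc w = 3 * g + 3 -> g < G /\ w = nth w0 E g.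
  rewrite /pc; case: ifP => wE; last by case: ifP => _; [|case: ifP => _]; lia.
  by move=> h; have -> : g = index w E by [lia]; rewrite nth_index // -sE index_mem.
have pc0 w : pc w = 0 -> [/\ w \notin E, w \notin code & forall w', w' \in code -> ~~ adj w w'].
  rewrite /pc; case: ifP => wE; first by lia.
  case: ifP => wc; first by lia.
  case: ifP => hs; first by lia.
  by split=> // w' w'c; move/hasPn: (negbT hs) => ->.
have pcval w : pc w != 0 -> (exists2 q, q < L & pc w = 3 * q + 1 \/ pc w = 3 * q + 2) \/
        (exists2 g, g < G & pc w = 3 * g + 3).
  move=> h; have : [\/ pc w = 3 * (pc w %/ 3) + 1, pc w = 3 * (pc w %/ 3) + 2 | pc w = 3 * (pc w %/ 3).-1 + 3].
    move: h; set i := pc w; clearbody i; clear; move=> h.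
    have := divn_eq i 3; have := ltn_pmod i (isT : 0 < 3); set a := i %/ 3; set b := i %% 3; clearbody a b.
    case: b => [|[|[|//]]] _ hi; [apply: Or33|apply: Or31|apply: Or32]; lia.
  case=> h'; [left|left|right].
  - by have [_ _ qL _] := pcA _ _ h'; exists (pc w %/ 3) => //; left.
  - by have [qL _] := pcB _ _ h'; exists (pc w %/ 3) => //; right.
  - by have [gG _] := pcG _ _ h'; exists (pc w %/ 3).-1.
exists pc; split=> //.
- pose N q := nth w0 code q |: [set flip (nth w0 code q) t | t in 'I_c].
  have NP q w : w \in N q -> dist w (nth w0 code q) <= 1.
    rewrite !inE => /orP[/eqP->|/imsetP[t _ ->]]; last by rewrite dist_sym dist_flip.
    by rewrite (eqP (_ : dist _ _ == 0)) // dist0.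
  have flip_inj w : injective (flip w).
    move=> t t' /ffunP/(_ t); rewrite !ffunE eqxx; case: eqP => // _; by case: (w t).
  have cN q : #|N q| = c.+1.
    rewrite cardsU1 card_imset; last exact: flip_inj.
    rewrite card_ord (_ : nth w0 code q \notin _) //; apply/imsetP => -[t _ h].
    by have := dist_flip (nth w0 code q) t; rewrite -h (eqP (_ : dist _ _ == 0)) // dist0.
  have dN q1 q2 : q1 < L -> q2 < L -> q1 != q2 -> [disjoint N q1 & N q2].
    move=> h1 h2 ne; rewrite -setI_eq0; apply/eqP/setP => w; rewrite inE in_set0; apply/negP => /andP[/NP d1 /NP d2].
    have := @adj_uniq w _ _ (mem_nth w0 (_ : q1 < size code)) (mem_nth w0 (_ : q2 < size code)) d1 (leqW d2).
    by rewrite sc => /(_ h1 h2)/eqP; rewrite nth_uniq ?sc // (negbTE ne).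
  have := card_bigcup_disjoint dN; rewrite [RHS](eq_bigr (fun=> c.+1)); last by move=> q _; exact: cN.
  rewrite sum_nat_const card_ord => <-.
  rewrite -cE0 -addnA -(_ : #|E0 :|: \bigcup_(i < L) N i| = #|E0| + #|\bigcup_(i < L) N i|); last first.
    rewrite cardsU (_ : E0 :&: _ = set0) ?cards0 ?subn0 //; apply/setP => w; rewrite inE in_set0; apply/negP.
    case/andP => wE /bigcupP[q _ /NP]; rewrite leqNgt; case/negP.
    apply: ltnW; apply: farE; first by rewrite mem_enum.
    by apply: mem_nth; rewrite sc.
  rewrite -[2 ^ c](_ : #|{: cube c}| = _); last by rewrite card_ffun card_bool card_ord.
  rewrite -(cardsC [set w | pc w == 0]) leq_add2l; apply/subset_leq_card/subsetP => w.
  rewrite in_setU in_setC inE => /orP[wE|/bigcupP[q _ wN]]; apply/negP => /eqP/pc0[h1 h2 h3].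
    by rewrite mem_enum wE in h1.
  have qc : nth w0 code q \in code by apply: mem_nth; rewrite sc.
  move: wN; rewrite !inE => /orP[/eqP E1|/imsetP[t _ E1]]; first by rewrite E1 qc in h2.
  by have := h3 _ qc; rewrite /adj E1 dist_sym dist_flip.
- move=> q; apply: leq_trans (_ : #|[set flip (nth w0 code q) t | t in 'I_c]| <= _); last first.
    by apply: leq_trans (leq_imset_card _ _) _; rewrite card_ord.
  apply/subset_leq_card/subsetP => w; rewrite inE => /eqP/pcA[_ _ _]; rewrite /adj dist_sym => /dist1P[t ->].
  exact: imset_f.
- move=> i iA i0; apply/card_le1_eqP => w w'; rewrite !inE => /eqP h /eqP h'.
  have w0' : pc w != 0 by rewrite h.
  have [[q _ [hq|hq]]|[g _ hg]] := pcval w w0'.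
  + by have := iA q; rewrite -hq h eqxx.
  + by have [_ ->] := pcB _ _ hq; rewrite h -h' in hq; have [_ ->] := pcB _ _ hq.
  + by have [_ ->] := pcG _ _ hg; rewrite h -h' in hg; have [_ ->] := pcG _ _ hg.
have nE w1 w2 : dist w1 w2 = 1 -> parity w2 = ~~ parity w1 -> w1 \in E -> pc w2 = 0 /\ touching (pc w2) (pc w1).
  move=> d p wE; suff h : pc w2 = 0.
    split=> //; apply: Or32; split=> //; exists (index w1 E); first by rewrite -sE index_mem.
    by rewrite /pc wE.
  have [_ p1] := EP _ wE; have far2 w' : w' \in code -> 1 < dist w2 w'.
    by move=> /(farE _ _ wE); have := dist_triangle w2 w1 w'; lia.
  rewrite /pc ifN; last by apply/negP => /EP[_]; rewrite p p1.
  rewrite ifN; last by apply/negP => /far2; rewrite (eqP (_ : dist w2 w2 == 0)) // dist0.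
  by rewrite ifN // -all_predC; apply/allP => w' /far2; rewrite /= /adj => h; rewrite gtn_eqF.
have nC w1 w2 : dist w1 w2 = 1 -> w1 \in code -> touching (pc w2) (pc w1).
  move=> d wc; apply: Or33; exists (index w1 code); first by rewrite -sc index_mem.
  have far1 w' : w' \in E -> 2 < dist w1 w' by move=> wE; rewrite dist_sym; apply: farE.
  have [f1 f2] : find (adj w2) code = index w1 code /\ has (adj w2) code.
    by apply: findE => //; rewrite /adj dist_sym d.
  split.
    rewrite /pc ifN; last by apply/negP => /far1; rewrite d.
    rewrite ifN; first by rewrite f2 f1.
    apply/negP => wc2; have ne : w1 != w2 by rewrite -dist0 d.
    by have := far _ _ wc wc2 ne; rewrite d.
  rewrite /pc ifN; last by apply/negP => /far1; rewrite (eqP (_ : dist w1 w1 == 0)) // dist0.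
  by rewrite wc.
move=> w t ne; have d := dist_flip w t; have d' : dist (flip w t) w = 1 by rewrite dist_sym.
have p := parity_flip w t; have p' : parity w = ~~ parity (flip w t) by rewrite p negbK.
have [wE|wE] := boolP (w \in E); first by right; case: (nE _ _ d p wE).
have [wE2|wE2] := boolP (flip w t \in E); first by left; case: (nE _ _ d' p' wE2).
have [wc|wc] := boolP (w \in code); first by right; exact: nC d wc.
have [wc2|wc2] := boolP (flip w t \in code); first by left; exact: nC d' wc2.
have val1 w1 : w1 \notin E -> w1 \notin code -> pc w1 = 0 \/ exists2 q, q < L & pc w1 = 3 * q + 1.
  move=> h1 h2; have [->|h] := eqVneq (pc w1) 0; first by left.
  right; case: (pcval w1 h) => [[q qL [hq|hq]]|[g gG hg]]; first by exists q.
    by have [_ hw] := pcB _ _ hq; rewrite hw mem_nth ?sc in h2.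
  by have [_ hw] := pcG _ _ hg; rewrite hw mem_nth ?sE in h1.
have [h1|[q1 q1L h1]] := val1 _ wE wc; have [h2|[q2 q2L h2]] := val1 _ wE2 wc2.
- by rewrite h1 h2 eqxx in ne.
- by left; apply: Or31; split=> //; exists q2.
- by right; apply: Or31; split=> //; exists q1.
case/negP: ne; rewrite h1 h2; apply/eqP.
have [_ _ _ a1] := pcA _ _ h1; have [_ _ _ a2] := pcA _ _ h2.
suff : nth w0 code q1 = nth w0 code q2 by move/eqP; rewrite nth_uniq ?sc // => /eqP->.
apply: (@adj_uniq w); rewrite ?mem_nth ?sc //; first by rewrite (eqP a1).
by apply: leq_trans (dist_triangle (flip w t) _ _) _; rewrite d (eqP a2).
Qed.

End Plan.

Section Restrict.
Variables (n c : nat).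
Hypothesis cn : c <= n.
Implicit Types (x : cube n).

Definition res x : cube c := [ffun i => x (widen_ord cn i)].

Lemma res_agree x y : (res x == res y) = agree c x y.
Proof.
apply/eqP/agreeP => [/ffunP h i ic|h]; last by apply/ffunP => i; rewrite !ffunE h /=.
have := h (Ordinal ic); rewrite !ffunE; suff -> : widen_ord cn (Ordinal ic) = i by [].
exact: val_inj.
Qed.

Lemma res_flip x (t : 'I_n) (tc : t < c) : res (flip x t) = flip (res x) (Ordinal tc).
Proof. by apply/ffunP => i; rewrite !ffunE -!val_eqE. Qed.

Lemma card_res (P : pred (cube c)) : #|[set x | P (res x)]| = #|[set w | P w]| * 2 ^ (n - c).
Proof.
rewrite -sum1_card (partition_big res P) /=; last by move=> x; rewrite inE.
rewrite -sum_nat_const; apply: eq_big => [w|w Pw]; first by rewrite inE.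
pose x0 : cube n := [ffun i : 'I_n => if insub (i : nat) is Some i' then w i' else false].
have rx0 : res x0 = w by apply/ffunP => i; rewrite !ffunE /= insubT //= => ic; congr (w _); apply: val_inj.
rewrite -(card_cell x0 cn) -sum1_card; apply: eq_bigl => x; rewrite !inE -res_agree rx0 [w == _]eq_sym.
by case: (res x =P w) => [->|_]; rewrite ?andbF ?Pw.
Qed.
End Restrict.

(** * A cube in one part, with the help of links to the outside *)

Section LadderEmbedding.
Variables (V : finType) (e : rel V) (s n c h' k j D lg : nat) (U Z : {set V}).
Variable links : seq ({set V} * {set V}).
Let L := size links.
Let h := h' + 2 * s + 2.
Let J := 2 * (h + k + 2).
Let iota := J * 2 ^ (2 * s).
(* Half the size of a cell. *)
Let m' := 2 ^ (n - c.+1).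
Let mu := 2 ^ (n - (c + h')).
Local Notation link_nth := (nth (set0, set0) links).
Local Notation deg := (deg e).
Local Notation edges := (edges e).
Hypotheses (e_sym : symmetric e) (e_irr : irreflexive e) (s1 : 1 < s) (Vfree : kfree e s [set: V]).
Hypotheses (c3 : 3 < c) (chn : c + h' <= n) (cn1 : c < n) (h5 : 5 <= h').
Hypotheses (hk : 8 * s * stage_cost s + 8 * s * c <= 2 ^ k) (ch : (2 * c + 1) * (2 * s) <= 2 ^ h).
Hypotheses (jiota : 2 * iota < j) (iotac : 1 + s * (4 + iota) + h' <= c).
Hypotheses (nlg : n <= 2 ^ lg) (dim : c + stage_cost s * ((h + lg + s + 3) * (J + (h + lg + s + 3))) + h <= n).
Hypotheses (UZ : [disjoint U & Z]) (Vs : #|V| <= s * 2 ^ n).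
Hypotheses (Ubig : 2 ^ n <= #|U| + D) (D6 : D * 2 ^ 6 <= 2 ^ n).
Hypothesis UZdeg : {in U :|: Z, forall u, deg u U * 2 ^ j <= 2 ^ n}.
Hypothesis Lsmall : L * c.+1 ^ 3 <= 2 ^ (c - 3).
Hypothesis total : 2 ^ n + 3 * 2 ^ (n - h') <= #|U :|: Z| + L * m'.

Definition good_link (W W' : {set V}) (p : {set V} * {set V}) :=
  [&& p.1 \subset W, p.2 \subset W', #|p.1| == (2 * c + 1) * m', #|p.2| == 4 * m',
      [forall u in p.1, deg u p.1 * 2 ^ iota <= #|p.1|], [forall u in p.2, deg u p.2 * 2 ^ iota <= #|p.2|] &
      edges p.1 p.2 * 2 ^ (2 * iota) <= #|p.1| * #|p.2|].

Hypothesis links_good : {in links, forall p, good_link (U :|: Z) (~: (U :|: Z)) p}.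
Hypothesis links_dis : forall q r, q < L -> r < L -> q != r ->
  [disjoint (link_nth q).1 :|: (link_nth q).2 & (link_nth r).1 :|: (link_nth r).2].

Let linkP q : q < L -> good_link (U :|: Z) (~: (U :|: Z)) (link_nth q).
Proof. by move=> qL; apply: links_good; apply: mem_nth. Qed.

Let A q := (link_nth q).1.
Let B q := (link_nth q).2.
Let UA := \bigcup_(q < L) A q.
Let T0 := U :\: UA.

Let m'E : 2 * m' = 2 ^ (n - c). Proof. by rewrite -expnS; congr (2 ^ _); move: cn1; clear; lia. Qed.
Let mE : 2 ^ c * (2 * m') = 2 ^ n. Proof. by rewrite m'E -expnD subnKC // ltnW. Qed.
Let muE : 2 ^ c * mu = 2 ^ (n - h'). Proof. by rewrite -expnD; congr (2 ^ _); move: chn; clear; lia. Qed.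
Let muh : mu * 2 ^ h' = 2 * m'. Proof. by rewrite m'E -expnD; congr (2 ^ _); move: chn; clear; lia. Qed.

Let cUA : #|UA| <= L * ((2 * c + 1) * m').
Proof.
apply: leq_trans (card_bigcup_le (k := (2 * c + 1) * m') _) _.
  by move=> q _; have /and5P[_ _ /eqP-> _ _] := linkP (ltn_ord q).
by rewrite leq_mul2r -[X in _ <= X]card_ord max_card orbT.
Qed.

Let UAsmall : 16 * (L * ((2 * c + 1) * m')) <= 2 ^ n.
Proof.
have c8 : 2 ^ c = 8 * 2 ^ (c - 3) by rewrite -[8]/(2 ^ 3) -expnD subnKC // ltnW.
have hc : 2 * c + 1 <= c.+1 ^ 3 by rewrite !expnS expn0 muln1; clear; nia.
rewrite -mE c8; have := leq_mul (leqnn L) hc => h1.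
have := leq_trans h1 Lsmall; set a := 2 ^ (c - 3); clearbody a; clear; move=> h.
have := leq_mul (leqnn (16 * m')) h; lia.
Qed.

Let T0low : 2 ^ n <= #|T0| + D + #|UA|.
Proof.
apply: (leq_trans Ubig); have := cardsID UA U; have := subset_leq_card (subsetIr U UA).
rewrite /T0; clear; lia.
Qed.

Let T0half : 2 ^ n <= 2 * #|T0|.
Proof. by have := T0low; have := cUA; have := UAsmall; have := D6; rewrite -[2 ^ 6]/64; clear; lia. Qed.

Let T0deg u : u \in U :|: Z -> deg u T0 * 2 ^ (2 * iota) <= #|T0|.
Proof.
move=> uU; have h1 : deg u T0 <= deg u U by apply/deg_sub/subsetDl.
have := leq_trans (leq_mul h1 (leqnn _)) (UZdeg uU); rewrite (_ : j = (2 * iota).+1 + (j - (2 * iota).+1)); last by rewrite subnKC.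
rewrite expnD mulnA => h2; rewrite -(leq_pmul2l (isT : 0 < 2)).
apply: leq_trans T0half; apply: leq_trans h2; rewrite expnS; set a := 2 ^ (2 * iota); set b := 2 ^ (j - _).
by have : 0 < b; [rewrite expn_gt0|move=> b0; rewrite mulnCA mulnA leq_pmulr].
Qed.

Let leaf_size := 2 * m' + mu.
(** Vertices of [Z] have few neighbours in [U] but perhaps many in [Z], so they cannot join the
    bulk. Sparse pieces of [Z] are put on isolated cells, whose neighbours all belong to the bulk;
    [mu] is their slack. *)
Let leaf (S : {set V}) := [&& S \subset Z :\: UA, #|S| == leaf_size & [forall u in S, deg u S * 2 ^ iota <= #|S|]].

Let mu0 : 0 < mu. Proof. by rewrite expn_gt0. Qed.

Let muS : mu <= 2 * m'.
Proof. by rewrite -muh leq_pmulr // expn_gt0. Qed.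

Let leaf2 : leaf_size <= 2 * (2 * m').
Proof. by have := muS; rewrite /leaf_size; set a := 2 * m'; clear; lia. Qed.

(** If all [2^(c - 4)] pieces are found, they fill [1/16] of the cube, which outweighs [D] and the
    slack. If the packing stops earlier, [sparse_subset] shows that less than [2^(n - h')] vertices
    of [Z :\: UA] lie outside the pieces. *)
Let leaves : exists ls : seq {set V}, [/\ size ls <= 2 ^ (c - 4), all leaf ls,
  forall g r, g < size ls -> r < size ls -> g != r -> [disjoint nth set0 ls g & nth set0 ls r] &
  2 ^ n + 2 ^ (n - h') <= #|T0| + size ls * (2 * m') + L * ((2 * c + 2) * m')].
Proof.
have [ls [h1 h2 h3 h4]] := packing id leaf set0 (2 ^ (c - 4)).
exists ls; split=> //; case: h4 => [->|hmax].
  have e4 : 2 ^ (c - 4) * (2 * m') * 16 = 2 ^ n.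
    by rewrite m'E -[16]/(2 ^ 4) -!expnD; congr (2 ^ _); move: c3 cn1; clear; lia.
  have e5 : 2 ^ (n - h') * 32 <= 2 ^ n.
    by rewrite -[32]/(2 ^ 5) -expnD leq_exp2l //; move: h5 chn; clear; lia.
  have := T0low; have := cUA; have := D6; rewrite -[2 ^ 6]/64; move: e4 e5.
  have : L * ((2 * c + 1) * m') <= L * ((2 * c + 2) * m') by rewrite leq_mul2l leq_mul2r leq_add2l !orbT.
  clear; lia.
set S := Z :\: UA :\: \bigcup_(f <- ls) f.
have cS : #|S| < leaf_size * (16 * 2 ^ iota) ^ s.
  rewrite ltnNge; apply/negP => hS.
  have l0 : 0 < leaf_size by rewrite /leaf_size addn_gt0 mu0 orbT.
  have kf : kfree e s S by apply: kfreeS Vfree; apply: subsetT.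
  have [Y [YS cY hY]] := sparse_subset e_sym e_irr (expn_gt0 2 iota : 0 < 2 ^ iota) l0 kf hS.
  have YP : leaf Y.
    rewrite /leaf cY eqxx (subset_trans YS (subsetDl _ _)) /=; apply/forall_inP => u uY; exact: hY.
  have := hmax Y YP; rewrite -setI_eq0; case/negP; apply/eqP/setP => v; rewrite !inE.
  by apply/negP => /andP[/(subsetP YS)]; rewrite !inE => /andP[/negbTE->].
have cl : #|\bigcup_(f <- ls) f| <= size ls * leaf_size.
  elim: (ls) h2 => [|f l IH]; first by rewrite big_nil cards0.
  rewrite big_cons mulSn => /= /andP[/and3P[_ /eqP cf _] /IH hl].
  by apply: leq_trans (leq_card_setU _ _).1 _; rewrite cf leq_add2l.
have ext : leaf_size * (16 * 2 ^ iota) ^ s <= 2 ^ (n - h').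
  apply: leq_trans (_ : 2 * (2 * m') * (16 * 2 ^ iota) ^ s <= _).
    by rewrite leq_mul2r leaf2 orbT.
  rewrite m'E -[16]/(2 ^ 4) -expnD -expnM -expnS -expnD leq_exp2l //.
  by rewrite [_ * s]mulnC; move: iotac chn; clear; set a := s * _; lia.
have sls : size ls * mu <= 2 ^ (n - h').
  rewrite -muE leq_mul2r; apply/orP; right; apply: (leq_trans h1); rewrite leq_exp2l //; exact: leq_subr.
have cZ : #|Z :\: UA| <= size ls * leaf_size + 2 ^ (n - h').
  apply: leq_trans (_ : #|S :|: \bigcup_(f <- ls) f| <= _).
    apply/subset_leq_card/subsetP => v; rewrite !inE => ->; rewrite andbT; exact: orNb.
  by apply: leq_trans (leq_card_setU _ _).1 _; rewrite addnC leq_add // (leq_trans (ltnW cS)).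
have cUZ : #|U :|: Z| <= #|T0| + #|Z :\: UA| + #|UA|.
  apply: leq_trans (_ : #|(T0 :|: (Z :\: UA)) :|: UA| <= _).
    by apply/subset_leq_card/subsetP => v; rewrite !inE; case: (v \in UA); rewrite //= orbF.
  apply: leq_trans (leq_card_setU _ _).1 _; rewrite leq_add2r; exact: (leq_card_setU _ _).1.
have e1 : L * ((2 * c + 2) * m') = L * ((2 * c + 1) * m') + L * m' by rewrite -mulnDr -mulSnr addn1 addn2.
have e2 : size ls * leaf_size = size ls * (2 * m') + size ls * mu by rewrite -mulnDr.
move: total cZ cUZ cUA sls; rewrite e1 e2; clear.
set a := size ls * _; set b := size ls * mu; set x := L * m'; set y := L * _; set w := 2 ^ (n - h'); lia.
Qed.

(** The bulk [T0] takes every cell not claimed by links or leaves, and [big] leaves it a room of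
    [2^(n - h')]. Its slack needs a proportion [2 * s / 2^h] of at most [s * 2^n] vertices, which
    explains why [h] exceeds [h'] by [2 * s + 2]. *)
Theorem ladder_embedding : red_cube e n.
Proof.
have [ls [lsz lsP lsd big]] := leaves.
have cn := ltnW cn1.
have [pc [pc0 pcv pcA pc1 pct]] := cell_plan c3 Lsmall lsz.
pose pi x := pc (res cn x).
pose T i := if i == 0 then T0 else if i.-1 %% 3 == 0 then A (i.-1 %/ 3)
  else if i.-1 %% 3 == 1 then B (i.-1 %/ 3) else nth set0 ls (i.-1 %/ 3).
have TA q : T (3 * q + 1) = A q.
  rewrite /T addn1 /= [3 * q]mulnC modnMl mulnK //.
have TB q : T (3 * q + 2) = B q.
  rewrite /T addn2 /= -addn1 [3 * q]mulnC modnMDl divnMDl //= addn0 //.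
have TG g : T (3 * g + 3) = nth set0 ls g.
  rewrite /T addn3 /= -addn2 [3 * g]mulnC modnMDl divnMDl //= addn0 //.
have leafP g : g < size ls -> leaf (nth set0 ls g) by move=> gl; apply: (allP lsP); apply: mem_nth.
have kind v i : v \in T i -> [\/ i = 0 /\ v \in U :\: UA,
    exists2 q, i = 3 * q + 1 & [/\ q < L, v \in A q, v \in UA & v \in U :|: Z],
    exists2 q, i = 3 * q + 2 & [/\ q < L, v \in B q & v \notin U :|: Z] |
    exists2 g, i = 3 * g + 3 & [/\ g < size ls, v \in nth set0 ls g & v \in Z :\: UA]].
  rewrite /T; have [->|i0] := eqVneq i 0; first by move=> vT; apply: Or41.
  have iE : i = 3 * (i.-1 %/ 3) + (i.-1 %% 3).+1.
    by rewrite addnS [3 * _]mulnC -divn_eq prednK // lt0n.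
  have b3 := ltn_pmod i.-1 (isT : 0 < 3).
  move: iE b3; set a := i.-1 %/ 3; case: (i.-1 %% 3) => [|[|[|//]]] iE _ /= vT.
  - have aL : a < L.
      rewrite ltnNge; apply/negP => La; move: vT; rewrite /A nth_default // inE //.
    apply: Or42; exists a => //; split=> //; first by apply/bigcupP; exists (Ordinal aL).
    by have /and3P[/subsetP h1 _ _] := linkP aL; apply: h1.
  - have aL : a < L.
      rewrite ltnNge; apply/negP => La; move: vT; rewrite /B nth_default // inE //.
    apply: Or43; exists a => //; split=> //.
    by have /and3P[_ /subsetP h1 _] := linkP aL; have := h1 v vT; rewrite in_setC.
  have aL : a < size ls.
    rewrite ltnNge; apply/negP => La; move: vT; rewrite nth_default // inE //.
  apply: Or44; exists a => //; split=> //.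
  by have /and3P[/subsetP h1 _ _] := leafP a aL; apply: h1.
have link_dis q r v : q < L -> r < L -> v \in A q :|: B q -> v \in A r :|: B r -> q = r.
  move=> qL rL vq vr; apply/eqP; apply/negPn/negP => ne; have := links_dis qL rL ne.
  by move=> /pred0P/(_ v); rewrite /= vq vr.
have dis i r : i != r -> [disjoint T i & T r].
  move=> ne; rewrite -setI_eq0; apply/eqP/setP => v; rewrite inE in_set0; apply/negP => /andP[vi vr].
  have uz : ~~ ((v \in U) && (v \in Z)) by have := UZ => /pred0P/(_ v) /= ->.
  case/negP: ne; apply/eqP.
  case: (kind v i vi) => [[Ei f1]|[q Eq [qL vq f1 f2]]|[q Eq [qL vq f1]]|[q Eq [qL vq f1]]];
  case: (kind v r vr) => [[Er g1]|[p Ep [pL vp g1 g2]]|[p Ep [pL vp g1]]|[p Ep [pL vp g1]]];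
    try by [rewrite Ei Er];
    try by exfalso; move: f1 g1 uz; rewrite ?inE; case: (v \in U); case: (v \in Z); case: (v \in UA).
  - by rewrite Eq Ep; congr (3 * _ + _); apply: (link_dis _ _ v); rewrite // inE ?vq ?vp.
  - by exfalso; move: f2 g1; rewrite inE => ->.
  - by exfalso; move: g2 f1; rewrite inE => ->.
  - by rewrite Eq Ep; congr (3 * _ + _); apply: (link_dis _ _ v); rewrite // inE ?vq ?vp ?orbT.
  - rewrite Eq Ep; congr (3 * _ + _); apply/eqP; apply/negPn/negP => ne.
    by have := lsd q p qL pL ne => /pred0P/(_ v); rewrite /= vq vp.
have cross i r : touching L (size ls) i r -> edges (T i) (T r) * 2 ^ (J * 2 ^ (2 * s) * 2) <= #|T i| * #|T r|.
  have main (S : {set V}) : S \subset U :|: Z -> edges T0 S * 2 ^ (J * 2 ^ (2 * s) * 2) <= #|T0| * #|S|.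
    move=> SU; rewrite edgesC // -/iota [iota * 2]mulnC [leqRHS]mulnC /edges big_distrl /= -sum_nat_const.
    by apply: leq_sum => u uS; apply: T0deg; apply: (subsetP SU).
  case=> [[-> [q qL ->]]|[-> [g gL ->]]|[q qL [-> ->]]].
  - by rewrite TA; apply: main; have /and3P[] := linkP qL.
  - rewrite TG; apply: main; have /and3P[h1 _ _] := leafP g gL; apply: (subset_trans h1).
    by apply: subset_trans (subsetDl _ _) (subsetUr _ _).
  rewrite TA TB -/iota [iota * 2]mulnC; have := linkP qL; rewrite /good_link.
  by do 6 case/andP=> _.
have s22 : 2 * s ^ 2 <= 2 ^ (2 * s).+1.
  by rewrite [2 ^ _.+1]expnS leq_mul2l [2 * s]mulnC expnM leq_exp2r // ltnW // ltn_expl.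
have hE : 2 ^ h = 2 ^ h' * 2 * 2 ^ (2 * s).+1 by rewrite /h -[2 in RHS]/(2 ^ 1) -!expnD; congr (2 ^ _); rewrite expn1; clear; lia.
have h2s : 2 * s <= 2 ^ h by apply: leq_trans ch; rewrite leq_pmull // addn1.
have card_pi x : #|[set x' | pi x' == pi x]| = #|[set w | pc w == pi x]| * (2 * m').
  by rewrite m'E -(card_res cn (fun w => pc w == pi x)).
have pi_kind x : [\/ pi x = 0, exists2 q, q < L & pi x = 3 * q + 1, exists2 q, q < L & pi x = 3 * q + 2 |
    exists2 g, g < size ls & pi x = 3 * g + 3].
  have [E|ne] := eqVneq (pi x) 0; first by apply: Or41.
  by case: (pcv _ ne) => [[q qL [E|E]]|[g gL E]]; [apply: Or42|apply: Or43|apply: Or44]; [exists q|exists q|exists g].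
have linkE q : q < L -> [/\ #|A q| = (2 * c + 1) * m', #|B q| = 4 * m',
    {in A q, forall u, deg u (A q) * 2 ^ iota <= #|A q|} & {in B q, forall u, deg u (B q) * 2 ^ iota <= #|B q|}].
  by move=> qL; have /and5P[_ _ /eqP h1 /eqP h2 /and3P[/forall_inP h3 /forall_inP h4 _]] := linkP qL.
apply: (uniform_embedding (l := 3 * (L + size ls) + 4) (T := T) (pi := pi) e_sym e_irr s1 Vfree cn hk h2s _ _ _ _ _ _ nlg dim).
- by move=> x; case: (pi_kind x) => [->|[q qL ->]|[q qL ->]|[q qL ->]]; [rewrite addn4|move: qL; clear; lia..].
- by move=> x x'; rewrite -(res_agree cn) /pi => /eqP->.
- by move=> i r _ _; apply: dis.
- move=> x; rewrite card_pi; case: (pi_kind x) => [E|[q qL E]|[q qL E]|[g gL E]]; rewrite E.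
  + have t0s : #|T0| <= s * 2 ^ n by apply: leq_trans Vs; apply: max_card.
    have -> : T 0 = T0 by [].
    have hp : 0 < 2 ^ h by rewrite expn_gt0.
    have key : 2 ^ n * 2 ^ h + #|T0| * (2 * s) <= (#|T0| + size ls * (2 * m') + L * ((2 * c + 2) * m')) * 2 ^ h.
      apply: leq_trans (leq_mul big (leqnn _)); rewrite mulnDl leq_add2l.
      rewrite {1}hE; have -> : 2 ^ (n - h') * (2 ^ h' * 2 * 2 ^ (2 * s).+1) = 2 ^ n * (2 * 2 ^ (2 * s).+1).
        by rewrite -[_ * 2 * _]mulnA mulnA -expnD subnK //; move: chn; clear; lia.
      apply: leq_trans (leq_mul t0s (leqnn _)) _; rewrite mulnAC mulnC leq_mul2l.
      by apply/orP; right; apply: leq_trans (leq_pmull _ (isT : 0 < 2)); apply: leq_trans s22; rewrite mulnCA mulnn.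
    have fit : #|[set w | pc w == 0]| * (2 * m') + size ls * (2 * m') + L * ((2 * c + 2) * m') <= 2 ^ n.
      rewrite -mE; apply: leq_trans (leq_mul pc0 (leqnn (2 * m'))); rewrite [leqRHS]mulnDl [X in _ <= X + _]mulnDl leq_add2l.
      by rewrite (_ : L * ((2 * c + 2) * m') = L * c.+1 * (2 * m')) //; clear; lia.
    have := leq_mul fit (leqnn (2 ^ h)); move: key; clear.
    set a := #|[set _ | _]| * (2 * m'); set b := size ls * _; set d := L * _; set H := 2 ^ h; set t := #|T0|.
    clearbody a b d H t; rewrite mulnBr !mulnDl; lia.
  + rewrite TA; have [-> _ _ _] := linkE q qL.
    apply: leq_trans (_ : c * (2 * m') * 2 ^ h <= _); first by rewrite !leq_mul2r pcA !orbT.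
    rewrite mulnA mulnAC [_ * m' * (_ - _)]mulnAC leq_mul2r; apply/orP; right.
    by move: ch; rewrite mulnBr; clear; set a := 2 ^ h; lia.
  + rewrite TB; have [_ -> _ _] := linkE q qL.
    apply: leq_trans (_ : 1 * (2 * m') * 2 ^ h <= _).
      by rewrite !leq_mul2r pc1 ?orbT //; [move=> q'; clear; lia|rewrite addn2].
    rewrite mul1n mulnAC [4 * m' * _]mulnAC leq_mul2r; apply/orP; right.
    have : (2 * c + 1) * (2 * s) >= 3 * (2 * s) by rewrite leq_mul2r; apply/orP; right; move: c3; clear; lia.
    by move: ch; clear; set a := 2 ^ h; set b := _ * (2 * s); lia.
  rewrite TG; have /and3P[_ /eqP-> _] := leafP g gL.
  apply: leq_trans (_ : 1 * (2 * m') * 2 ^ h <= _).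
    by rewrite !leq_mul2r pc1 ?orbT //; [move=> q'; clear; lia|rewrite addn3].
  have hs : leaf_size * (2 * s) <= mu * 2 ^ h.
    rewrite hE -[2 ^ h' * 2 * _]mulnA [leqRHS]mulnA muh; apply: leq_trans (_ : (2 * (2 * m')) * (2 * s) <= _).
      by rewrite leq_mul2r leaf2 orbT.
    rewrite [2 * (2 * m')]mulnC -mulnA leq_mul2l leq_mul2l; apply/orP; right.
    apply: leq_trans s22; rewrite leq_mul2l -mulnn leq_pmulr ?orbT //; exact: ltnW.
  move: hs; rewrite mul1n mulnBr /leaf_size mulnDl; clear.
  set a := 2 * m' * 2 ^ h; set b := (_ + _) * _; set d := mu * _; lia.
- move=> x u; rewrite -/iota; case: (pi_kind x) => [->|[q qL ->]|[q qL ->]|[g gL ->]].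
  + rewrite (_ : T 0 = T0) // => uT; have uU : u \in U :|: Z by move: uT; rewrite !inE => /andP[_ ->].
    apply: leq_trans (T0deg uU); rewrite leq_mul2l leq_exp2l // mul2n -addnn leq_addr orbT //.
  + by rewrite TA; have [_ _ h1 _] := linkE q qL; apply: h1.
  + by rewrite TB; have [_ _ _ h1] := linkE q qL; apply: h1.
  by rewrite TG; have /and3P[_ _ /forall_inP h1] := leafP g gL; apply: h1.
move=> x t tc ne; rewrite /pi (res_flip cn x tc) in ne *.
by case: (pct _ _ ne) => hT; [exact: cross|rewrite edgesC // [leqRHS]mulnC; exact: cross].
Qed.

End LadderEmbedding.

(** In a cube of dimension [c = 2 * j], where [c.+1 <= 2^(l + 1)], a code of [2^(c - ladder_gain l)]
    words satisfies the volume condition [L * c.+1 ^ 3 <= 2^(c - 3)]. *)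
Definition ladder_gain l := 3 * l + 6.
Definition ladder_slack s l := ladder_gain l + s + 5.
Definition ladder_weight s l := l + s + 5 + 8 * s * stage_cost s.
Definition ladder_stage s l := 2 * (ladder_slack s l + 2 * s + 2 + ladder_weight s l + 2).
Definition ladder_density s l := ladder_stage s l * 2 ^ (2 * s).

Lemma ladder_arith s I d l : d <= I * l.+1 ->
  s.+1 * (4 * d + s + 10) + 2 * l + (3 * l + 6 + s + 5) + (3 * l + 6) + 20 <=
  (s.+1 * (4 * I + s + 10) + 60 + 2 * s) * l.+1.
Proof.
move=> hd; have hs := leq_pmulr s (ltn0Sn l).
have key : 4 * d + s + 10 <= (4 * I + s + 10) * l.+1.
  rewrite [leqRHS]mulnDl [(_ + s) * _]mulnDl -[4 * I * l.+1]mulnA; move: hd hs; set x := I * _; set y := s * _; clear; lia.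
have {}key := leq_mul (leqnn s.+1) key; rewrite mulnA in key.
apply: leq_trans (_ : s.+1 * (4 * I + s + 10) * l.+1 + 2 * l + (3 * l + 6 + s + 5) + (3 * l + 6) + 20 <= _).
  by rewrite !leq_add2r.
move: hs; set Y := s.+1 * _; clearbody Y; clear => hs; rewrite [leqRHS]mulnDl [(Y + _) * _]mulnDl -[2 * s * l.+1]mulnA.
move: hs; set x := s * _; set y := Y * _; clear; lia.
Qed.

(** [ladder_density s l] is linear in [l], so logarithmic in [j], and the conditions on [j] hold
    from a constant on. As [j] is itself at most about [log n], the conditions on the dimension are
    polynomial in [log n]. *)
Lemma ladder_numerics s : 1 < s -> exists j0 n0, forall n j, n0 <= n -> j0 <= j -> j <= trunc_log 2 n + 8 ->
  let l := (trunc_log 2 j).+1 in let a := ladder_slack s l + 2 * s + 2 + (trunc_log 2 n).+1 + s + 3 in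
  [/\ j < 2 ^ l, s + 4 <= l,
      s.+1 * (4 * ladder_density s l + s + 10) + 2 * l + ladder_slack s l + ladder_gain l + 20 <= j,
      3 * j + 20 <= n &
      2 * j + stage_cost s * (a * (ladder_stage s l + a)) + (ladder_slack s l + 2 * s + 2) <= n].
Proof.
move=> s1; set P := stage_cost s.
pose I := (8 + 2 * (4 * s + 20 + 8 * s * P)) * 2 ^ (2 * s).
pose C := s.+1 * (4 * I + s + 10) + 60 + 2 * s.
exists (2 ^ (4 * (2 + C + 40))), (2 ^ (4 * (10.+1 + (12 * P + 20) + 40))) => n j hn hj jn l a.
have j0 : 0 < j by apply: leq_trans hj; rewrite expn_gt0.
have lj : j < 2 ^ l by apply: trunc_log_ltn.
have lC : 4 * (2 + C + 40) <= trunc_log 2 j by apply: trunc_log_max.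
have ll : C * l.+1 <= j.
  apply: leq_trans (trunc_logP (isT : 1 < 2) j0); apply: leq_trans (poly_exp lC).
  apply: leq_trans (leq_addl _ _); rewrite leq_mul2l; apply/orP; right.
  by rewrite /l addn2 -mulnn leq_pmulr.
have dens : ladder_density s l <= I * l.+1.
  rewrite /ladder_density /I mulnAC leq_mul2r; apply/orP; right.
  rewrite /ladder_stage /ladder_slack /ladder_gain /ladder_weight -/P; set q := 8 * s * P.
  clearbody q l; clear; nia.
have big : s.+1 * (4 * ladder_density s l + s + 10) + 2 * l + ladder_slack s l + ladder_gain l + 20 <= j.
  apply: leq_trans ll; rewrite /C /ladder_slack /ladder_gain; move: dens; set d := ladder_density s l.
  by move=> hd; apply: ladder_arith.
have dim := log_poly hn; set lg := (trunc_log 2 n).+1 in dim a *.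
have jlg : j <= lg + 7 by move: jn; rewrite /lg; lia.
have d_st : ladder_stage s l <= ladder_density s l by rewrite leq_pmulr // expn_gt0.
have d_sl : ladder_slack s l + 2 * s + 2 <= ladder_stage s l by rewrite /ladder_stage; clear; lia.
have d_de : 8 * ladder_density s l + 2 * s + 20 <= j by move: big s1; clear; nia.
split=> //.
- by move: lC; rewrite /C /l; clear; nia.
- by move: dim jlg; set X := (lg + _) ^ 2; have : lg + 10 <= X; [rewrite /X -mulnn leq_pmulr // addnS|]; clear; nia.
apply: leq_trans dim; have ha : a <= 2 * (lg + 10) by rewrite /a; move: jlg d_de d_sl d_st; clear; lia.
have hb : ladder_stage s l + a <= 3 * (lg + 10) by move: ha jlg d_de d_st; clear; lia.
have := leq_mul (leqnn P) (leq_mul ha hb); rewrite -mulnn; move: jlg d_de d_sl d_st.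
have : lg + 10 <= (lg + 10) * (lg + 10) by rewrite leq_pmulr // addnS.
set X := (lg + 10) * _; set A := P * (a * _).
rewrite (_ : P * _ = 6 * (P * X)); last by rewrite /X; clear; lia.
set PX := P * X; rewrite (_ : (12 * P + 20) * X = 12 * PX + 20 * X); last by rewrite /PX; clear; lia.
clearbody A PX X; clear; lia.
Qed.

Section Step.
Variables (V : finType) (e : rel V).
Hypotheses (e_sym : symmetric e) (e_irr : irreflexive e).
Local Notation deg := (deg e).
Local Notation edges := (edges e).

(** A pair of large sets that is too sparse for [dense_vertex] would be reduced by [sparse_link] to
    a good link; the two extra bits of density pay for the factor 4 lost there. *)
Lemma no_link_meets s n c h' k (W W' : {set V}) g d :
  let iota := 2 * (h' + 2 * s + 2 + k + 2) * 2 ^ (2 * s) in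
  kfree e s [set: V] -> 1 < c -> (forall p, ~~ good_link e s n c h' k W W' p) ->
  2 * ((2 * c + 1) * 2 ^ (n - c.+1) * (16 * 2 ^ iota) ^ s) <= g -> d * 2 ^ (2 * iota + 2) <= g ->
  meets e g d W W'.
Proof.
move=> iota kf c1 nl hg hd A B AW BW gA gB.
have [hE|hE] := leqP (edges A B * 2 ^ (2 * iota + 2)) (#|A| * #|B|); last first.
  have [v vA hv] := dense_vertex hE; exists v => //.
  rewrite -(leq_pmul2r (expn_gt0 2 (2 * iota + 2))); apply: (leq_trans hd); exact: leq_trans hv.
have kfS (S : {set V}) : kfree e s S by apply: kfreeS kf; apply: subsetT.
have m0 : 0 < 2 ^ (n - c.+1) by rewrite expn_gt0.
have a0 : 0 < (2 * c + 1) * 2 ^ (n - c.+1) by rewrite muln_gt0 m0 addn1.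
have b0 : 0 < 4 * 2 ^ (n - c.+1) by rewrite muln_gt0.
have [|A' [B' [[A'A cA iA] [B'B cB iB] hE']]] := sparse_link e_sym e_irr (expn_gt0 2 iota : 0 < 2 ^ iota) a0 b0
  (kfS A) (kfS B) hE (leq_trans hg gA) _.
  apply: leq_trans gB; apply: leq_trans hg; rewrite leq_mul2l leq_mul2r leq_mul2r.
  by rewrite (_ : 4 <= 2 * c + 1) ?orbT //; move: c1; clear; lia.
case/negP: (nl (A', B')); rewrite /good_link /= (subset_trans A'A AW) (subset_trans B'B BW) cA cB !eqxx /=.
apply/and3P; split; [by apply/forall_inP|by apply/forall_inP|].
rewrite -(leq_pmul2l (isT : 0 < 4)); apply: leq_trans hE'.
change (4 * (edges A' B' * 2 ^ (2 * iota)) <= edges A' B' * 2 ^ (2 * iota + 2)).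
by rewrite expnD mulnA [leqRHS]mulnA [leqRHS]mulnC mulnA.
Qed.

Lemma good_link_sub s n c h' k (W1 W1' W2 W2' : {set V}) p : W1 \subset W1' -> W2 \subset W2' ->
  good_link e s n c h' k W1 W2 p -> good_link e s n c h' k W1' W2' p.
Proof.
by move=> h1 h2 /and3P[k1 k2 k3]; apply/and3P; split=> //; apply: subset_trans; eassumption.
Qed.

(** Priority goes to the part that contains the vertex, so that each [U i] stays inside the set of
    vertices attached to it. *)
Lemma attachment n j p D U : near_partition e n j p D U ->
  exists att : V -> nat, [/\ forall w, att w < p, forall i w, i < p -> w \in U i -> att w = i &
    forall w, deg w (U (att w)) * 2 ^ j <= 2 ^ n].
Proof.
move=> [dis _ inner light].
pose att w : nat := if [pick i : 'I_p | w \in U i] is Some i then i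
  else if [pick i : 'I_p | deg w (U i) * 2 ^ j <= 2 ^ n] is Some i then i else 0.
exists att; split=> [w|i w ip wi|w]; rewrite /att.
- case: pickP => // _; case: pickP => // h; have [i ip hi] := light w.
  by have := h (Ordinal ip); rewrite hi.
- case: pickP => [k wk|h]; last by have := h (Ordinal ip); rewrite wi.
  apply/eqP; apply/negPn/negP => ne; have := dis k i (ltn_ord k) ip ne.
  by move/pred0P/(_ w); rewrite /= wk wi.
case: pickP => [k wk|_]; first exact: inner (ltn_ord k) _ wk.
by case: pickP => // h; have [i ip hi] := light w; have := h (Ordinal ip); rewrite hi.
Qed.

Variable s : nat.
Hypothesis s1 : 1 < s.
Hypothesis kf : kfree e s [set: V].
Variables (n j D : nat) (U : nat -> {set V}).
Let l := (trunc_log 2 j).+1.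
Let lg := (trunc_log 2 n).+1.
Let c := 2 * j.
Let h' := ladder_slack s l.
Let k := ladder_weight s l.
Let L := 2 ^ (c - ladder_gain l).
(** The deficit of a part will be at most [s.+1 * B0 <= 2^(n - (ladder_gain l + 2))], half of what
    [L] links are worth. *)
Let B0 := 2 ^ (n - (ladder_gain l + 2 + s)).
Let a := h' + 2 * s + 2 + lg + s + 3.
Let iota := ladder_density s l.
Hypotheses (jl : j < 2 ^ l) (sl : s + 4 <= l).
Hypothesis jbig : s.+1 * (4 * iota + s + 10) + 2 * l + h' + ladder_gain l + 20 <= j.
Hypothesis jn : 3 * j + 20 <= n.
Hypothesis dim : 2 * j + stage_cost s * (a * (ladder_stage s l + a)) + (h' + 2 * s + 2) <= n.
Hypotheses (Vlow : s.-1 * (2 ^ n - 1) <= #|V|) (Vup : #|V| <= s * 2 ^ n).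
Hypotheses (D6 : D * 2 ^ 6 <= 2 ^ n) (st : near_partition e n j s.-1 D U).

Let iota_h : h' + 2 * s + 2 <= iota.
Proof.
rewrite /iota /ladder_density; apply: leq_trans (leq_pmulr _ (expn_gt0 2 _)).
by rewrite /ladder_stage -/h'; clear; lia.
Qed.

Let siota : s * (4 * iota + s + 10) + (4 * iota + s + 10) + 2 * l + h' + ladder_gain l + 20 <= j.
Proof. by move: jbig; rewrite mulSn [(4 * _ + _ + _) + _]addnC. Qed.

Let L3 : L * c.+1 ^ 3 <= 2 ^ (c - 3).
Proof.
have c1 : c.+1 <= 2 ^ l.+1 by rewrite /c expnS; move: jl; clear; lia.
have := leq_exp2r c.+1 (2 ^ l.+1) (isT : 0 < 3); rewrite c1 => /(leq_mul (leqnn L)) /leq_trans; apply.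
rewrite /L -expnM -expnD leq_exp2l //; move: siota; rewrite /c /ladder_gain; clear; lia.
Qed.

Lemma ladder_embed i (Z : {set V}) (links : seq ({set V} * {set V})) : i < s.-1 -> [disjoint U i & Z] ->
  {in U i :|: Z, forall u, deg u (U i) * 2 ^ j <= 2 ^ n} -> size links <= L ->
  2 ^ n + 3 * 2 ^ (n - h') <= #|U i :|: Z| + size links * 2 ^ (n - c.+1) ->
  {in links, forall p, good_link e s n c h' k (U i :|: Z) (~: (U i :|: Z)) p} ->
  (forall q r, q < size links -> r < size links -> q != r ->
    [disjoint (nth (set0, set0) links q).1 :|: (nth (set0, set0) links q).2 &
              (nth (set0, set0) links r).1 :|: (nth (set0, set0) links r).2]) ->
  red_cube e n.
Proof.
move=> ip dUZ UZdeg sL total good dis; have [_ low _ _] := st.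
have hc : 2 * c + 1 <= 2 ^ l.+2 by rewrite /c [2 ^ l.+2]expnS [2 ^ l.+1]expnS; move: jl; clear; lia.
have s2 : 2 * s <= 2 ^ s.+1 by rewrite expnS leq_mul2l ltnW ?orbT // ltn_expl.
have sio := siota; have ih := iota_h.
have iotaE : 2 * (h' + 2 * s + 2 + k + 2) * 2 ^ (2 * s) = iota by [].
apply: (ladder_embedding e_sym e_irr s1 kf (c := c) (h' := h') (k := k) (j := j) (D := D) (lg := lg) (U := U i) (Z := Z) (links := links)) => //.
- by rewrite /c; move: sio; clear; lia.
- by rewrite /c; move: sio jn; clear; lia.
- by rewrite /c; move: jn; clear; lia.
- by rewrite /h' /ladder_slack /ladder_gain; clear; lia.
- rewrite (_ : 2 ^ k = 2 ^ (k.-1) + 2 ^ k.-1); last by rewrite addnn -mul2n -expnS.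
  apply: leq_add.
    apply: leq_trans (ltnW (ltn_expl _ (isT : 1 < 2))) _; rewrite leq_exp2l // /k /ladder_weight.
    by move: s1; clear; set q := 8 * s * _; lia.
  have h1 : 8 * s * c <= 2 ^ (3 + s + l.+1).
    rewrite !expnD; apply: leq_mul; first by rewrite leq_mul2l ltnW // ltn_expl.
    by rewrite /c expnS leq_mul2l ltnW.
  by apply: (leq_trans h1); rewrite leq_exp2l // /k /ladder_weight; set q := 8 * s * _; clear; lia.
- apply: leq_trans (leq_mul hc s2) _; rewrite -expnD leq_exp2l // /h' /ladder_slack /ladder_gain; clear; lia.
- by rewrite iotaE; move: sio; clear; lia.
- rewrite iotaE /c; move: sio; move: (iota) (h') => I H; clear; nia.
- exact/ltnW/trunc_log_ltn.
- exact: low.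
- by apply: leq_trans L3; rewrite leq_mul2r sL orbT.
Qed.

(** The argument runs on the sets [VV i] of all attached vertices, which cover [V]: either one of
    them exceeds [2^n] by [B0] and holds a cube without any link, or all of them are close to [2^n].
    As the new parts are cut from the [VV i] and not from the [U i], the defect [D] does not
    accumulate from round to round. *)
Lemma ladder_step : red_cube e n \/ exists D' U', D' * 2 ^ 6 <= 2 ^ n /\ near_partition e n j.+1 s.-1 D' U'.
Proof.
have [att [attp attU attd]] := attachment st; have [_ low _ _] := st.
have sio := siota; have s0 : 0 < s := ltnW s1.
pose VV i := [set w | att w == i].
have UVV i : i < s.-1 -> U i \subset VV i.
  by move=> ip; apply/subsetP => w wU; rewrite inE (attU i w ip wU).
have VVE i : i < s.-1 -> U i :|: (VV i :\: U i) = VV i.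
  move=> ip; apply/setP => w; rewrite in_setU in_setD.
  by have [/(subsetP (UVV i ip)) ->|//] := boolP (w \in U i).
have UVd i : [disjoint U i & VV i :\: U i].
  by rewrite -setI_eq0 setIDA setDIl setDv set0I.
have VVdeg i : {in VV i, forall u, deg u (U i) * 2 ^ j <= 2 ^ n}.
  by move=> u; rewrite inE => /eqP <-; apply: attd.
have gn : ladder_gain l + 2 + s + 9 <= n by move: sio jn; clear; lia.
have hB : 3 * 2 ^ (n - h') <= B0.
  rewrite /B0 (_ : n - (ladder_gain l + 2 + s) = (n - h') + 3); last first.
    by move: sio jn; rewrite /h' /ladder_slack; clear; lia.
  by rewrite expnD mulnC leq_mul2l orbT.
have [/existsP[i hi]|/existsPn hsmall] := boolP [exists i : 'I_(s.-1), 2 ^ n + B0 <= #|VV i|].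
  left; apply: (@ladder_embed i (VV i :\: U i) [::]) => //; first by rewrite VVE.
  by rewrite VVE // mul0n addn0; apply: leq_trans hi; rewrite leq_add2l.
have small i : i < s.-1 -> #|VV i| < 2 ^ n + B0.
  by move=> ip; have := hsmall (Ordinal ip); rewrite -ltnNge.
have VVdis i r : i != r -> [disjoint VV i & VV r].
  move=> ne; rewrite -setI_eq0; apply/eqP/setP => w; rewrite !inE.
  by apply/negP => /andP[/eqP-> E]; rewrite E in ne.
have VVsum : \sum_(i < s.-1) #|VV i| = #|V|.
  rewrite -card_bigcup_disjoint; last by move=> i r _ _; apply: VVdis.
  rewrite -cardsT; congr #|pred_of_set _|; apply/setP => w; rewrite [RHS]inE; apply/bigcupP.
  by exists (Ordinal (attp w)); rewrite // inE.
have B0s : s <= B0.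
  apply: leq_trans (ltnW (ltn_expl s (isT : 1 < 2))) _; rewrite leq_exp2l //.
  by move: sio jn; clear; lia.
have B0g : s.+1 * B0 <= 2 ^ (n - (ladder_gain l + 2)).
  apply: leq_trans (leq_mul (ltn_expl s (isT : 1 < 2)) (leqnn _)) _; rewrite /B0 -expnD leq_exp2l //.
  by move: gn; clear; lia.
have large i : i < s.-1 -> 2 ^ n <= #|VV i| + 2 ^ (n - (ladder_gain l + 2)).
  move=> ip; apply: leq_trans (leq_add (leqnn _) B0g).
  have : s.-1 * 2 ^ n <= #|VV i| + s.-2 * (2 ^ n + B0) + s.
    apply: leq_trans (_ : #|V| + s <= _).
      by move: Vlow; rewrite mulnBr muln1; have := leq_pred s; clear; set q := s.-1 * _; lia.
    rewrite leq_add2r -VVsum (bigD1 (Ordinal ip)) //= leq_add2l.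
    apply: leq_trans (_ : \sum_(r < s.-1 | r != Ordinal ip) (2 ^ n + B0) <= _).
      by apply: leq_sum => r _; apply/ltnW/small.
    rewrite sum_nat_const leq_mul2r; apply/orP; right.
    by have := cardC1 (Ordinal ip); rewrite card_ord => <-; apply/subset_leq_card/subsetP => r; rewrite !inE.
  have s2E : s.-1 = s.-2.+1 by rewrite prednK //; move: s1; clear; lia.
  rewrite [s.-1 * 2 ^ n](_ : _ = 2 ^ n + s.-2 * 2 ^ n); last by rewrite -mulSn -s2E.
  have h2 : s.-2 * B0 <= s * B0 by rewrite leq_mul2r; apply/orP; right; clear; lia.
  rewrite mulnDr mulSn; move: h2 B0s; clear; set x := s.-2 * B0; set y := s * B0; set q := s.-2 * 2 ^ n; lia.
pose supp (p : {set V} * {set V}) := p.1 :|: p.2.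
pose packed (x : 'I_(s.-1) * 'I_(s.-1)) fs := [/\ size fs <= L,
    all (good_link e s n c h' k (VV x.1) (VV x.2)) fs,
    forall i r, i < size fs -> r < size fs -> i != r ->
      [disjoint supp (nth (set0, set0) fs i) & supp (nth (set0, set0) fs r)] &
    size fs = L \/ forall p, good_link e s n c h' k (VV x.1) (VV x.2) p ->
      ~~ [disjoint supp p & \bigcup_(f <- fs) supp f]].
have [fs fsP] : exists fs, forall x, packed x (fs x).
  apply: (@fin_all_exists _ (fun=> seq ({set V} * {set V})) packed) => x.
  exact: (packing supp (good_link e s n c h' k (VV x.1) (VV x.2)) (set0, set0) L).
have [/existsP[[i r] /andP[/= ir /eqP sL]]|/existsPn few] :=
    boolP [exists x : 'I_(s.-1) * 'I_(s.-1), (x.1 != x.2) && (size (fs x) == L)].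
  left; have [_ good dis _] := fsP (i, r).
  apply: (@ladder_embed i (VV i :\: U i) (fs (i, r))) => //; rewrite ?VVE // ?sL //.
    apply: leq_trans (_ : #|VV i| + 2 ^ (n - (ladder_gain l + 2)) + 2 ^ (n - (ladder_gain l + 2)) <= _).
      apply: leq_add (large i (ltn_ord i)) _; apply: (leq_trans hB); rewrite /B0 leq_exp2l //.
      by move: gn; clear; lia.
    rewrite -addnA leq_add2l addnn -mul2n -expnS /L -expnD leq_exp2l //.
    by move: sio jn; rewrite /c; clear; lia.
  move=> p pf; apply: good_link_sub (subxx _) _ (allP good p pf) => /=.
  by rewrite -disjoints_subset disjoint_sym; apply: VVdis.
right; pose X := \bigcup_(x : 'I_(s.-1) * 'I_(s.-1) | x.1 != x.2) \bigcup_(f <- fs x) supp f.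
have s2 : s <= 2 ^ s by apply/ltnW/ltn_expl.
have sio2 : 4 * (s * iota) + s * s + 10 * s + 4 * iota + 2 * l + ladder_gain l + 30 <= j.
  by move: sio; move: (iota) (h') (ladder_gain l) => I H Gn; clear; lia.
have lg6 : 3 * l + 6 = ladder_gain l by [].
have cX : #|X| <= 2 ^ (n - 9).
  have cfs x : #|\bigcup_(f <- fs x) supp f| <= L * ((2 * c + 5) * 2 ^ (n - c.+1)).
    have [sL good _ _] := fsP x; apply: leq_trans (leq_mul sL (leqnn _)).
    elim: (fs x) good => [|f t IH] /=; first by rewrite big_nil cards0.
    case/andP => /and5P[_ _ /eqP c1 /eqP c2 _] /IH ht; rewrite big_cons mulSn.
    apply: leq_trans (leq_card_setU _ _).1 _; apply: leq_add ht.
    by apply: leq_trans (leq_card_setU _ _).1 _; rewrite c1 c2 -mulnDl leq_mul2r; apply/orP; right; clear; lia.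
  apply: leq_trans (card_bigcup_le (k := L * ((2 * c + 5) * 2 ^ (n - c.+1))) _) _; first by move=> x _; apply: cfs.
  have hs : #|[pred x : 'I_(s.-1) * 'I_(s.-1) | x.1 != x.2]| <= 2 ^ s * 2 ^ s.
    apply: leq_trans (max_card _) _; rewrite card_prod card_ord.
    by apply: leq_mul; apply: leq_trans (leq_pred s) s2.
  have hc : 2 * c + 5 <= 2 ^ (l + 3).
    have e1 : 2 ^ (l + 3) = 8 * 2 ^ l by rewrite expnD mulnC.
    by rewrite e1 /c; move: jl; set q := 2 ^ l; clear; lia.
  apply: leq_trans (leq_mul hs (leq_mul (leqnn L) (leq_mul hc (leqnn _)))) _.
  rewrite /L -!expnD leq_exp2l //; move: sio2 lg6 sl jn; rewrite /c; move: (l) => l0; clear; lia.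
pose W i := VV i :\: X.
(* The first scale is fixed by the target [s * g 1 * 2^(j + 1) <= 2^n]; each further one is smaller
   by the link density [2 * iota + 2] and by a factor for [s]. *)
pose g i := 2 ^ (n - ((j.+1 + s) + i * (2 * iota + 2 + s))).
exists (2 ^ (n - 6)).
have nE9 : 2 ^ n = 512 * 2 ^ (n - 9).
  by rewrite -[512]/(2 ^ 9) -expnD; congr (2 ^ _); move: jn; clear; lia.
have hr2 : 2 ^ (n - (ladder_gain l + 2)) <= 2 * 2 ^ (n - 9).
  by rewrite -expnS leq_exp2l //; move: jn lg6; clear; lia.
have sg0 : s * g 0 <= 2 ^ (n - 9).
  apply: leq_trans (leq_mul s2 (leqnn _)) _; rewrite /g -expnD leq_exp2l //.
  by move: sio2 jn; rewrite mul0n; move: (iota) (l) => I l0; clear; lia.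
have [U' hU' _] : exists2 U', near_partition e n j.+1 s.-1 (2 ^ (n - 6)) U' & forall i, i < s.-1 -> U' i \subset W i.
  apply: (@classes_near_partition V e e_sym e_irr s n j.+1 s.-1 (#|X| + s) B0 (2 ^ (n - 6)) W g) => //.
  - by move=> i _; rewrite expn_gt0.
  - move=> i r t ip rp ir ts; have tq := leq_mul (ltnW ts) (leqnn (2 * iota + 2 + s)).
    have tq1 := leq_mul ts (leqnn (2 * iota + 2 + s)); rewrite mulSn in tq1.
    apply: (no_link_meets (s := s) (n := n) (c := c) (h' := h') (k := k)) => //.
    + by rewrite /c; move: sio2; clear; lia.
    + move=> p; apply/negP => gp; have [_ _ _ [E|hmax]] := fsP (Ordinal ip, Ordinal rp).
        by have := few (Ordinal ip, Ordinal rp); rewrite /= E eqxx andbT -val_eqE /= ir.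
      have := hmax p (good_link_sub (subsetDl _ _) (subsetDl _ _) gp).
      have pX : supp p \subset ~: X.
        have /and3P[p1 p2 _] := gp; rewrite subUset; apply/andP.
        by split; [apply: (subset_trans p1)|apply: (subset_trans p2)]; apply/subsetP => w; rewrite !inE => /andP[].
      case/negP; rewrite disjoints_subset; apply: (subset_trans pX); rewrite setCS.
      by apply: (bigcup_sup (Ordinal ip, Ordinal rp)).
    + apply: leq_trans (_ : 2 * (2 ^ l.+2 * 2 ^ (n - c.+1) * (16 * 2 ^ iota) ^ s) <= _).
        rewrite leq_mul2l leq_mul2r leq_mul2r; apply/orP; right; apply/orP; right; apply/orP; right.
        by rewrite [2 ^ l.+2]expnS [2 ^ l.+1]expnS /c; move: jl; set q := 2 ^ l; clear; lia.
      rewrite -[16]/(2 ^ 4) -[2 ^ 4 * _]expnD -expnM -!expnD -expnS leq_exp2l //.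
      move: tq sio2 jn lg6; rewrite /c [(4 + _) * s]mulnC; move: (iota) (l) => I l0; clear; rewrite !mulnDr.
      set x := t * _; set y := t * _; set z := t * s; lia.
    change (s * g t.+1 * 2 ^ (2 * iota + 2) <= g t).
    apply: leq_trans (leq_mul (leq_mul s2 (leqnn _)) (leqnn _)) _; rewrite -!expnD leq_exp2l //.
    have sqE : s * (2 * iota + 2 + s) = 2 * (s * iota) + 2 * s + s * s by move: (iota) => I; clear; lia.
    move: tq tq1 sio2 jn; rewrite [t.+1 * _]mulSn sqE.
    move: (iota) (ladder_gain l) (l) => I Gn l0; move: (t * _) (s * I) (s * s) => x y z; clear; lia.
  - move=> i ip; apply/andP; split; last first.
      by apply: leq_trans (ltnW (small i ip)); apply/subset_leq_card/subsetDl.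
    have := large i ip; have := subset_leq_card (subsetIr (VV i) X); have := cardsID X (VV i); rewrite -/(W i).
    have := hr2; have := sg0; have := cX; have := nE9; clear.
    set x := 2 ^ (n - 9); set y := 2 ^ (n - _); lia.
  - by move=> i r _ _ ir; apply: disjointWl (subsetDl _ _) (disjointWr (subsetDl _ _) (VVdis i r ir)).
  - rewrite -card_bigcup_disjoint; last first.
      by move=> i r _ _ ir; apply: disjointWl (subsetDl _ _) (disjointWr (subsetDl _ _) (VVdis i r ir)).
    have : #|V| <= #|\bigcup_(i < s.-1) W i| + #|X|.
      apply: leq_trans (leq_card_setU _ _).1; rewrite -cardsT; apply/subset_leq_card/subsetP => w _.
      rewrite in_setU; have [|wX] := boolP (w \in X); rewrite ?orbT // orbF.
      by apply/bigcupP; exists (Ordinal (attp w)) => //; rewrite in_setD wX inE /=.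
    by move: Vlow; rewrite mulnBr muln1; have := leq_pred s; clear; set q := s.-1 * _; lia.
  - have h8 : 2 ^ (n - 6) = 8 * 2 ^ (n - 9).
      by rewrite -[8]/(2 ^ 3) -expnD; congr (2 ^ _); move: jn; clear; lia.
    move: cX hr2 sg0 B0s B0g; rewrite h8 mulSn; clear.
    set x := 2 ^ (n - 9); set y := 2 ^ (n - _); set q := s * B0; lia.
  - by rewrite ltn_exp2l //; move: jn; clear; lia.
  - apply: leq_trans (leq_mul (leq_mul s2 (leqnn _)) (leqnn _)) _; rewrite -!expnD leq_exp2l //.
    move: sio2 jn; rewrite mul1n; move: (iota) (l) => I l0; clear; lia.
exists U'; split=> //; rewrite -expnD subnK //; move: jn; clear; lia.
Qed.

End Step.

(** * The Ramsey number *)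

Section Final.
Variables (V : finType) (e : rel V).
Hypotheses (e_sym : symmetric e).

(** Among [s - 1] attached sets one has at least [2^n] vertices. This is where the single vertex
    beyond [(s - 1) * (2^n - 1)] counts. *)
Lemma final_cube s n j D U : 0 < n -> 64 * n <= 2 ^ j -> s.-1 * (2 ^ n - 1) < #|V| ->
  D * 2 ^ 6 <= 2 ^ n -> near_partition e n j s.-1 D U -> red_cube e n.
Proof.
move=> n0 hj hV hD st; have [att [attp attU attd]] := attachment st; have [_ low _ _] := st.
pose VV i := [set w | att w == i].
have [/existsP[i hi]|/existsPn h] := boolP [exists i : 'I_(s.-1), 2 ^ n <= #|VV i|]; last first.
  have : #|V| <= s.-1 * (2 ^ n - 1); last by rewrite leqNgt hV.
  rewrite -cardsT (_ : [set: V] = \bigcup_(i < s.-1) VV i); last first.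
    apply/setP => w; rewrite [LHS]inE; apply/esym/bigcupP.
    by exists (Ordinal (attp w)); rewrite // inE.
  apply: leq_trans (card_bigcup_le (k := 2 ^ n - 1) _) _.
    by move=> i _; have := h i; rewrite -ltnNge; have := expn_gt0 2 n; lia.
  by rewrite leq_mul2r -[X in _ <= X]card_ord max_card orbT.
have ip := ltn_ord i.
have UVV : U i \subset VV i by apply/subsetP => w wU; rewrite inE (attU i w ip wU).
(* [U i] may have more than [2^n] vertices, while [exact_cube] wants [U] and [Z] to have [2^n]
   together. *)
have [U0 U0U cU0] : exists2 U0 : {set V}, U0 \subset U i & #|U0| = minn #|U i| (2 ^ n).
  by apply: card_subset_exists; apply: geq_minl.
have [Z ZV cZ] : exists2 Z : {set V}, Z \subset VV i :\: U i & #|Z| = 2 ^ n - #|U0|.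
  apply: card_subset_exists; rewrite cardsD (setIidPr UVV) cU0.
  by have := subset_leq_card UVV; lia.
apply: (exact_cube (U := U0) (Z := Z)) => //.
- apply: disjointWl U0U _; apply: disjointWr ZV _.
  by rewrite -setI_eq0 setIDA setDIl setDv set0I.
- by rewrite cZ subnKC // cU0 geq_minr.
- by have := low i ip; rewrite cZ cU0; move: hD; rewrite -[2 ^ 6]/64; lia.
move=> w wUZ; have wV : w \in VV i.
  move: wUZ; rewrite inE => /orP[/(subsetP U0U)/(subsetP UVV) //|/(subsetP ZV)].
  by rewrite inE => /andP[].
have := attd w; move: wV; rewrite inE => /eqP->; apply: leq_trans.
by apply: leq_mul; first exact: deg_sub.
Qed.
End Final.

Lemma red_cube_exists s : 1 < s -> exists n0, forall n (V : finType) (e : rel V), n0 <= n ->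
  symmetric e -> irreflexive e -> kfree e s [set: V] -> #|V| = s.-1 * (2 ^ n - 1) + 1 ->
  red_cube e n.
Proof.
move=> s1; have [j0 [n1 step]] := ladder_numerics s1; have [n2 base] := @near_partition_start s j0 6 s1 isT.
exists (n1 + n2 + s + 1) => n V e hn e_sym e_irr kf cV; set t := trunc_log 2 n in step *.
have n0 : 0 < n by lia.
have Vlow : s.-1 * (2 ^ n - 1) <= #|V| by rewrite cV leq_addr.
have Vup : #|V| <= s * 2 ^ n.
  rewrite cV -[s in leqRHS](prednK (ltnW s1)) mulSn addnC; apply: leq_add; first by rewrite expn_gt0.
  by rewrite leq_mul2l leq_subr orbT.
(* The alternative [d = 0] gives the start without comparing [j0] to [log n]. The climb ends at
   [t + 8] or above, enough for [64 * n <= 2^(t + 7)]. *)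
have iter d : j0 + d <= t + 9 \/ d = 0 ->
    red_cube e n \/ exists D U, D * 2 ^ 6 <= 2 ^ n /\ near_partition e n (j0 + d) s.-1 D U.
  elim: d => [_|d IH hd].
    rewrite addn0; apply: base => //; last by rewrite Vlow.
    by lia.
  have jt : j0 + d <= t + 8 by lia.
  have [|//|[D [U [hD st]]]] := IH; first by left; lia.
    by left.
  have [||jl sl jbig jn dim] := step n (j0 + d) _ _ jt; [lia|lia|].
  rewrite addnS; exact: (ladder_step e_sym e_irr s1 kf jl sl jbig jn dim Vlow Vup hD st).
have [|//|[D [U [hD st]]]] := iter (t + 8 - j0); first by lia.
apply: (final_cube e_sym n0 _ _ hD st); last by rewrite cV addn1.
have tn := trunc_log_ltn n (isT : 1 < 2).
apply: leq_trans (_ : 2 ^ (t + 7) <= _); last by rewrite leq_exp2l //; lia.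
apply: leq_trans (leq_mul (leqnn 64) (ltnW tn)) _; rewrite -[64]/(2 ^ 6) -expnD leq_exp2l // -/t; lia.
Qed.

Theorem theorem1p1 :
  forall s : nat, 0 < s ->
  exists n0 : nat, forall n : nat, n0 <= n ->
    is_ramsey_number (complete_graph s) (hypercube n)
      ((s - 1) * (2 ^ n - 1) + 1).
Proof.
move=> s s0; have [s1|s1] := leqP s 1.
  have -> : s = 1 by lia.
  exists 1 => n n0; split; last by move=> M; apply: ramsey_lower.
  apply: ramsey_upper => e _ _ /kfree1/setP/(_ ord0); rewrite !inE.
  by [].
have [n0 hn0] := red_cube_exists s1; exists n0.+1 => n hn.
split; last by move=> M; apply: ramsey_lower => //; lia.
apply: ramsey_upper => e e_sym e_irr kf; apply: hn0 => //; first exact: ltnW.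
by rewrite card_ord subn1.
Qed.
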